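(* Let $1<p<\infty$, $X$ a complex Banach space, and $m:\mathbb R^d\to\mathbb C$ an even homogeneous function (i.e. $m(-\xi)=m(\xi)$ and $m(c\xi)=m(\xi)$ for $c>0$) such that $m|_{\mathbb R^d\setminus\{0\}}$ is continuous. Let $A:=\mathrm{Ran}(m|_{\mathbb R^d\setminus\{0\}})\subset\mathbb C$. Then $\|T_m\|_{\mathcal L(L^p(\mathbb R^d;X))}\ge\beta_{p,X}^A$. In particular, if $X$ is not a UMD space and $m$ is not constant, then $T_m$ is unbounded on $L^p(\mathbb R^d;X)$.
   Context: For bounded measurable $m$, the Fourier multiplier $T_m$ is defined on $\mathcal S(\mathbb R^d)\otimes X$ (finite sums $\sum f_k\otimes x_k$ with $f_k$ Schwartz) by $T_m(f\otimes x)=\mathcal F^{-1}(m\mathcal F f)\,x$, where $\mathcal Ff(t)=(2\pi)^{-d}\int e^{-i\langle t,u\rangle}f(u)\,du$ and $\mathcal F^{-1}f(t)=\int e^{i\langle t,u\rangle}f(u)\,du$; $\|T_m\|_{\mathcal L(L^p(\mathbb R^d;X))}$ denotes the norm of its (densely defined) extension, set to $\infty$ if it is unbounded. The UMD$_p^A$ constant $\beta_{p,X}^A\in[0,\infty]$ is the least $\beta\ge0$ such that for every martingale difference sequence $(d_n)_{n=1}^N$ in $L^p(\Omega;X)$ and every deterministic sequence $(\varepsilon_n)_{n=1}^N$ in $A$, $\bigl(\mathbb E\|\sum_n\varepsilon_nd_n\|^p\bigr)^{1/p}\le\beta\bigl(\mathbb E\|\sum_nd_n\|^p\bigr)^{1/p}$.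 $X$ is UMD iff this is finite for $A=\{|\varepsilon|=1\}$.
   Formalization: In the ''in particular'' part, ''m is not constant'' is taken to mean that m is not constant on R^d∖{0}; if m differs only at the origin (e.g. m=1 off 0, m(0)=0), T_m is a multiple of the identity and the claim as worded fails. *)

(* Defs.v *)
From HB Require Import structures.
From mathcomp Require Export all_boot all_order all_algebra.
From mathcomp Require Export complex.
From mathcomp Require Export all_classical all_reals all_analysis.
Export Order.TTheory GRing.Theory Num.Theory numFieldNormedType.Exports.

Set Implicit Arguments.
Unset Strict Implicit.
Unset Printing Implicit Defensive.

Local Open Scope classical_set_scope.
Local Open Scope ring_scope.

Definition expi (R : realType) (t : R) : R[i] := (cos t +i* sin t)%C.

(** real norm of a vector of a complex normed space (the library norm is
    C-valued with vanishing imaginary part) *)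
Definition normX (R : realType) (X : normedModType R[i]) (x : X) : R :=
  complex.Re `|x|.

Definition dotR (R : realType) (d : nat) (t u : 'rV[R]_d) : R :=
  \sum_(j < d) t 0 j * u 0 j.

(** Lebesgue integral over R^d of a nonnegative function, computed as the
    iterated one–dimensional Lebesgue integrals (Tonelli); for d = 0,
    R^0 is a point with unit mass. *)
Fixpoint iintRd (R : realType) (d : nat) : ('rV[R]_d -> \bar R) -> \bar R :=
  match d with
  | 0 => fun f => f 0
  | d'.+1 => fun f =>
      (\int[@lebesgue_measure R]_(x in setT)
          iintRd (fun v : 'rV[R]_d' => f (row_mx (\row_(j < 1) x) v)))%E
  end.

Definition intRd (R : realType) (d : nat) (f : 'rV[R]_d -> R) : R :=
  fine (iintRd (fun v => (Num.max (f v) 0)%:E)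
        - iintRd (fun v => (Num.max (- f v) 0)%:E))%E.

Definition intCd (R : realType) (d : nat) (f : 'rV[R]_d -> R[i]) : R[i] :=
  (intRd (fun v => complex.Re (f v)) +i* intRd (fun v => complex.Im (f v)))%C.

Definition fourier (R : realType) (d : nat) (f : 'rV[R]_d -> R[i])
  (t : 'rV[R]_d) : R[i] :=
  (((2 * pi) ^- d)%:C)%C * intCd (fun u => expi (- dotR t u) * f u).

Definition ifourier (R : realType) (d : nat) (f : 'rV[R]_d -> R[i])
  (t : 'rV[R]_d) : R[i] :=
  intCd (fun u => expi (dotR t u) * f u).

Definition partialR (R : realType) (d : nat) (j : 'I_d)
  (g : 'rV[R]_d -> R) : 'rV[R]_d -> R :=
  fun x => 'D_(delta_mx 0 j) g x.

Fixpoint iterpd (R : realType) (d : nat) (l : seq 'I_d)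
  (g : 'rV[R]_d -> R) : 'rV[R]_d -> R :=
  match l with
  | [::] => g
  | j :: l' => partialR j (iterpd l' g)
  end.

Definition schwartzR (R : realType) (d : nat) (g : 'rV[R]_d -> R) : Prop :=
  forall l : seq 'I_d,
    (forall (j : 'I_d) (x : 'rV[R]_d), derivable (iterpd l g) x (delta_mx 0 j))
    /\ forall N : nat, exists M : R, forall x : 'rV[R]_d,
         (1 + `|x|) ^+ N * `|iterpd l g x| <= M.

Definition schwartz (R : realType) (d : nat) (f : 'rV[R]_d -> R[i]) : Prop :=
  schwartzR (fun x => complex.Re (f x)) /\ schwartzR (fun x => complex.Im (f x)).

Definition LpRd (R : realType) (X : normedModType R[i]) (p : R) (d : nat)
  (F : 'rV[R]_d -> X) : \bar R :=
  poweR (iintRd (fun t => (normX (F t) `^ p)%:E)) p^-1.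

(** element sum_k f_k (x) x_k of S(R^d) (x) X, as a function *)
Definition tensor (R : realType) (X : normedModType R[i]) (d : nat)
  (s : seq (('rV[R]_d -> R[i]) * X)) : 'rV[R]_d -> X :=
  fun t => \sum_(k <- s) (k.1 t) *: k.2.

Definition Tm (R : realType) (X : normedModType R[i]) (d : nat)
  (m : 'rV[R]_d -> R[i]) (s : seq (('rV[R]_d -> R[i]) * X)) : 'rV[R]_d -> X :=
  fun t => \sum_(k <- s) (ifourier (fun u => m u * fourier k.1 u) t) *: k.2.

(** ||T_m||_{L(L^p(R^d;X))}: norm of the extension of T_m from the dense
    subspace S(R^d) (x) X, i.e. the least constant c with
    ||T_m F||_p <= c ||F||_p on S (x) X (+oo if there is none). *)
Definition multnorm (R : realType) (X : normedModType R[i]) (p : R) (d : nat)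
  (m : 'rV[R]_d -> R[i]) : \bar R :=
  ereal_inf [set c%:E | c in [set c : R | 0 <= c /\
     forall s : seq (('rV[R]_d -> R[i]) * X),
       (forall k, k \in s -> schwartz k.1) ->
       (LpRd p (Tm m s) <= c%:E * LpRd p (tensor s))%E]].

Definition strongly_meas (T : Type) (R : realType) (X : normedModType R[i])
  (G : set (set T)) (f : T -> X) : Prop :=
  exists s : nat -> T -> X,
    (forall k, finite_set (range (s k)) /\ forall x, G (s k @^-1` [set x]))
    /\ forall w, (fun k => s k w) @ \oo --> f w.

Definition cint (d0 : measure_display) (T : measurableType d0) (R : realType)
  (mu : {measure set T -> \bar R}) (A : set T) (g : T -> R[i]) : R[i] :=
  (fine (\int[mu]_(w in A) (complex.Re (g w))%:E)%E
   +i* fine (\int[mu]_(w in A) (complex.Im (g w))%:E)%E)%C.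

Definition clinfun (R : realType) (X : normedModType R[i]) (phi : X -> (R[i])^o)
  : Prop :=
  (forall (a : R[i]) (x y : X), phi (a *: x + y) = a * phi x + phi y)
  /\ continuous phi.

Definition LpP (d0 : measure_display) (T : measurableType d0) (R : realType)
  (X : normedModType R[i]) (P : probability T R) (p : R) (F : T -> X) : \bar R :=
  poweR (\int[P]_w (normX (F w) `^ p)%:E)%E p^-1.

(** (ds_n)_{n=1}^N is a martingale difference sequence in L^p(Omega;X)
    w.r.t. the filtration (G_n)_n:  G_n increasing sub-sigma-algebras,
    ds_n strongly G_n-measurable and in L^p, and E[ds_n | G_{n-1}] = 0 for
    2 <= n <= N (tested against all A in G_{n-1} and all continuous linear
    functionals; ds_1 = f_1 is unrestricted since f_0 = 0). *)
Definition mds (d0 : measure_display) (T : measurableType d0) (R : realType)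
  (X : normedModType R[i]) (P : probability T R) (p : R)
  (G : nat -> set (set T)) (ds : nat -> T -> X) (N : nat) : Prop :=
  (forall n, sigma_algebra setT (G n) /\ G n `<=` measurable /\ G n `<=` G n.+1)
  /\ forall n, (1 <= n <= N)%N ->
     [/\ strongly_meas (G n) (ds n),
         (\int[P]_w (normX (ds n w) `^ p)%:E < +oo)%E &
         ((2 <= n)%N -> forall A, G n.-1 A -> forall phi : X -> (R[i])^o,
            clinfun phi -> cint P A (fun w => phi (ds n w)) = 0)].

Definition UMDconst (R : realType) (X : normedModType R[i]) (p : R)
  (A : set R[i]) : \bar R :=
  ereal_inf [set c%:E | c in [set c : R | 0 <= c /\
    forall (d0 : measure_display) (T : measurableType d0) (P : probability T R)
      (G : nat -> set (set T)) (ds : nat -> T -> X) (N : nat) (eps : nat -> R[i]),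
      mds P p G ds N ->
      (forall n, (1 <= n <= N)%N -> A (eps n)) ->
      (LpP P p (fun w => (\sum_(1 <= n < N.+1) eps n *: ds n w)%R)
        <= c%:E * LpP P p (fun w => (\sum_(1 <= n < N.+1) ds n w)%R))%E]].

(* Main.v *)
(** Bourgain's transference argument. If frequencies tend to infinity in the
    direction [xi], then [T_m] acts on the Gaussians modulated by them as the
    multiplication by [m xi], up to a uniformly small error. Using lacunary
    frequencies and averaging over the translations of the torus, a bound for
    [T_m] becomes a bound for trigonometric polynomials on the torus in which
    a monomial is multiplied by [m xi_n], where [n] is its last variable.

    A branching of a finite martingale with probabilities [q] and [1 - q] is
    imitated by a trigonometric polynomial of one variable with values in
    [0,1], with mean [q], and close to an indicator function; convexity of the
    p-th power of the norm then compares the two sides in the right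
    directions. Hence the transforms of finite martingales by values of [m] are
    bounded by the norm of [T_m]. A general martingale difference sequence is
    approximated in L^p by simple functions, made into martingale differences
    by subtracting averages over atoms; Hahn-Banach and Young's inequality show
    that these averages are small.

    If [m] takes two values, then the transforms by them are bounded, hence
    those by 0 and 1, by convexity those by numbers of [0,1], and by linear
    combination those by unimodular numbers. *)

Require Import Defs.
From mathcomp Require Import ring lra measurable_realfun.

Set Implicit Arguments.
Unset Strict Implicit.
Unset Printing Implicit Defensive.

Local Open Scope classical_set_scope.
Local Open Scope ring_scope.

(** * Iterated Lebesgue integrals *)

(** The bound for $T_m$ concerns finite sums of Schwartz functions, and $m$ is continuous only away
    from 0. So a branching cannot be imitated by an indicator function itself, whose Fourier series
    is infinite, and its increment must carry no zero frequency, to which no direction belongs. This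
    is why the polynomial $w$ has mean exactly $q$: if $q x_L + (1-q) x_R = 0$, then $w x_L + (1-w)
    x_R = (w-q)(x_L - x_R)$ has no constant term. Values in [0,1] make convexity exact on the
    untransformed side, while the transformed side loses a multiple of the mean of $w(1-w)$. The
    spectrum of a real polynomial is symmetric, and evenness of $m$ gives opposite frequencies the
    same factor. The multiplier error on $R^d$ is uniform, which is not enough in $L^p$: a second
    Gaussian weight makes it integrable and is flattened at the end, when the ratio of the two
    Gaussian integrals tends to 1. Conditional expectations occur only as finite averages of simple
    functions. Vanishing conditional means are used only through scalar functionals. *)

(** The integral of a nonnegative function is a supremum over the simple functions below it, hence
    monotone without measurability. The functions [Tm m s] are estimated in this way. *)
Lemma ge0_le_integral_nomeas d (T : measurableType d) (R : realType)
    (mu : {measure set T -> \bar R}) (f g : T -> \bar R) :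
  (forall x, 0 <= f x)%E -> (forall x, f x <= g x)%E ->
  (\int[mu]_x f x <= \int[mu]_x g x)%E.
Proof.
move=> f0 fg; have g0 x : (0 <= g x)%E by exact: le_trans (f0 x) (fg x).
rewrite /integral !patch_setT.
have E (h : T -> \bar R) : (forall x, 0 <= h x)%E -> (h^\-)%E = cst 0%E :> (T -> \bar R).
  by move=> h0; apply/funext => x; rewrite funenegE; apply/max_idPr; rewrite leeNl oppe0.
rewrite (E f)// (E g)// leeB//; apply: ge_ereal_sup => _ [h /= hf <-].
apply: ereal_sup_ubound; exists h => //= x; apply: (le_trans (hf x)).
by rewrite !funeposE !max_l.
Qed.

Definition vcons (R : realType) n (x : R) (v : 'rV[R]_n) : 'rV[R]_n.+1 :=
  row_mx (\row_(j < 1) x) v.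

Lemma vcons0 (R : realType) n (x : R) (v : 'rV[R]_n) : vcons x v 0 0 = x.
Proof.
have -> : (0 : 'I_n.+1) = lshift n (0 : 'I_1) by apply: val_inj.
by rewrite /vcons (@row_mxEl _ 1 1 n) mxE.
Qed.

Lemma vconsS (R : realType) n (x : R) (v : 'rV[R]_n) (j : 'I_n) :
  vcons x v 0 (lift 0 j) = v 0 j.
Proof.
have -> : lift 0 j = rshift 1 j by apply: val_inj.
by rewrite /vcons (@row_mxEr _ 1 1 n).
Qed.

Lemma vconsP (R : realType) n (u : 'rV[R]_n.+1) :
  u = vcons (u 0 0) (\row_j u 0 (lift 0 j)).
Proof.
apply/rowP => j; case: (unliftP 0 j) => [i ->|->]; last by rewrite vcons0.
by rewrite vconsS mxE.
Qed.

Section iterated.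
Context (R : realType) (mu : {sigma_finite_measure set (measurableTypeR R) -> \bar R}).

Fixpoint iintm (n : nat) : ('rV[R]_n -> \bar R) -> \bar R :=
  match n with
  | 0 => fun f => f 0
  | n'.+1 => fun f => (\int[mu]_x iintm (fun v : 'rV[R]_n' => f (vcons (x : R) v)))%E
  end.

Definition vmeas d (T : measurableType d) n (h : T -> 'rV[R]_n) :=
  forall j, measurable_fun [set: T] ((fun t => h t 0 j) : T -> R).

(** Joint measurability in the first argument and in the coordinates of the
    second one, phrased through all measurable substitutions, so that no
    sigma-algebra on ['rV_n] is needed. *)
Definition jmeas d (T : measurableType d) n (F : T -> 'rV[R]_n -> \bar R) :=
  forall d' (S : measurableType d') (a : S -> T) (h : S -> 'rV[R]_n),
    measurable_fun setT a -> vmeas h ->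
    measurable_fun [set: S] ((fun s => F (a s) (h s)) : S -> \bar R).

Definition bmeas n (f : 'rV[R]_n -> \bar R) :=
  forall d' (S : measurableType d') (h : S -> 'rV[R]_n),
    vmeas h -> measurable_fun [set: S] ((fun s => f (h s)) : S -> \bar R).

Lemma jmeas_meas d (T : measurableType d) n (F : T -> 'rV[R]_n -> \bar R) v :
  jmeas F -> measurable_fun [set: T] (F ^~ v : T -> \bar R).
Proof. by move=> mF; apply: (mF _ _ id (cst v)) => // j; exact: measurable_cst. Qed.

Lemma vmeas_vcons d (T : measurableType d) n (x : T -> R) (h : T -> 'rV[R]_n) :
  measurable_fun [set: T] (x : T -> R) -> vmeas h -> vmeas (fun t => vcons (x t) (h t)).
Proof.
move=> mx mh j; case: (unliftP 0 j) => [i ->|->].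
  by under eq_fun do rewrite vconsS; exact: mh.
by under eq_fun do rewrite vcons0.
Qed.

Lemma jmeas_vcons d (T : measurableType d) n (F : T -> 'rV[R]_n.+1 -> \bar R) :
  jmeas F -> jmeas (fun (z : T * measurableTypeR R) v => F z.1 (vcons (z.2 : R) v)).
Proof.
move=> mF d' S a h ma mh; apply: mF.
  exact: measurableT_comp measurable_fst ma.
by apply: vmeas_vcons => //; exact: measurableT_comp measurable_snd ma.
Qed.

Lemma jmeas_vcons1 n (f : 'rV[R]_n.+1 -> \bar R) :
  bmeas f -> jmeas (fun (x : measurableTypeR R) v => f (vcons (x : R) v)).
Proof. by move=> mf d' S a h ma mh; apply: mf; exact: vmeas_vcons. Qed.

Lemma bmeas_vcons n (f : 'rV[R]_n.+1 -> \bar R) (x : R) :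
  bmeas f -> bmeas (fun v => f (vcons x v)).
Proof.
move=> mf d' S h mh; apply: mf; apply: vmeas_vcons => //; exact: measurable_cst.
Qed.

Lemma iintm_ge0 n (f : 'rV[R]_n -> \bar R) :
  (forall v, 0 <= f v)%E -> (0 <= iintm f)%E.
Proof.
elim: n f => [|n IH] f f0 /=; first exact: f0.
by apply: integral_ge0 => x _; exact: IH.
Qed.

Lemma eq_iintm n (f g : 'rV[R]_n -> \bar R) : f =1 g -> iintm f = iintm g.
Proof. by move=> /funext ->. Qed.

Lemma le_iintm n (f g : 'rV[R]_n -> \bar R) :
  (forall v, 0 <= f v)%E -> (forall v, f v <= g v)%E -> (iintm f <= iintm g)%E.
Proof.
elim: n f g => [|n IH] f g f0 fg /=; first exact: fg.
apply: ge0_le_integral_nomeas => x; first exact: iintm_ge0.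
exact: IH.
Qed.

Lemma jmeas_iintm d (T : measurableType d) n (F : T -> 'rV[R]_n -> \bar R) :
  jmeas F -> (forall t v, 0 <= F t v)%E ->
  measurable_fun [set: T] ((fun t => iintm (F t)) : T -> \bar R).
Proof.
elim: n d T F => [|n IH] d T F mF F0 /=; first exact: jmeas_meas.
have := @measurable_fun_fubini_tonelli_F _ _ _ _ _ mu
  (fun z : T * measurableTypeR R => iintm (fun v => F z.1 (vcons (z.2 : R) v))).
apply.
- by apply: IH => //; exact: jmeas_vcons.
- by move=> z; exact: iintm_ge0.
Qed.

Lemma measurable_iintm_vcons n (f : 'rV[R]_n.+1 -> \bar R) :
  bmeas f -> (forall v, 0 <= f v)%E ->
  measurable_fun [set: measurableTypeR R] ((fun x => iintm (fun v => f (vcons (x : R) v))) : measurableTypeR R -> \bar R).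
Proof.
move=> mf f0; apply: jmeas_iintm => //; exact: jmeas_vcons1.
Qed.

Lemma tonelli_iintm d (T : measurableType d)
    (P : {sigma_finite_measure set T -> \bar R}) n (F : T -> 'rV[R]_n -> \bar R) :
  jmeas F -> (forall t v, 0 <= F t v)%E ->
  (\int[P]_t iintm (F t) = iintm (fun v => \int[P]_t F t v))%E.
Proof.
elim: n F => [//|n IH] F mF F0 /=.
rewrite (@fubini_tonelli _ _ _ _ _ P mu
  (fun z => iintm (fun v => F z.1 (vcons (z.2 : R) v))))/=.
- apply: eq_integral => x _; rewrite IH//.
  move=> d' S a h ma mh; apply: mF => //.
  by apply: vmeas_vcons => //; exact: measurable_cst.
- by apply: jmeas_iintm => //; exact: jmeas_vcons.
- by move=> z; exact: iintm_ge0.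
Qed.

Lemma bmeas_mul n (f g : 'rV[R]_n -> \bar R) : bmeas f -> bmeas g ->
  bmeas (fun v => f v * g v)%E.
Proof. by move=> mf mg d S h mh; apply: emeasurable_funM; [exact: mf|exact: mg]. Qed.

Lemma bmeas_cst n (k : \bar R) : bmeas (fun _ : 'rV[R]_n => k).
Proof. by move=> d S h mh; exact: measurable_cst. Qed.

Lemma iintmD n (f g : 'rV[R]_n -> \bar R) :
  bmeas f -> bmeas g -> (forall v, 0 <= f v)%E -> (forall v, 0 <= g v)%E ->
  (iintm (fun v => f v + g v) = iintm f + iintm g)%E.
Proof.
elim: n f g => [//|n IH] f g mf mg f0 g0 /=.
rewrite -ge0_integralD//.
- by apply: eq_integral => x _; apply: IH => //; exact: bmeas_vcons.
- by move=> x _; exact: iintm_ge0.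
- exact: measurable_iintm_vcons.
- by move=> x _; exact: iintm_ge0.
- exact: measurable_iintm_vcons.
Qed.

Lemma iintmZl n (k : \bar R) (f : 'rV[R]_n -> \bar R) :
  (0 <= k)%E -> bmeas f -> (forall v, 0 <= f v)%E ->
  (iintm (fun v => k * f v) = k * iintm f)%E.
Proof.
elim: n f => [//|n IH] f k0 mf f0 /=.
rewrite -ge0_integralZl//.
- by apply: eq_integral => x _; apply: IH => //; exact: bmeas_vcons.
- exact: measurable_iintm_vcons.
- by move=> x _; exact: iintm_ge0.
Qed.

End iterated.

Lemma iintRdE (R : realType) d (f : 'rV[R]_d -> \bar R) :
  iintRd f = iintm lebesgue_measure f.
Proof.
by elim: d f => [//|d IH] f /=; apply: eq_integral => x _; rewrite IH.
Qed.

Definition jmeas2 (R : realType) k n (F : 'rV[R]_k -> 'rV[R]_n -> \bar R) :=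
  forall d' (S : measurableType d') (a : S -> 'rV[R]_k) (h : S -> 'rV[R]_n),
    vmeas a -> vmeas h -> measurable_fun [set: S] ((fun s => F (a s) (h s)) : S -> \bar R).

Lemma exchange_iintm (R : realType)
    (mu nu : {sigma_finite_measure set (measurableTypeR R) -> \bar R})
    k n (F : 'rV[R]_k -> 'rV[R]_n -> \bar R) :
  jmeas2 F -> (forall u v, 0 <= F u v)%E ->
  (iintm mu (fun u => iintm nu (F u)) = iintm nu (fun v => iintm mu (F ^~ v)))%E.
Proof.
elim: k F => [//|k IH] F mF F0 /=.
under eq_integral => x _.
  rewrite IH//; last first.
    move=> d' S a h ma mh; apply: mF => //.
    by apply: vmeas_vcons => //; exact: measurable_cst.
  over.
rewrite (@tonelli_iintm _ nu _ _ mu n (fun x v => iintm mu (fun u => F (vcons x u) v)))//.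
- move=> d' S a h ma mh; apply: jmeas_iintm => //.
  move=> d'' S' a' h' ma' mh'; apply: mF.
    by apply: vmeas_vcons => //; exact: measurableT_comp ma ma'.
  by move=> j; exact: measurableT_comp (mh j) ma'.
- by move=> x v; exact: iintm_ge0.
Qed.

Lemma rV_norm_le (R : realType) n (v : 'rV[R]_n) (e : R) :
  0 <= e -> (forall j, `|v 0 j| <= e) -> `|v| <= e.
Proof.
move=> e0 ve; rewrite -[`|v|]/(mx_norm v); have [->|] := eqVneq (mx_norm v) 0; first exact: e0.
move=> /mx_norm_neq0[[i j]] /= ->; rewrite ord1; exact: ve.
Qed.

Lemma coord_le_norm (R : realType) n (v : 'rV[R]_n) j : `|v 0 j| <= `|v|.
Proof.
rewrite -[leRHS]/(mx_norm v) mx_normrE.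
by rewrite (le_bigmax _ (fun i : 'I_1 * 'I_n => `|v i.1 i.2|) (0, j)).
Qed.

Definition rmeas (R : realType) n (f : 'rV[R]_n -> R) :=
  forall d' (S : measurableType d') (h : S -> 'rV[R]_n),
    vmeas h -> measurable_fun [set: S] ((fun s => f (h s)) : S -> R).

Lemma rmeas_bmeas (R : realType) n (f : 'rV[R]_n -> R) :
  rmeas f -> bmeas (fun v => (f v)%:E).
Proof. by move=> mf d S h mh; apply/measurable_EFinP; exact: mf. Qed.

(* The coordinates of h are rounded down to multiples of 1/(k+1); this maps
   into a countable set, and 0 is mapped to 0, so continuity at 0 is not
   needed. *)
Lemma continuous_rmeas (R : realType) n (f : 'rV[R]_n -> R) :
  (forall v, v != 0 -> {for v, continuous f}) -> rmeas f.
Proof.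
move=> cf d S h mh.
pose z k (s : S) : 'rV[int]_n := \row_j Num.floor ((k.+1)%:R * h s 0 j).
pose r k (w : 'rV[int]_n) : 'rV[R]_n := \row_j ((w 0 j)%:~R / (k.+1)%:R).
have k0 k : (0 : R) < k.+1%:R by rewrite ltr0n.
have rz k s j : `|h s 0 j - r k (z k s) 0 j| <= k.+1%:R^-1.
  rewrite !mxE; have /andP[] := floor_itv (k.+1%:R * h s 0 j).
  set y := (Num.floor _); rewrite intrD => y1 y2.
  have -> : h s 0 j - y%:~R / k.+1%:R = (k.+1%:R * h s 0 j - y%:~R) / k.+1%:R.
    by rewrite mulrBl mulrAC divff ?mul1r ?gt_eqF.
  have k0' : 0 <= k.+1%:R^-1 :> R by rewrite invr_ge0.
  rewrite normrM [X in _ * X]ger0_norm// ler_piMl// ger0_norm ?subr_ge0//.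
  by rewrite lerBlDl ltW.
apply: (@measurable_fun_cvg _ _ _ _ (fun k s => f (r k (z k s)))).
  move=> k _ Y mY; rewrite setTI.
  have -> : (fun s => f (r k (z k s))) @^-1` Y =
      \bigcup_(w : 'rV[int]_n) (if f (r k w) \in Y then z k @^-1` [set w] else set0).
    apply/seteqP; split => [s /= Ys|s [w _]].
      by exists (z k s) => //; rewrite mem_set.
    by case: ifPn => // /set_mem Yw /= zw; rewrite /preimage/= zw.
  apply: countable_bigcupT_measurable => // w; case: ifPn => // _.
  have -> : z k @^-1` [set w] = \bigcap_(j in [set: 'I_n])
      ((fun s => h s 0 j) @^-1` `[(w 0 j)%:~R / k.+1%:R, (w 0 j + 1)%:~R / k.+1%:R[).
    have E s j : (Num.floor (k.+1%:R * h s 0 j) == w 0 j) =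
        (h s 0 j \in `[(w 0 j)%:~R / k.+1%:R, (w 0 j + 1)%:~R / k.+1%:R[).
      by rewrite floor_eq in_itv/= ler_pdivrMr// ltr_pdivlMr// mulrC.
    apply/seteqP; split => [s /= zw j _|s /= H] /=.
      by rewrite -E -zw mxE.
    by apply/rowP => j; rewrite mxE; apply/eqP; rewrite E; exact: H.
  apply: fin_bigcap_measurable => // j _.
  by rewrite -[X in measurable X]setTI; apply: mh => //; exact: measurable_itv.
move=> s _; have [hs0|hs0] := eqVneq (h s) 0.
  have -> : (fun k => f (r k (z k s))) = cst (f (h s)).
    apply/funext => k /=; congr f; apply/rowP => j.
    by rewrite !mxE hs0 mxE mulr0 floor0 mul0r.
  exact: cvg_cst.
apply: (continuous_cvg _ (cf _ hs0)).
apply/cvgrPdist_le => e e0.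
have /cvgrPdist_le/(_ _ e0) := @cvg_harmonic R.
apply: filterS => k; rewrite sub0r normrN /= ger0_norm ?invr_ge0// => ke.
apply: (le_trans _ ke); apply: rV_norm_le; first by rewrite invr_ge0.
by move=> j; rewrite !mxE; have := rz k s j; rewrite !mxE.
Qed.

Section rmeas_closure.
Context (R : realType) (n : nat).
Implicit Types f g : 'rV[R]_n -> R.

Lemma rmeas_add f g : rmeas f -> rmeas g -> rmeas (fun v => f v + g v).
Proof. by move=> mf mg d S h mh; apply: measurable_funD; [exact: mf|exact: mg]. Qed.

Lemma rmeas_mul f g : rmeas f -> rmeas g -> rmeas (fun v => f v * g v).
Proof. by move=> mf mg d S h mh; apply: measurable_funM; [exact: mf|exact: mg]. Qed.

Lemma rmeas_opp f : rmeas f -> rmeas (fun v => - f v).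
Proof. by move=> mf d S h mh; apply: measurableT_comp => //; exact: mf. Qed.

Lemma rmeas_cst (c : R) : rmeas (fun _ : 'rV[R]_n => c).
Proof. by move=> d S h mh; exact: measurable_cst. Qed.

Lemma rmeas_max f g : rmeas f -> rmeas g -> rmeas (fun v => Num.max (f v) (g v)).
Proof. by move=> mf mg d S h mh; apply: measurable_maxr; [exact: mf|exact: mg]. Qed.

Lemma rmeas_abs f : rmeas f -> rmeas (fun v => `|f v|).
Proof. by move=> mf d S h mh; apply: measurableT_comp => //; exact: mf. Qed.

End rmeas_closure.

(** * Linearity and product formulas for the integral on R^d *)

Section lebesgue_rV.
Context (R : realType).
Local Notation iint := (iintm (@lebesgue_measure R)).

Definition intgr n (f : 'rV[R]_n -> R) :=
  rmeas f /\ (iint (fun v => `|f v|%:E) < +oo)%E.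

Lemma intgr_le n (f g : 'rV[R]_n -> R) :
  rmeas f -> (forall v, `|f v| <= g v) -> intgr g -> intgr f.
Proof.
move=> mf fg [mg gi]; split=> //; apply: le_lt_trans gi.
apply: le_iintm => v; rewrite lee_fin// (le_trans (fg v))//; exact: ler_norm.
Qed.

Lemma intgrD n (f g : 'rV[R]_n -> R) :
  intgr f -> intgr g -> intgr (fun v => f v + g v).
Proof.
move=> [mf fi] [mg gi]; split; first exact: rmeas_add.
apply: (@le_lt_trans _ _ (iint (fun v => `|f v|%:E + `|g v|%:E)%E)).
  by apply: le_iintm => v; rewrite -?EFinD lee_fin//; exact: ler_normD.
rewrite iintmD ?lte_add_pinfty//;
  by [apply: rmeas_bmeas; exact: rmeas_abs | move=> v; rewrite lee_fin].
Qed.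

Lemma intgrZ n (c : R) (f : 'rV[R]_n -> R) :
  intgr f -> intgr (fun v => c * f v).
Proof.
move=> [mf fi]; split; first by apply: rmeas_mul => //; exact: rmeas_cst.
under eq_iintm do rewrite normrM EFinM.
rewrite iintmZl//; last by apply: rmeas_bmeas; exact: rmeas_abs.
by rewrite lte_mul_pinfty// lee_fin.
Qed.

Lemma intgr_abs n (f : 'rV[R]_n -> R) : intgr f -> intgr (fun v => `|f v|).
Proof.
by move=> [mf fi]; apply: (intgr_le _ _ (conj (rmeas_abs mf) _)) => [|v|];
  [exact: rmeas_abs| rewrite normr_id |under eq_iintm do rewrite normr_id].
Qed.

Lemma intgr_iint_fin n (f : 'rV[R]_n -> R) : intgr f -> (forall v, 0 <= f v) ->
  iint (fun v => (f v)%:E) \is a fin_num.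
Proof.
move=> [mf fi] f0; rewrite ge0_fin_numE; last by apply: iintm_ge0 => v; rewrite lee_fin.
by apply: le_lt_trans fi; apply: le_iintm => v; rewrite lee_fin// ler_norm.
Qed.

Lemma intRd_ge0 n (f : 'rV[R]_n -> R) : (forall v, 0 <= f v) ->
  intRd f = fine (iint (fun v => (f v)%:E)).
Proof.
move=> f0; rewrite /intRd !iintRdE.
under eq_iintm do rewrite max_l//.
rewrite [X in (_ - X)%E](_ : _ = 0%E) ?sube0//.
under eq_iintm do rewrite max_r ?oppr_le0//.
elim: n {f f0} => [//|n IH] /=.
by under eq_integral do rewrite IH; rewrite integral0.
Qed.

(** [intRd] is defined through positive and negative parts, which do not add up. Since $f^+ + h = g
    + f^-$, any difference of nonnegative integrable functions computes the same integral; linearity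
    is derived from this. *)
Lemma intRd_sub n (f g h : 'rV[R]_n -> R) :
  intgr g -> intgr h -> (forall v, 0 <= g v) -> (forall v, 0 <= h v) ->
  (forall v, f v = g v - h v) ->
  intRd f = intRd g - intRd h.
Proof.
move=> ig ih g0 h0 fE; rewrite (intRd_ge0 g0) (intRd_ge0 h0).
have mf : rmeas f.
  rewrite (_ : f = fun v => g v - h v); last exact/funext.
  by apply: rmeas_add; [exact: ig.1|apply: rmeas_opp; exact: ih.1].
pose fp v := Num.max (f v) 0; pose fn v := Num.max (- f v) 0.
have mfp : rmeas fp by apply: rmeas_max => //; exact: rmeas_cst.
have mfn : rmeas fn by apply: rmeas_max; [exact: rmeas_opp|exact: rmeas_cst].
have fp0 v : 0 <= fp v by rewrite le_max lexx orbT.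
have fn0 v : 0 <= fn v by rewrite le_max lexx orbT.
have fpg v : `|fp v| <= g v.
  by rewrite ger0_norm// ge_max g0 andbT fE lerBlDr lerDl.
have fnh v : `|fn v| <= h v.
  by rewrite ger0_norm// ge_max h0 andbT fE opprB lerBlDr lerDl.
have ifp : intgr fp by exact: (intgr_le mfp fpg).
have ifn : intgr fn by exact: (intgr_le mfn fnh).
have : (iint (fun v => (fp v)%:E) + iint (fun v => (h v)%:E) =
        iint (fun v => (g v)%:E) + iint (fun v => (fn v)%:E))%E.
  rewrite -!iintmD//; do ?[by apply: rmeas_bmeas; first [done|exact: ig.1|exact: ih.1]
    | by move=> v; rewrite lee_fin].
  apply: eq_iintm => v; rewrite -!EFinD; congr (_%:E).
  rewrite /fp /fn fE /Num.max; case: ifPn; case: ifPn; lra.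
rewrite /intRd !iintRdE -/fp -/fn.
have := intgr_iint_fin ifp fp0; have := intgr_iint_fin ifn fn0.
have := intgr_iint_fin ig g0; have := intgr_iint_fin ih h0.
move=> /fineK <- /fineK <- /fineK <- /fineK <-.
move: (fine _) (fine _) (fine _) (fine _) => x y z t.
by rewrite -!EFinD => -[] /=; lra.
Qed.

Lemma intRdE n (f : 'rV[R]_n -> R) : intgr f ->
  intRd f = intRd (fun v => `|f v| + f v) - intRd (fun v => `|f v|).
Proof.
move=> fi; apply: intRd_sub.
- by apply: intgrD => //; exact: intgr_abs.
- exact: intgr_abs.
- by move=> v; rewrite -lerBlDr sub0r -normrN ler_norm.
- by [].
- by move=> v; ring.
Qed.

Lemma intRdD_ge0 n (f g : 'rV[R]_n -> R) :
  intgr f -> intgr g -> (forall v, 0 <= f v) -> (forall v, 0 <= g v) ->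
  intRd (fun v => f v + g v) = intRd f + intRd g.
Proof.
move=> fi gi f0 g0; rewrite !intRd_ge0//; last by move=> v; rewrite addr_ge0.
under eq_iintm do rewrite EFinD.
rewrite iintmD//; do ?[by apply: rmeas_bmeas; first [done|exact: fi.1|exact: gi.1]
    | by move=> v; rewrite lee_fin].
by rewrite fineD//; exact: intgr_iint_fin.
Qed.

Lemma intRdD n (f g : 'rV[R]_n -> R) : intgr f -> intgr g ->
  intRd (fun v => f v + g v) = intRd f + intRd g.
Proof.
move=> fi gi; have [fa ga] := (intgr_abs fi, intgr_abs gi).
have P h : intgr h -> intgr (fun v => `|h v| + h v).
  by move=> hi; apply: intgrD => //; exact: intgr_abs.
have P0 (h : 'rV[R]_n -> R) v : 0 <= `|h v| + h v by rewrite -lerBlDr sub0r -normrN ler_norm.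
rewrite (@intRd_sub _ _ (fun v => (`|f v| + f v) + (`|g v| + g v)) (fun v => `|f v| + `|g v|)).
- rewrite (intRdD_ge0 (P _ _ fi) (P _ _ gi))// (intRdD_ge0 fa ga)//.
  by rewrite (intRdE fi) (intRdE gi); ring.
- by apply: intgrD; exact: P.
- exact: intgrD.
- by move=> v; rewrite addr_ge0.
- by move=> v; rewrite addr_ge0.
- by move=> v; ring.
Qed.

Lemma intRdN n (f : 'rV[R]_n -> R) : intgr f -> intRd (fun v => - f v) = - intRd f.
Proof.
move=> fi; have fa := intgr_abs fi; rewrite (intRdE fi) opprB; apply: intRd_sub => //.
- by apply: intgrD.
- by move=> v; rewrite -lerBlDr sub0r -normrN ler_norm.
- by move=> v; ring.
Qed.

Lemma intRdZ n (c : R) (f : 'rV[R]_n -> R) : intgr f ->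
  intRd (fun v => c * f v) = c * intRd f.
Proof.
wlog c0 : c / 0 <= c.
  move=> H fi; have [c0|c0] := leP 0 c; first exact: H.
  have -> : (fun v => c * f v) = (fun v => - ((- c) * f v)).
    by apply/funext => v; rewrite mulNr opprK.
  rewrite intRdN; last exact: intgrZ.
  by rewrite H ?oppr_ge0 ?ltW// mulNr opprK.
move=> fi; have fa := intgr_abs fi.
have Z (g : 'rV[R]_n -> R) : intgr g -> (forall v, 0 <= g v) ->
    intRd (fun v => c * g v) = c * intRd g.
  move=> gi g0; rewrite !intRd_ge0//; last by move=> v; rewrite mulr_ge0.
  under eq_iintm do rewrite EFinM.
  rewrite iintmZl ?lee_fin//; first by rewrite fineM//; exact: intgr_iint_fin.
  by apply: rmeas_bmeas; exact: gi.1.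
have f0 v : 0 <= `|f v| + f v by rewrite -lerBlDr sub0r -normrN ler_norm.
have fai : intgr (fun v => `|f v| + f v) by exact: intgrD.
rewrite (intRdE fi) mulrBr -!Z//; apply: intRd_sub.
- exact: intgrZ.
- exact: intgrZ.
- by move=> v; rewrite mulr_ge0.
- by move=> v; rewrite mulr_ge0.
- by move=> v; ring.
Qed.

Lemma intRd_le_ge0 n (f g : 'rV[R]_n -> R) : intgr g -> (forall v, 0 <= f v) ->
  (forall v, f v <= g v) -> intRd f <= intRd g.
Proof.
move=> gi f0 fg; have g0 v : 0 <= g v by exact: le_trans (f0 v) (fg v).
rewrite !intRd_ge0//; have gf := intgr_iint_fin gi g0.
have le : (iint (fun v => (f v)%:E) <= iint (fun v => (g v)%:E))%E.
  by apply: le_iintm => v; rewrite lee_fin.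
apply: fine_le => //; rewrite ge0_fin_numE.
  by apply: le_lt_trans le _; rewrite -ge0_fin_numE// iintm_ge0// => v; rewrite lee_fin.
by apply: iintm_ge0 => v; rewrite lee_fin.
Qed.

Lemma le_abs_intRd n (f g : 'rV[R]_n -> R) : rmeas f -> intgr g ->
  (forall v, `|f v| <= g v) -> `|intRd f| <= intRd g.
Proof.
move=> mf gi fg; have fi := intgr_le mf fg gi; have fa := intgr_abs fi.
have E1 := intRdE fi.
have f0 v : 0 <= `|f v| + f v by rewrite -lerBlDr sub0r -normrN ler_norm.
have E2 : intRd (fun v => `|f v| + f v) <= intRd (fun v => `|f v| + `|f v|).
  apply: intRd_le_ge0 => //; first exact: intgrD.
  by move=> v; rewrite lerD2l ler_norm.
rewrite (intRdD_ge0 fa fa)// in E2.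
have E3 : 0 <= intRd (fun v => `|f v| + f v).
  by rewrite intRd_ge0// fine_ge0// iintm_ge0// => v; rewrite lee_fin.
have E4 : intRd (fun v => `|f v|) <= intRd g by exact: intRd_le_ge0.
rewrite ler_norml; lra.
Qed.

Lemma iint_prod n (a : R -> R) (b : 'rV[R]_n -> R) :
  measurable_fun setT a -> (forall x, 0 <= a x) -> rmeas b -> (forall v, 0 <= b v) ->
  iint (fun u : 'rV[R]_n.+1 => (a (u 0 0) * b (\row_j u 0 (lift 0 j)))%:E) =
  ((\int[@lebesgue_measure R]_x (a x)%:E) * iint (fun v => (b v)%:E))%E.
Proof.
move=> ma a0 mb b0 /=.
rewrite muleC -ge0_integralZl//.
- apply: eq_integral => x _; rewrite muleC -iintmZl ?lee_fin//.
  + by apply: eq_iintm => v; rewrite -EFinM vcons0; congr (_ * b _)%:E;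
      apply/rowP => j; rewrite mxE vconsS.
  + exact: rmeas_bmeas.
- exact/measurable_EFinP.
- by move=> x _; rewrite lee_fin.
- by apply: iintm_ge0 => v; rewrite lee_fin.
Qed.

Lemma rmeas_prod n (a : R -> R) (b : 'rV[R]_n -> R) :
  measurable_fun setT a -> rmeas b ->
  rmeas (fun u : 'rV[R]_n.+1 => a (u 0 0) * b (\row_j u 0 (lift 0 j))).
Proof.
move=> ma mb; apply: rmeas_mul => d S h mh.
  exact: measurableT_comp ma (mh _).
apply: mb => j; rewrite (_ : (fun _ => _) = (fun s => h s 0 (lift 0 j))); first exact: mh.
by apply/funext => s; rewrite mxE.
Qed.

Lemma intgr_prod n (a : R -> R) (b : 'rV[R]_n -> R) :
  (@lebesgue_measure R).-integrable setT (EFin \o a) -> intgr b ->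
  intgr (fun u : 'rV[R]_n.+1 => a (u 0 0) * b (\row_j u 0 (lift 0 j))).
Proof.
move=> /integrableP[/measurable_EFinP ma ai] [mb bi].
split; first exact: rmeas_prod.
under eq_iintm do rewrite normrM.
rewrite (iint_prod (a := fun x => `|a x|) (b := fun v => `|b v|))//.
- by rewrite lte_mul_pinfty ?integral_ge0// ge0_fin_numE ?integral_ge0.
- exact: measurableT_comp.
- exact: rmeas_abs.
Qed.

Lemma intRd_prod n (a : R -> R) (b : 'rV[R]_n -> R) :
  (@lebesgue_measure R).-integrable setT (EFin \o a) -> intgr b ->
  intRd (fun u : 'rV[R]_n.+1 => a (u 0 0) * b (\row_j u 0 (lift 0 j))) =
  fine (\int[@lebesgue_measure R]_x (a x)%:E) * intRd b.
Proof.
move=> ai bi; have /integrableP[/measurable_EFinP ma aoo] := ai.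
have ba := intgr_abs bi.
have aa : (@lebesgue_measure R).-integrable setT (EFin \o (fun x => `|a x|)).
  exact: (integrable_abse ai).
have aaa : (@lebesgue_measure R).-integrable setT (EFin \o (fun x => `|a x| + a x)).
  exact: (integrableD measurableT aa ai).
have a0 x : 0 <= `|a x| + a x by rewrite -lerBlDr sub0r -normrN ler_norm.
have b0 v : 0 <= `|b v| + b v by rewrite -lerBlDr sub0r -normrN ler_norm.
have bai : intgr (fun v => `|b v| + b v) by exact: intgrD.
have Q (a' : R -> R) (b' : 'rV[R]_n -> R) : (@lebesgue_measure R).-integrable setT (EFin \o a') ->
   intgr b' -> (forall x, 0 <= a' x) -> (forall v, 0 <= b' v) ->
   intRd (fun u : 'rV[R]_n.+1 => a' (u 0 0) * b' (\row_j u 0 (lift 0 j))) =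
    fine (\int[@lebesgue_measure R]_x (a' x)%:E) * intRd b'.
  move=> ai' bi' a0' b0'; rewrite intRd_ge0; last by move=> u; rewrite mulr_ge0.
  rewrite iint_prod//; last 2 first.
    by have /integrableP[/measurable_EFinP] := ai'.
    exact: bi'.1.
  by rewrite fineM ?(intRd_ge0 b0')//; [exact: integrable_fin_num|exact: intgr_iint_fin].
have Qi := @intgr_prod n.
(* With $A = |a| + a$ and $B = |b| + b$ one has $ab = (A - |a|)(B - |b|)$; the four products are
   sorted by sign. *)
rewrite (@intRd_sub _ _
  (fun u : 'rV[R]_n.+1 => (`|a (u 0 0)| + a (u 0 0)) * (`|b (\row_j u 0 (lift 0 j))| + b (\row_j u 0 (lift 0 j)))
     + `|a (u 0 0)| * `|b (\row_j u 0 (lift 0 j))|)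
  (fun u : 'rV[R]_n.+1 => (`|a (u 0 0)| + a (u 0 0)) * `|b (\row_j u 0 (lift 0 j))|
     + `|a (u 0 0)| * (`|b (\row_j u 0 (lift 0 j))| + b (\row_j u 0 (lift 0 j))))).
- rewrite !intRdD_ge0; try (by move=> v; rewrite mulr_ge0); last first.
  all: try exact: (Qi _ _ aa ba).
  all: try exact: (Qi _ _ aaa ba).
  all: try exact: (Qi _ _ aa bai).
  all: try exact: (Qi _ _ aaa bai).
  rewrite (Q _ _ aaa bai)// (Q _ _ aa ba)// (Q _ _ aaa ba)// (Q _ _ aa bai)//.
  rewrite (intRdE bi).
  under eq_integral do rewrite EFinD.
  rewrite integralD// fineD; [ring|exact: integrable_fin_num|exact: integrable_fin_num].
- by apply: intgrD; [exact: (Qi _ _ aaa bai)|exact: (Qi _ _ aa ba)].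
- by apply: intgrD; [exact: (Qi _ _ aaa ba)|exact: (Qi _ _ aa bai)].
- by move=> u; rewrite addr_ge0// mulr_ge0.
- by move=> u; rewrite addr_ge0// mulr_ge0.
- by move=> u; ring.
Qed.

End lebesgue_rV.

Section complex_parts.
Context (R : realType).
Implicit Types z w : R[i].

Lemma ReD z w : complex.Re (z + w) = complex.Re z + complex.Re w.
Proof. by case: z w => [a b] [c d]. Qed.
Lemma ImD z w : complex.Im (z + w) = complex.Im z + complex.Im w.
Proof. by case: z w => [a b] [c d]. Qed.
Lemma ReM z w : complex.Re (z * w) =
  complex.Re z * complex.Re w - complex.Im z * complex.Im w.
Proof. by case: z w => [a b] [c d]. Qed.
Lemma ImM z w : complex.Im (z * w) =
  complex.Re z * complex.Im w + complex.Im z * complex.Re w.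
Proof. by case: z w => [a b] [c d] /=; rewrite addrC. Qed.
Lemma ReN z : complex.Re (- z) = - complex.Re z.
Proof. by case: z. Qed.
Lemma ImN z : complex.Im (- z) = - complex.Im z.
Proof. by case: z. Qed.

Lemma complexP z w :
  complex.Re z = complex.Re w -> complex.Im z = complex.Im w -> z = w.
Proof. by case: z w => [a b] [c d] /= -> ->. Qed.

End complex_parts.

Section complex_integral.
Context (R : realType).
Local Notation leb := (@lebesgue_measure R).

Definition cintgr n (f : 'rV[R]_n -> R[i]) :=
  intgr (fun u => complex.Re (f u)) /\ intgr (fun u => complex.Im (f u)).

Lemma intCdD n (f g : 'rV[R]_n -> R[i]) : cintgr f -> cintgr g ->
  intCd (fun u => f u + g u) = intCd f + intCd g.
Proof.
move=> [f1 f2] [g1 g2]; apply: complexP; rewrite ?ReD ?ImD /=.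
  by under [in LHS]eq_fun do rewrite ReD; exact: intRdD.
by under [in LHS]eq_fun do rewrite ImD; exact: intRdD.
Qed.

Lemma cintgrZ n (a : R[i]) (f : 'rV[R]_n -> R[i]) : cintgr f ->
  cintgr (fun u => a * f u).
Proof.
move=> [f1 f2]; split.
  under eq_fun do rewrite ReM -mulNr.
  by apply: intgrD; exact: intgrZ.
under eq_fun do rewrite ImM.
by apply: intgrD; exact: intgrZ.
Qed.

Lemma intCdZ n (a : R[i]) (f : 'rV[R]_n -> R[i]) : cintgr f ->
  intCd (fun u => a * f u) = a * intCd f.
Proof.
move=> [f1 f2]; apply: complexP; rewrite ?ReM ?ImM /=.
  under [in LHS]eq_fun do rewrite ReM -mulNr.
  rewrite intRdD; [|exact: intgrZ|exact: intgrZ].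
  by rewrite !intRdZ// mulNr.
under [in LHS]eq_fun do rewrite ImM.
rewrite intRdD; [|exact: intgrZ|exact: intgrZ].
by rewrite !intRdZ.
Qed.

Definition cintg1 (a : R -> R[i]) :=
  leb.-integrable setT (fun x => (complex.Re (a x))%:E) /\
  leb.-integrable setT (fun x => (complex.Im (a x))%:E).

Lemma intCd_prod n (a : R -> R[i]) (b : 'rV[R]_n -> R[i]) :
  cintg1 a -> cintgr b ->
  cintgr (fun u : 'rV[R]_n.+1 => a (u 0 0) * b (\row_j u 0 (lift 0 j))) /\
  intCd (fun u : 'rV[R]_n.+1 => a (u 0 0) * b (\row_j u 0 (lift 0 j))) =
  cint leb setT a * intCd b.
Proof.
move=> [a1 a2] [b1 b2].
have p11 := intgr_prod a1 b1; have p22 := intgr_prod a2 b2.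
have p12 := intgr_prod a1 b2; have p21 := intgr_prod a2 b1.
split.
  split.
    under eq_fun do rewrite ReM -mulN1r.
    by apply: intgrD; [exact: p11|apply: intgrZ; exact: p22].
  under eq_fun do rewrite ImM.
  by apply: intgrD; [exact: p12|exact: p21].
apply: complexP; rewrite ?ReM ?ImM /=.
  under [in LHS]eq_fun do rewrite ReM -mulN1r.
  rewrite (intRdD p11 (intgrZ (-1) p22)) (intRdZ _ p22) mulN1r.
  by rewrite (intRd_prod a1 b1) (intRd_prod a2 b2).
under [in LHS]eq_fun do rewrite ImM.
by rewrite (intRdD p12 p21) (intRd_prod a1 b2) (intRd_prod a2 b1).
Qed.

Lemma intCd_bigprod d (h : 'I_d -> R -> R[i]) : (forall j, cintg1 (h j)) ->
  cintgr (fun u : 'rV[R]_d => \prod_(j < d) h j (u 0 j)) /\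
  intCd (fun u : 'rV[R]_d => \prod_(j < d) h j (u 0 j)) =
  \prod_(j < d) cint leb setT (h j).
Proof.
elim: d h => [|d IH] h hi.
  have E : (fun u : 'rV[R]_0 => \prod_(j < 0) h j (u 0 j)) = fun=> 1.
    by apply/funext => u; rewrite big_ord0.
  rewrite E big_ord0; split.
    split; split; rewrite /= ?normr1 ?normr0 ?ltry//; exact: rmeas_cst.
  by apply: complexP; rewrite /= intRd_ge0.
have [IH1 IH2] := IH (fun j => h (lift 0 j)) (fun j => hi _).
have [P1 P2] := intCd_prod (hi 0) IH1.
have E : (fun u : 'rV[R]_d.+1 => \prod_(j < d.+1) h j (u 0 j)) =
    (fun u => h 0 (u 0 0) * \prod_(j < d) h (lift 0 j) ((\row_j u 0 (lift 0 j)) 0 j)).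
  apply/funext => u; rewrite big_ord_recl; congr (_ * _).
  by apply: eq_bigr => j _; rewrite mxE.
by rewrite E P2 IH2 big_ord_recl; split.
Qed.

End complex_integral.

(** * Gaussians and their Fourier transform *)

Section translation.
Context (R : realType).
Local Notation leb := (@lebesgue_measure R).

Lemma lebesgue_measure_shift (c : R) (A : set R) : measurable (A : set (measurableTypeR R)) ->
  pushforward leb ((fun x => x + c) : measurableTypeR R -> measurableTypeR R) A = leb A.
Proof.
have mc : measurable_fun setT ((fun x => x + c) : measurableTypeR R -> measurableTypeR R).
  exact: measurable_funD.
move=> mA; apply/esym/lebesgue_measure_unique => //= _ [[a b]] _ <-.
rewrite /pushforward (_ : _ @^-1` _ = `]a - c, b - c]%classic).
  rewrite !lebesgue_measure_itv/= !lte_fin ltrD2r.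
  by case: ifP => // _; congr (_%:E); ring.
by apply/seteqP; split => x; rewrite /= !in_itv/= ltrBlDr lerBrDr.
Qed.

Lemma ge0_integral_shift (c : R) (f : R -> \bar R) :
  measurable_fun [set: measurableTypeR R] (f : measurableTypeR R -> \bar R) ->
  (forall x, 0 <= f x)%E ->
  (\int[leb]_x f (x + c)%R = \int[leb]_x f x)%E.
Proof.
move=> mf f0.
have mc : measurable_fun setT ((fun x => x + c) : measurableTypeR R -> measurableTypeR R).
  exact: measurable_funD.
have := @ge0_integral_pushforward _ _ _ _ R _ mc leb setT f measurableT mf (fun y _ => f0 y).
rewrite preimage_setT => <-.
by apply: eq_measure_integral => A mA _; exact/lebesgue_measure_shift.
Qed.

Lemma integral_shift (c : R) (f : R -> R) : measurable_fun setT f ->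
  (\int[leb]_x (f (x + c)%R)%:E = \int[leb]_x (f x)%:E)%E.
Proof.
move=> mf; rewrite integralE [RHS]integralE.
have mc : measurable_fun setT ((fun x => x + c) : measurableTypeR R -> measurableTypeR R).
  exact: measurable_funD.
have mF : measurable_fun setT (EFin \o f) by exact/measurable_EFinP.
congr (_ - _)%E.
  have := @ge0_integral_shift c (EFin \o f)^\+%E (measurable_funepos mF) (funepos_ge0 _).
  by move=> <-; apply: eq_integral => x _; rewrite !funeposE.
have := @ge0_integral_shift c (EFin \o f)^\-%E (measurable_funeneg mF) (funeneg_ge0 _).
by move=> <-; apply: eq_integral => x _; rewrite !funenegE.
Qed.

Lemma integrable_shift (c : R) (f : R -> R) :
  leb.-integrable setT (EFin \o f) -> leb.-integrable setT (EFin \o (fun x => f (x + c))).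
Proof.
move=> /integrableP[/measurable_EFinP mf fi]; apply/integrableP; split.
  apply/measurable_EFinP; apply: measurableT_comp => //; exact: measurable_funD.
by rewrite (@ge0_integral_shift c (fun x => `|f x|%:E))//; apply/measurable_EFinP;
  exact: measurableT_comp.
Qed.

End translation.

Section gaussian_integral.
Context (R : realType).
Local Notation leb := (@lebesgue_measure R).

Lemma gauss_integral (a l : R) : 0 < a ->
  leb.-integrable setT (EFin \o (fun x => expR (- (a * (x - l) ^+ 2)))) /\
  (\int[leb]_x (expR (- (a * (x - l) ^+ 2)))%:E = (Num.sqrt (pi / a))%:E)%E.
Proof.
(* The normal law of variance $1/(2a)$ has a density proportional to the integrand. *)
move=> a0; pose s := Num.sqrt (a *+ 2)^-1.
have s0 : s != 0 by rewrite gt_eqF// sqrtr_gt0 invr_gt0 pmulrn_lgt0.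
have s2 : s ^+ 2 = (a *+ 2)^-1 by rewrite sqr_sqrtr// invr_ge0 mulrn_wge0// ltW.
have E x : expR (- (a * (x - l) ^+ 2)) = (normal_peak s)^-1 * normal_pdf l s x.
  rewrite normal_pdfE// mulKf ?gt_eqF ?normal_peak_gt0// /normal_fun s2.
  congr expR; rewrite mulNr; congr (- _).
  rewrite mulrC -[(a *+ 2)^-1 *+ 2]mulr_natr -[a *+ 2]mulr_natr; field.
  by rewrite gt_eqF.
have ni := integrable_normal_pdf l s.
split.
  rewrite (_ : _ \o _ = fun x => ((normal_peak s)^-1)%:E * (normal_pdf l s x)%:E)%E.
    exact: integrableZl.
  by apply/funext => x; rewrite /= E EFinM.
under eq_integral do rewrite E EFinM.
rewrite integralZl// integral_normal_pdf mule1 /normal_peak invrK s2.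
congr (_%:E); congr (Num.sqrt _).
rewrite -(mulr_natr (_ * pi)) -(mulr_natr a); move: (pi : R) => q; field.
by rewrite gt_eqF.
Qed.

Lemma is_derive_under_integral (f df : R -> R -> R) (G : R -> R) (a : R) :
  (forall x, leb.-integrable setT (EFin \o f x)) ->
  (forall x y : R, is_derive x (1 : R) (f ^~ y) (df x y)) ->
  leb.-integrable setT (EFin \o G) ->
  (forall x y, `|x - a| < 1 -> `|df x y| <= G y) ->
  is_derive a (1 : R) (fun x => fine (\int[leb]_y (f x y)%:E)) (fine (\int[leb]_y (df a y)%:E)).
Proof.
move=> fi dff Gi dfG.
have G0 y : 0 <= G y by apply: le_trans (dfG a y _); rewrite ?subrr ?normr0.
have aI : `]a - 1, a + 1[%classic a by rewrite /= in_itv/= ltrBlDr ltrDl ltr01.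
have pE x y : partial1of2 f x y = df x y.
  by rewrite /partial1of2 derive1E; exact: derive_val.
have dI x y : `]a - 1, a + 1[%classic x -> [set: R] y -> `|partial1of2 f x y| <= G y.
  rewrite /= in_itv/= => /andP[x1 x2] _; rewrite pE; apply: dfG.
  by rewrite ltr_norml; apply/andP; split; lra.
have df' x y : `]a - 1, a + 1[%classic x -> [set: R] y -> derivable (f ^~ y) x 1.
  by move=> _ _; exact: (@ex_derive _ _ _ _ _ _ _ (dff x y)).
have H1 := @derivable_under_integral R _ _ leb f setT measurableT a _ _ aI
  (fun x _ => fi x) df' G G0 Gi dI.
have H2 := @differentiation_under_integral R _ _ leb f setT measurableT a _ _ aI
  (fun x _ => fi x) df' G G0 Gi dI.
apply: DeriveDef; first exact: H1.
rewrite -derive1E; apply: etrans H2 _.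
by rewrite /Rintegral; under eq_integral do rewrite /= pE.
Qed.

(* Translation invariance makes x |-> \int G (x + s) ds constant. *)
Lemma integral_derive_eq0 (G dG H : R -> R) :
  (forall x : R, is_derive x (1 : R) G (dG x)) ->
  leb.-integrable setT (EFin \o G) ->
  leb.-integrable setT (EFin \o H) ->
  (forall x s, `|x| < 1 -> `|dG (x + s)| <= H s) ->
  fine (\int[leb]_s (dG s)%:E) = 0.
Proof.
move=> dGG Gi Hi dGH.
have /integrableP[/measurable_EFinP mG _] := Gi.
have D : is_derive (0 : R) (1 : R) (fun x => fine (\int[leb]_y (G (x + (y : R)))%:E))
    (fine (\int[leb]_y (dG (0 + (y : R)))%:E)).
  apply: (@is_derive_under_integral (fun x y => G (x + y)) (fun x y => dG (x + y)) H).
  - move=> x; under [X in _.-integrable _ (_ \o X)]eq_fun do rewrite addrC.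
    exact: integrable_shift.
  - move=> x y; have := dGG (x + y) => dd.
    have -> : (fun x => G (x + y)) = G \o (fun x => x + y) by [].
    have d2 : is_derive x (1 : R) (fun x => x + y) 1.
      by apply: is_derive_eq; rewrite addr0.
    by have := @is_derive1_comp R G (fun x => x + y) x _ _ dd d2; rewrite mulr1.
  - exact: Hi.
  - by move=> x y; rewrite subr0; exact: dGH.
have := @derive_val _ _ _ _ _ _ _ D.
under eq_integral do rewrite add0r.
move=> <-.
have -> : (fun x => fine (\int[leb]_y (G (x + (y : R)))%:E)) = cst (fine (\int[leb]_y (G y)%:E)).
  apply/funext => x /=; rewrite -(integral_shift x mG); congr fine.
  by apply: eq_integral => y _; rewrite addrC.
exact: derive_cst.
Qed.

End gaussian_integral.

Section gaussian_fourier.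
Context (R : realType).
Local Notation leb := (@lebesgue_measure R).

Definition gs (s : R) : R := expR (- (2^-1 * s ^+ 2)).

Lemma norm_cos_le1 (x : R) : `|cos x| <= 1.
Proof. by rewrite ler_norml cos_le1 cos_geN1. Qed.

Lemma norm_sin_le1 (x : R) : `|sin x| <= 1.
Proof. by rewrite ler_norml sin_le1 sin_geN1. Qed.

Lemma gs_gt0 s : 0 < gs s. Proof. exact: expR_gt0. Qed.

Lemma is_derive_gs (x : R) : is_derive x (1 : R) gs (- x * gs x).
Proof.
have d1 : is_derive x (1 : R) (fun s : R => - (2^-1 * s ^+ 2)) (- x).
  by apply: is_derive_eq; rewrite /GRing.scale/=; field.
by have := @is_derive1_comp R expR (fun s => - (2^-1 * s ^+ 2)) x _ _ (is_derive_expR _) d1;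
  rewrite mulrC.
Qed.

Lemma gs_itg : leb.-integrable setT (EFin \o gs) /\
  (\int[leb]_x (gs x)%:E = (Num.sqrt (pi *+ 2))%:E)%E.
Proof.
have [H1 H2] := @gauss_integral R 2^-1 0 ltac:(by rewrite invr_gt0).
have E : (fun x => expR (- (2^-1 * (x - 0) ^+ 2))) = gs by apply/funext => x; rewrite subr0.
rewrite E in H1; split => //; move: H2.
under eq_integral do rewrite subr0.
by move=> ->; rewrite invrK mulr_natr.
Qed.

Lemma measurable_gs : measurable_fun setT gs.
Proof. by have [/integrableP[/measurable_EFinP]] := gs_itg. Qed.

Lemma integrable_cos_gs t : leb.-integrable setT (EFin \o (fun s => cos (t * s) * gs s)).
Proof.
apply: (le_integrable measurableT _ _ gs_itg.1).
  apply/measurable_EFinP; apply: measurable_funM; last exact: measurable_gs.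
  apply: measurableT_comp; first exact: (continuous_measurable_fun (@continuous_cos R)).
  exact: measurable_funM.
move=> s _; rewrite lee_fin normrM ler_piMl//.
by rewrite ler_norml cos_le1 cos_geN1.
Qed.

Lemma integrable_sin_gs t : leb.-integrable setT (EFin \o (fun s => sin (t * s) * gs s)).
Proof.
apply: (le_integrable measurableT _ _ gs_itg.1).
  apply/measurable_EFinP; apply: measurable_funM; last exact: measurable_gs.
  apply: measurableT_comp; first exact: (continuous_measurable_fun (@continuous_sin R)).
  exact: measurable_funM.
move=> s _; rewrite lee_fin normrM ler_piMl//.
by rewrite ler_norml sin_le1 sin_geN1.
Qed.

(* The shift by [0] is the one of [gauss_integral]. *)
Definition gs4 (a s : R) : R := expR (- (a * (s - 0) ^+ 2)).

(** Half of the exponent absorbs the linear factor, since $|y| \le 1 + y^2/4 \le e^{y^2/4}$. *)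
Lemma gs_bound (y : R) : `|y| * gs y <= gs4 4^-1 y.
Proof.
rewrite /gs /gs4 subr0.
have -> : - (4^-1 * y ^+ 2) = 4^-1 * y ^+ 2 - 2^-1 * y ^+ 2 by field.
rewrite expRD ler_wpM2r ?expR_ge0//.
apply: (le_trans _ (expR_ge1Dx _)).
rewrite -(real_normK (num_real y)) ; move: `|y| => z.
have := sqr_ge0 (z / 2 - 1); rewrite -subr_ge0 => H; move: H.
by rewrite !expr2; lra.
Qed.

Lemma gs_le4 (y : R) : gs y <= gs4 4^-1 y.
Proof.
by rewrite /gs /gs4 subr0 ler_expR lerN2 ler_wpM2r ?sqr_ge0// lef_pV2 ?posrE//; lra.
Qed.

Lemma integrable_id_gs (t : R) (b : R -> R) : measurable_fun setT b -> (forall x, `|b x| <= 1) ->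
  leb.-integrable setT (fun s => (s * b (t * s) * gs s)%:E).
Proof.
have [i4 _] := @gauss_integral R 4^-1 0 ltac:(by rewrite invr_gt0).
move=> mb b1; apply: (le_integrable measurableT _ _ i4).
  apply/measurable_EFinP; apply: measurable_funM; last exact: measurable_gs.
  apply: measurable_funM => //; apply: measurableT_comp => //; exact: measurable_funM.
move=> s _; rewrite lee_fin !normrM (ger0_norm (ltW (gs_gt0 _))) [leRHS]ger0_norm ?expR_ge0//.
by apply: le_trans (gs_bound s); rewrite ler_wpM2r ?(ltW (gs_gt0 _))// ler_piMr.
Qed.

(** Dominates all translates by less than 1 at once, as [integral_derive_eq0] requires. The
    exponents differ by $x^2/4 - (2x+s)^2/8 \le 1/4$. *)
Lemma gs4_shift (x s : R) : `|x| < 1 -> gs4 4^-1 (x + s) <= expR 4^-1 * gs4 8^-1 s.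
Proof.
move=> x1; rewrite /gs4 !subr0 -expRD ler_expR.
have x2 : x ^+ 2 <= 1 by rewrite -(real_normK (num_real x)) expr_le1// ltW.
have := sqr_ge0 (2 * x + s); rewrite !expr2 in x2 *; nra.
Qed.

(* Integration by parts: the Gaussian Fourier integrals solve a linear differential
   equation in [t]. *)
Lemma gs_cos_sin_eq (t : R) :
  fine (\int[leb]_s (s * sin (t * s) * gs s)%:E) =
    t * fine (\int[leb]_s (cos (t * s) * gs s)%:E) /\
  fine (\int[leb]_s (s * cos (t * s) * gs s)%:E) =
    - t * fine (\int[leb]_s (sin (t * s) * gs s)%:E).
Proof.
have lin (x : R) : is_derive x (1 : R) ( *%R t) t.
  by apply: is_derive_eq; rewrite /GRing.scale/= mulr1.
have dc (x : R) : is_derive x (1 : R) (fun s => cos (t * s) * gs s)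
    (- t * (sin (t * x) * gs x) - x * cos (t * x) * gs x).
  have d1 := @is_derive1_comp R cos ( *%R t) x _ _ (is_derive_cos _) (lin x).
  have d2 := is_derive_gs x.
  apply: (is_derive_eq (is_deriveM d1 d2)).
  by rewrite /GRing.scale/=; ring.
have ds (x : R) : is_derive x (1 : R) (fun s => sin (t * s) * gs s)
    (t * (cos (t * x) * gs x) - x * sin (t * x) * gs x).
  have d1 := @is_derive1_comp R sin ( *%R t) x _ _ (is_derive_sin _) (lin x).
  have d2 := is_derive_gs x.
  apply: (is_derive_eq (is_deriveM d1 d2)).
  by rewrite /GRing.scale/=; ring.
have [i8 _] := @gauss_integral R 8^-1 0 ltac:(by rewrite invr_gt0).
have [i4 _] := @gauss_integral R 4^-1 0 ltac:(by rewrite invr_gt0).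
pose H s := (`|t| + 1) * expR 4^-1 * gs4 8^-1 s.
have iH : leb.-integrable setT (EFin \o H).
  rewrite (_ : _ \o _ = fun s => (((`|t| + 1) * expR 4^-1)%:E * (gs4 8^-1 s)%:E)%E).
    exact: integrableZl.
  by apply/funext => s; rewrite /= EFinM.
have bnd (t' a b x s : R) : `|t'| = `|t| -> `|x| < 1 -> `|a| <= 1 -> `|b| <= 1 ->
    `|t' * (a * gs (x + s)) - (x + s) * b * gs (x + s)| <= H s.
  move=> tt x1 a1 b1.
  have -> : H s = `|t| * (expR 4^-1 * gs4 8^-1 s) + expR 4^-1 * gs4 8^-1 s.
    by rewrite /H; ring.
  apply: (le_trans (ler_normB _ _)); apply: lerD.
    rewrite !normrM tt (ger0_norm (ltW (gs_gt0 _))) ler_wpM2l//.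
    apply: (@le_trans _ _ (gs (x + s))); first by rewrite ler_piMl// ltW// gs_gt0.
    by apply: (le_trans (gs_le4 _)); exact: gs4_shift.
  rewrite !normrM (ger0_norm (ltW (gs_gt0 _))).
  apply: (@le_trans _ _ (`|x + s| * gs (x + s))).
    by rewrite ler_wpM2r ?(ltW (gs_gt0 _))// ler_piMr.
  by apply: (le_trans (gs_bound _)); exact: gs4_shift.
have nc := norm_cos_le1; have ns := norm_sin_le1.
have isin := integrable_id_gs t (continuous_measurable_fun (@continuous_sin R)) ns.
have icos := integrable_id_gs t (continuous_measurable_fun (@continuous_cos R)) nc.
have Es := integral_derive_eq0 ds (integrable_sin_gs t) iH
  (fun x s x1 => bnd _ _ _ x s erefl x1 (nc _) (ns _)).
have Ec := integral_derive_eq0 dc (integrable_cos_gs t) iH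
  (fun x s x1 => bnd _ _ _ x s (normrN t) x1 (ns _) (nc _)).
split.
  move: Es; under eq_integral do rewrite EFinB EFinM.
  rewrite integralB//; last by apply: integrableZl => //; exact: integrable_cos_gs.
  rewrite integralZl//; last exact: integrable_cos_gs.
  rewrite fineB ?fineM//; last 3 first.
  - by apply: integrable_fin_num => //; exact: integrable_cos_gs.
  - by rewrite fin_numM//; apply: integrable_fin_num => //; exact: integrable_cos_gs.
  - exact: integrable_fin_num.
  by move/eqP; rewrite subr_eq0 => /eqP <-.
move: Ec; under eq_integral do rewrite EFinB EFinM.
rewrite integralB//; last by apply: integrableZl => //; exact: integrable_sin_gs.
rewrite integralZl//; last exact: integrable_sin_gs.
rewrite fineB ?fineM//; last 3 first.
- by apply: integrable_fin_num => //; exact: integrable_sin_gs.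
- by rewrite fin_numM//; apply: integrable_fin_num => //; exact: integrable_sin_gs.
- exact: integrable_fin_num.
by move/eqP; rewrite subr_eq0 => /eqP <-.
Qed.

End gaussian_fourier.

Section gaussian_fourier_formula.
Context (R : realType).
Local Notation leb := (@lebesgue_measure R).

(** The product of [f] with $e^{t^2/2}$ has derivative zero. *)
Lemma ode_gs (f : R -> R) : (forall t : R, is_derive t (1 : R) f (- t * f t)) ->
  forall t, f t = f 0 * gs t.
Proof.
move=> df t.
have d1 (x : R) : is_derive x (1 : R) (fun s : R => 2^-1 * s ^+ 2) x.
  by apply: is_derive_eq; rewrite /GRing.scale/=; field.
have d2 (x : R) : is_derive x (1 : R) (fun s : R => expR (2^-1 * s ^+ 2)) (expR (2^-1 * x ^+ 2) * x).
  exact: (@is_derive1_comp R expR (fun s => 2^-1 * s ^+ 2) x _ _ (is_derive_expR _) (d1 x)).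
have d3 (x : R) : is_derive x (1 : R) (fun s => f s * expR (2^-1 * s ^+ 2)) 0.
  by apply: (is_derive_eq (is_deriveM (df x) (d2 x))); rewrite /GRing.scale/=; ring.
have := @is_derive_0_is_cst R (fun s => f s * expR (2^-1 * s ^+ 2)) t 0 d3.
rewrite /= expr0n/= mulr0 expR0 mulr1 => <-.
by rewrite /gs expRN mulfK// gt_eqF// expR_gt0.
Qed.

Lemma norm_id_gs (b t s : R) : `|b| <= 1 -> `|s * b * gs s| <= gs4 4^-1 s.
Proof.
move=> b1; rewrite !normrM (ger0_norm (ltW (gs_gt0 _))); apply: le_trans (gs_bound s).
by rewrite ler_wpM2r ?(ltW (gs_gt0 _))// ler_piMr.
Qed.

(** Differentiation under the integral sign and [gs_cos_sin_eq] give the differential equation of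
    [ode_gs]; the value at 0 is the Gaussian integral. *)
Lemma integral_cos_gs (t : R) :
  fine (\int[leb]_s (cos (t * s) * gs s)%:E) = Num.sqrt (pi *+ 2) * gs t.
Proof.
have [i4 _] := @gauss_integral R 4^-1 0 ltac:(by rewrite invr_gt0).
apply: (etrans (@ode_gs (fun t => fine (\int[leb]_s (cos (t * s) * gs s)%:E)) _ t)); last first.
  congr (_ * _); under eq_integral do rewrite mul0r cos0 mul1r.
  by rewrite (@gs_itg R).2.
move=> {}t; rewrite mulNr -(@gs_cos_sin_eq R t).1.
have isin := integrable_id_gs t (continuous_measurable_fun (@continuous_sin R)) (@norm_sin_le1 R).
have -> : - fine (\int[leb]_s (s * sin (t * s) * gs s)%:E) =
    fine (\int[leb]_s (- 1 * (s * sin (t * s) * gs s))%:E).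
  under [in RHS]eq_integral do rewrite EFinM.
  by rewrite integralZl// fineM ?mulN1r//; exact: integrable_fin_num.
apply: (@is_derive_under_integral R (fun t s => cos (t * s) * gs s)
  (fun t s => - 1 * (s * sin (t * s) * gs s)) (gs4 4^-1)).
- by move=> x; exact: integrable_cos_gs.
- move=> x y.
  have lin : is_derive x (1 : R) (fun x => x * y) y.
    by apply: is_derive_eq; rewrite /GRing.scale/=; ring.
  have d1 := @is_derive1_comp R cos (fun x => x * y) x _ _ (is_derive_cos _) lin.
  by apply: (is_derive_eq (is_deriveM d1 (is_derive_cst (gs y) x 1))); rewrite /GRing.scale/=; ring.
- exact: i4.
- by move=> x y _; rewrite mulN1r normrN; apply: norm_id_gs => //; exact: norm_sin_le1.
Qed.

Lemma integral_sin_gs (t : R) :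
  fine (\int[leb]_s (sin (t * s) * gs s)%:E) = 0.
Proof.
have [i4 _] := @gauss_integral R 4^-1 0 ltac:(by rewrite invr_gt0).
apply: (etrans (@ode_gs (fun t => fine (\int[leb]_s (sin (t * s) * gs s)%:E)) _ t)); last first.
  under eq_integral do rewrite mul0r sin0 mul0r.
  by rewrite integral0 mul0r.
move=> {}t; rewrite -(@gs_cos_sin_eq R t).2.
apply: (@is_derive_under_integral R (fun t s => sin (t * s) * gs s)
  (fun t s => s * cos (t * s) * gs s) (gs4 4^-1)).
- by move=> x; exact: integrable_sin_gs.
- move=> x y.
  have lin : is_derive x (1 : R) (fun x => x * y) y.
    by apply: is_derive_eq; rewrite /GRing.scale/=; ring.
  have d1 := @is_derive1_comp R sin (fun x => x * y) x _ _ (is_derive_sin _) lin.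
  by apply: (is_derive_eq (is_deriveM d1 (is_derive_cst (gs y) x 1))); rewrite /GRing.scale/=; ring.
- exact: i4.
- by move=> x y _; apply: norm_id_gs => //; exact: norm_cos_le1.
Qed.

Lemma cint_expi_gs (t l : R) :
  cintg1 (fun s => expi (t * s) * (gs (s - l))%:C%C) /\
  cint leb setT (fun s => expi (t * s) * (gs (s - l))%:C%C) =
    (Num.sqrt (pi *+ 2) * gs t)%:C%C * expi (t * l).
Proof.
pose C s := cos (t * s) * gs s; pose S s := sin (t * s) * gs s.
pose A s := cos (t * l) * C s - sin (t * l) * S s.
pose B s := sin (t * l) * C s + cos (t * l) * S s.
have iC := integrable_cos_gs t; have iS := integrable_sin_gs t.
have iZ (c : R) (f : R -> R) : leb.-integrable setT (EFin \o f) ->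
    leb.-integrable setT (fun s => c%:E * (f s)%:E)%E by move=> fi; exact: integrableZl.
have iA : leb.-integrable setT (EFin \o A).
  by apply: (integrableB _ (iZ _ _ iC) (iZ _ _ iS)).
have iB : leb.-integrable setT (EFin \o B).
  by apply: (integrableD _ (iZ _ _ iC) (iZ _ _ iS)).
have mA : measurable_fun setT A by have /integrableP[/measurable_EFinP] := iA.
have mB : measurable_fun setT B by have /integrableP[/measurable_EFinP] := iB.
have EA s : complex.Re (expi (t * s) * (gs (s - l))%:C%C) = A (s - l).
  rewrite ReM /= mulr0 subr0 /A /C /S.
  by rewrite {1}(_ : t * s = t * l + t * (s - l)); [rewrite cosD; ring|ring].
have EB s : complex.Im (expi (t * s) * (gs (s - l))%:C%C) = B (s - l).
  rewrite ImM /= mulr0 add0r /B /C /S.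
  by rewrite {1}(_ : t * s = t * l + t * (s - l)); [rewrite sinD; ring|ring].
have fC : (\int[leb]_x (C x)%:E)%E \is a fin_num by exact: integrable_fin_num.
have fS : (\int[leb]_x (S x)%:E)%E \is a fin_num by exact: integrable_fin_num.
split.
  split; first by under eq_fun do rewrite EA; exact: (integrable_shift (- l) iA).
  by under eq_fun do rewrite EB; exact: (integrable_shift (- l) iB).
apply: complexP; rewrite /cint ?ReM ?ImM [LHS]/= [RHS]/= mul0r ?subr0 ?addr0.
  transitivity (fine (\int[leb]_s (A (s - l)%R)%:E)).
    by congr fine; apply: eq_integral => s _; rewrite -EA.
  rewrite (integral_shift (- l) mA) /A; under eq_integral do rewrite EFinB !EFinM.
  rewrite integralB//; [|exact: iZ|exact: iZ].
  rewrite !integralZl// fineB ?fin_numM// !fineM// integral_cos_gs integral_sin_gs.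
  by rewrite mulr0 subr0 mulrC.
transitivity (fine (\int[leb]_s (B (s - l)%R)%:E)).
  by congr fine; apply: eq_integral => s _; rewrite -EB.
rewrite (integral_shift (- l) mB) /B; under eq_integral do rewrite EFinD !EFinM.
rewrite integralD//; [|exact: iZ|exact: iZ].
rewrite !integralZl// fineD ?fin_numM// !fineM// integral_cos_gs integral_sin_gs.
by rewrite mulr0 addr0 mulrC.
Qed.

End gaussian_fourier_formula.

Import ComplexField.Normc.

Section norms.
Context (R : realType).
Implicit Types z w : R[i].

Lemma normCE z : `|z| = (normc z)%:C%C.
Proof. by []. Qed.

Lemma normc_ge0 z : 0 <= normc z.
Proof. by case: z => a b; exact: sqrtr_ge0. Qed.

Lemma normcD z w : normc (z + w) <= normc z + normc w.
Proof. exact: le_normcD. Qed.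

Lemma normc_Re z : `|complex.Re z| <= normc z.
Proof. by have := normc_ge_Re z; rewrite lecR. Qed.

Lemma normc_Im z : `|complex.Im z| <= normc z.
Proof.
case: z => a b /=; rewrite -(sqrtr_sqr b) ler_wsqrtr// lerDr; exact: sqr_ge0.
Qed.

Lemma normc_le z : normc z <= `|complex.Re z| + `|complex.Im z|.
Proof.
case: z => a b /=; rewrite -[leRHS]ger0_norm ?addr_ge0//.
rewrite -sqrtr_sqr ler_wsqrtr// -(real_normK (num_real a)) -(real_normK (num_real b)).
have := mulr_ge0 (normr_ge0 a) (normr_ge0 b); rewrite !expr2; nra.
Qed.

Lemma normc_real (a : R) : normc (a%:C%C) = `|a|.
Proof. by rewrite /= expr0n addr0 sqrtr_sqr. Qed.

Lemma normc_expi (t : R) : normc (expi t) = 1.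
Proof. by rewrite /expi /= cos2Dsin2 sqrtr1. Qed.

Lemma expiD (s t : R) : expi (s + t) = expi s * expi t.
Proof.
by apply: complexP; rewrite ?ReM ?ImM /= ?cosD ?sinD//; ring.
Qed.

Lemma expi0 : expi (0 : R) = 1.
Proof. by rewrite /expi cos0 sin0. Qed.

Lemma expi_sum (I : Type) (r : seq I) (F : I -> R) :
  expi (\sum_(j <- r) F j) = \prod_(j <- r) expi (F j).
Proof.
by elim: r => [|i r IH]; rewrite ?big_nil ?expi0// !big_cons expiD IH.
Qed.

Context (X : normedModType R[i]).
Implicit Types x y : X.

Lemma normXE x : `|x| = (normX x)%:C%C.
Proof.
have : 0 <= `|x| by [].
by rewrite lecE /= => /andP[/eqP E _]; apply: complexP.
Qed.

Lemma normX_ge0 x : 0 <= normX x.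
Proof. by have : 0 <= `|x| by []; rewrite normXE lecR. Qed.

Lemma normXD x y : normX (x + y) <= normX x + normX y.
Proof. by rewrite -lecR rmorphD /= -!normXE; exact: ler_normD. Qed.

Lemma normXZ z x : normX (z *: x) = normc z * normX x.
Proof. by apply: (@complexI R); rewrite rmorphM /= -!normXE normrZ. Qed.

Lemma normX0 : normX (0 : X) = 0.
Proof. by rewrite /normX normr0. Qed.

Lemma normXN x : normX (- x) = normX x.
Proof. by rewrite /normX normrN. Qed.

Lemma normXC x y : normX (x - y) = normX (y - x).
Proof. by rewrite -normXN opprB. Qed.

Lemma normX_sum (I : Type) (r : seq I) (F : I -> X) :
  normX (\sum_(j <- r) F j) <= \sum_(j <- r) normX (F j).
Proof.
elim: r => [|i r IH]; rewrite ?big_nil ?normX0// !big_cons.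
by apply: (le_trans (normXD _ _)); rewrite lerD2l.
Qed.

Lemma normXBl x y : normX x - normX y <= normX (x - y).
Proof. by rewrite lerBlDr; have := normXD (x - y) y; rewrite subrK. Qed.

Lemma normXBr x y : normX y - normX x <= normX (x - y).
Proof. by rewrite normXC normXBl. Qed.

Lemma normX_cvg (u : nat -> X) (x : X) :
  u @ \oo --> x <-> forall e : R, 0 < e -> \forall k \near \oo, normX (x - u k) < e.
Proof.
split=> [/cvgrPdist_lt H e e0|H].
  have e0' : 0 < e%:C%C :> R[i] by rewrite ltcR.
  by have := H _ e0'; apply: filterS => k; rewrite normXE ltcR.
apply/cvgrPdist_lt => e e0; have [/eqP ei re] : complex.Im e == 0 /\ 0 < complex.Re e.
  by move: e0; rewrite ltcE /= => /andP[].
have := H _ re; apply: filterS => k; rewrite normXE ltcE /= ei eqxx.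
exact.
Qed.

End norms.

(** * The multiplier on modulated Gaussians *)

Section gaussian_wave.
Context (R : realType) (d : nat).
Local Notation leb := (@lebesgue_measure R).
Implicit Types t u L : 'rV[R]_d.

Definition gauss t : R := \prod_(j < d) gs (t 0 j).

Definition wave L t : R[i] := expi (dotR L t) * (gauss t)%:C%C.

Lemma gauss_ge0 t : 0 <= gauss t.
Proof. by apply: prodr_ge0 => j _; exact: ltW (gs_gt0 _). Qed.

(** The constant $1/\sqrt{2\pi}$: in each coordinate, the Gaussian integral $\sqrt{2\pi}$ times the
    factor $(2\pi)^{-1}$ that [fourier] carries. *)
Definition kap : R := Num.sqrt (pi *+ 2) / (2 * pi).

Lemma kap_sqrt : kap * Num.sqrt (pi *+ 2) = 1.
Proof.
rewrite /kap; have p0 : (0 : R) < 2 * pi by rewrite mulr_gt0// pi_gt0.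
have -> : pi *+ 2 = 2 * pi :> R by rewrite [RHS]mulr_natl.
rewrite mulrAC -expr2 sqr_sqrtr; last exact: ltW.
by rewrite divff// gt_eqF.
Qed.

Lemma kap_ge0 : 0 <= kap.
Proof. by rewrite divr_ge0// mulr_ge0// pi_ge0. Qed.

Lemma prod_realC (I : Type) (r : seq I) (F : I -> R) :
  (\prod_(j <- r) F j)%:C%C = \prod_(j <- r) (F j)%:C%C :> R[i].
Proof. exact: rmorph_prod. Qed.

Lemma wave_prod (a b : 'rV[R]_d) t :
  expi (dotR a t) * (gauss (t - b))%:C%C =
  \prod_(j < d) (expi (a 0 j * t 0 j) * (gs (t 0 j - b 0 j))%:C%C).
Proof.
rewrite /dotR expi_sum /gauss prod_realC -big_split/=.
by apply: eq_bigr => j _; rewrite !mxE.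
Qed.

Lemma intCd_wave (a b : 'rV[R]_d) :
  cintgr (fun t => expi (dotR a t) * (gauss (t - b))%:C%C) /\
  intCd (fun t => expi (dotR a t) * (gauss (t - b))%:C%C) =
    (Num.sqrt (pi *+ 2) ^+ d * gauss a)%:C%C * expi (dotR a b).
Proof.
have [H1 H2] := @intCd_bigprod R d
  (fun j s => expi (a 0 j * s) * (gs (s - b 0 j))%:C%C) (fun j => (cint_expi_gs _ _).1).
have E : (fun t => expi (dotR a t) * (gauss (t - b))%:C%C) =
    (fun t => \prod_(j < d) (expi (a 0 j * t 0 j) * (gs (t 0 j - b 0 j))%:C%C)).
  by apply/funext => t; rewrite wave_prod.
rewrite E; split => //; rewrite H2.
under eq_bigr do rewrite (cint_expi_gs _ _).2.
rewrite big_split/= -expi_sum; congr (_ * _).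
rewrite -prod_realC; congr (_%:C)%C.
by rewrite big_split/= prodr_const card_ord.
Qed.

Lemma gauss_sym t u : gauss (t - u) = gauss (u - t).
Proof. by apply: eq_bigr => j _; rewrite !mxE /gs -sqrrN opprB. Qed.

Lemma fourier_wave L u : fourier (wave L) u = (kap ^+ d * gauss (u - L))%:C%C.
Proof.
have E : (fun v => expi (- dotR u v) * wave L v) =
    (fun v => expi (dotR (L - u) v) * (gauss (v - 0))%:C%C).
  apply/funext => v; rewrite /wave mulrA -expiD subr0; congr (expi _ * _).
  by rewrite /dotR -sumrN -big_split/=; apply: eq_bigr => j _; rewrite !mxE; ring.
rewrite /fourier E (intCd_wave _ _).2 (_ : dotR _ 0 = 0); last first.
  by rewrite /dotR big1// => j _; rewrite [X in _ * X]mxE mulr0.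
rewrite expi0 mulr1 -rmorphM /= gauss_sym; congr (_%:C)%C.
by rewrite /kap expr_div_n mulrA (mulrC (_ ^- d)).
Qed.

(** Fourier inversion is only used for these functions, where it is a second Gaussian integral. *)
Lemma ifourier_wave L t :
  intCd (fun u => expi (dotR t u) * (kap ^+ d * gauss (u - L))%:C%C) = wave L t.
Proof.
have E : (fun u => expi (dotR t u) * (kap ^+ d * gauss (u - L))%:C%C) =
    (fun u => (kap ^+ d)%:C%C * (expi (dotR t u) * (gauss (u - L))%:C%C)).
  by apply/funext => u; rewrite rmorphM /= mulrCA.
have [H1 H2] := intCd_wave t L.
rewrite E intCdZ// H2 mulrA -rmorphM /= mulrA -exprMn kap_sqrt expr1n mul1r mulrC.
by rewrite /wave; congr (expi _ * _); apply: eq_bigr => j _; rewrite mulrC.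
Qed.

Definition gauss4 t : R := \prod_(j < d) gs4 4^-1 (t 0 j).

Lemma gauss_le4 t : gauss t <= gauss4 t.
Proof. by apply: ler_prod => j _; rewrite (ltW (gs_gt0 _)) gs_le4. Qed.

Lemma gs_sqr_le (y : R) : y ^+ 2 * gs y <= 4 * gs4 4^-1 y.
Proof.
rewrite /gs /gs4 subr0.
have -> : - (4^-1 * y ^+ 2) = 4^-1 * y ^+ 2 - 2^-1 * y ^+ 2 by field.
rewrite expRD mulrA ler_wpM2r ?expR_ge0//.
have := expR_ge1Dx (4^-1 * y ^+ 2); lra.
Qed.

(** The norm is the maximum norm, so the quadratic factor can be absorbed in the single coordinate
    that attains it. *)
Lemma norm2_gauss_le t : `|t| ^+ 2 * gauss t <= 4 * gauss4 t.
Proof.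
have [->|t0] := eqVneq `|t| 0.
  by rewrite expr0n mul0r mulr_ge0// prodr_ge0// => j _; exact: expR_ge0.
have [[i j] /= E] := @mx_norm_neq0 _ _ _ t t0.
rewrite -[`|t|]/(mx_norm t) E ord1 real_normK ?num_real// /gauss /gauss4.
rewrite (bigD1 j)//= [in leRHS](bigD1 j)//= !mulrA.
apply: ler_pM.
- by rewrite mulr_ge0 ?sqr_ge0// (ltW (gs_gt0 _)).
- by apply: prodr_ge0 => k _; exact: (ltW (gs_gt0 _)).
- exact: gs_sqr_le.
- by apply: ler_prod => k _; rewrite (ltW (gs_gt0 _)) gs_le4.
Qed.

End gaussian_wave.

Section gaussian_rV.
Context (R : realType).
Local Notation leb := (@lebesgue_measure R).
Local Notation iint := (iintm leb).

Definition gaussa d (a : R) (u : 'rV[R]_d) : R :=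
  \prod_(j < d) expR (- (a * u 0 j ^+ 2)).

Lemma gaussa_ge0 d a (u : 'rV[R]_d) : 0 <= gaussa a u.
Proof. by apply: prodr_ge0 => j _; exact: expR_ge0. Qed.

Lemma rmeas_gaussa d a (L : 'rV[R]_d) : rmeas (fun u => gaussa a (u - L)).
Proof.
move=> d' S h mh; apply: measurable_prod => j _.
apply: measurableT_comp => //; apply: measurableT_comp => //.
apply: measurable_funM => //; apply: measurable_funX.
under eq_fun do rewrite !mxE.
by apply: measurable_funB => //; exact: mh.
Qed.

Lemma iint_gaussa d (a : R) (L : 'rV[R]_d) : 0 < a ->
  iint (fun u => (gaussa a (u - L))%:E) = (Num.sqrt (pi / a) ^+ d)%:E.
Proof.
move=> a0; elim: d L => [|d IH] L; first by rewrite /= /gaussa big_ord0 expr0.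
have E (u : 'rV[R]_d.+1) : gaussa a (u - L) =
    expR (- (a * (u 0 0 - L 0 0) ^+ 2)) *
    gaussa a ((\row_j u 0 (lift 0 j)) - (\row_j L 0 (lift 0 j))).
  rewrite /gaussa big_ord_recl; congr (_ * _); first by rewrite !mxE.
  by apply: eq_bigr => j _; rewrite !mxE.
have [gi gE] := gauss_integral (L 0 0) a0.
under eq_iintm do rewrite E.
rewrite (@iint_prod _ d (fun x => expR (- (a * (x - L 0 0) ^+ 2)))
  (fun v => gaussa a (v - \row_j L 0 (lift 0 j)))).
- by rewrite gE IH -EFinM exprS.
- by have /integrableP[/measurable_EFinP] := gi.
- by move=> x; exact: expR_ge0.
- exact: rmeas_gaussa.
- by move=> v; exact: gaussa_ge0.
Qed.

Lemma intgr_gaussa d (a : R) (L : 'rV[R]_d) : 0 < a ->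
  intgr (fun u => gaussa a (u - L)).
Proof.
move=> a0; split; first exact: rmeas_gaussa.
by under eq_iintm do rewrite ger0_norm ?gaussa_ge0//; rewrite iint_gaussa// ltry.
Qed.

Lemma gauss4E d (u : 'rV[R]_d) : gauss4 u = gaussa 4^-1 u.
Proof. by apply: eq_bigr => j _; rewrite /gs4 subr0. Qed.

End gaussian_rV.

Section multiplier.
Context (R : realType) (d : nat) (m : 'rV[R]_d -> (R[i])^o).
Hypothesis m_even : forall xi : 'rV[R]_d, m (- xi) = m xi.
Hypothesis m_homog : forall (c : R) (xi : 'rV[R]_d), 0 < c -> m (c *: xi) = m xi.
Hypothesis m_cont : {within [set xi : 'rV[R]_d | xi != 0], continuous m}.

Lemma m_continuous_at (v : 'rV[R]_d) : v != 0 -> {for v, continuous m}.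
Proof.
move=> v0; have : open [set xi : 'rV[R]_d | xi != 0].
  rewrite (_ : [set _ | _] = ~` [set 0]); last first.
    by apply/seteqP; split => x /= /eqP.
  apply: closed_openC; apply: accessible_closed_set1; apply: hausdorff_accessible.
  exact: norm_hausdorff.
move=> oA; have := m_cont; rewrite continuous_open_subspace// => H.
by apply: H; rewrite inE.
Qed.

Lemma m_cont_eps (v : 'rV[R]_d) : v != 0 -> forall e : R, 0 < e ->
  exists2 r : R, 0 < r & forall u, `|v - u| < r -> normc (m u - m v) < e.
Proof.
move=> v0 e e0; have /cvgrPdist_lt := m_continuous_at v0.
move=> /(_ e%:C%C); rewrite ltcR => /(_ e0) /nbhs_ballP[r /= r0 H].
exists r => // u vu; have := H u; rewrite -ball_normE /= => /(_ vu).
by rewrite distrC normCE ltcR.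
Qed.

Lemma m_Re_continuous (v : 'rV[R]_d) : v != 0 ->
  {for v, continuous ((fun u => complex.Re (m u)) : 'rV[R]_d -> R)}.
Proof.
move=> v0; apply/(@cvgrPdist_lt _ _ _ _ (nbhs_filter (v : 'rV[R]_d))) => e e0.
have [r r0 H] := m_cont_eps v0 e0.
apply/nbhs_ballP; exists r => //= u; rewrite -ball_normE /= => vu.
rewrite -ReN -ReD.
by apply: le_lt_trans (H _ vu); rewrite -normrN -ReN opprB; exact: normc_Re.
Qed.

Lemma m_Im_continuous (v : 'rV[R]_d) : v != 0 ->
  {for v, continuous ((fun u => complex.Im (m u)) : 'rV[R]_d -> R)}.
Proof.
move=> v0; apply/(@cvgrPdist_lt _ _ _ _ (nbhs_filter (v : 'rV[R]_d))) => e e0.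
have [r r0 H] := m_cont_eps v0 e0.
apply/nbhs_ballP; exists r => //= u; rewrite -ball_normE /= => vu.
rewrite -ImN -ImD.
by apply: le_lt_trans (H _ vu); rewrite -normrN -ImN opprB; exact: normc_Im.
Qed.

(** The unit sphere is compact and every nonzero vector is scaled to it. The value at 0, where [m]
    may jump, is added to the bound separately. *)
Lemma m_bounded : exists2 M : R, 0 <= M & forall u, normc (m u) <= M.
Proof.
pose S := [set u : 'rV[R]_d | `|u| = 1].
have cS : compact S.
  apply: bounded_closed_compact.
    by exists 1; split => // x x1 u /= ->; exact: ltW.
  rewrite (_ : S = (fun u : 'rV[R]_d => `|u|) @^-1` [set 1])//.
  apply: closed_comp => [u _|]; first exact: norm_continuous.
  exact: closed_eq.
have cf : {within S, continuous ((fun u => normc (m u)) : 'rV[R]_d -> R)}.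
  apply: (@continuous_subspaceW _ _ _ [set xi : 'rV[R]_d | xi != 0]).
    by move=> u /= u1; rewrite -normr_gt0 u1.
  apply: continuous_in_subspaceT => v; rewrite inE /= => v0.
  apply/(@cvgrPdist_lt _ _ _ _ (nbhs_filter (v : 'rV[R]_d))) => e e0; have [r r0 H] := m_cont_eps v0 e0.
  apply/nbhs_ballP; exists r => //= u; rewrite -ball_normE /= => vu.
  apply: le_lt_trans (H _ vu).
  have := @normXBl R (R[i])^o (m u) (m v); have := @normXBr R (R[i])^o (m u) (m v).
  rewrite ler_norml /normX !normCE /=; lra.
have /compact_bounded[M0 [M0r HM]] := continuous_compact cf cS.
have {}HM : forall u, `|u| = 1 -> normc (m u) <= M0 + 1.
  move=> u u1; have := HM (M0 + 1) ltac:(by rewrite ltrDl) (normc (m u)).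
  by rewrite /= ger0_norm ?normc_ge0//; apply; exists u.
exists (Num.max (Num.max (M0 + 1) (normc (m 0))) 0); first by rewrite le_max lexx orbT.
move=> u; rewrite !le_max; have [->|u0] := eqVneq u 0; first by rewrite lexx orbT.
rewrite -(@m_homog `|u|^-1) ?invr_gt0 ?normr_gt0// HM//.
by rewrite normrZ normfV normr_id mulVf// normr_eq0.
Qed.

(* [s] may have any sign: [m] is even. *)
Definition dirto (L : nat -> 'rV[R]_d) (xi : 'rV[R]_d) := exists s : nat -> R,
  (forall A : R, \forall k \near \oo, A <= `|s k|) /\
  (forall r : R, 0 < r -> \forall k \near \oo, `|L k - s k *: xi| <= r * `|s k|).

Lemma m_scale (c : R) u : c != 0 -> m (c *: u) = m u.
Proof.
move=> c0; have [c1|c1] := ltP 0 c; first exact: m_homog.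
by rewrite -m_even -scaleNr m_homog// oppr_gt0 lt_neqAle c0.
Qed.

Lemma rmeas_mRe (z : R[i]) : rmeas (fun u => complex.Re (m u - z)).
Proof.
under eq_fun do rewrite ReD.
apply: (@rmeas_add _ _ (fun u => complex.Re (m u)) (fun=> complex.Re (- z))); last exact: rmeas_cst.
by apply: continuous_rmeas => v; exact: m_Re_continuous.
Qed.

Lemma rmeas_mIm (z : R[i]) : rmeas (fun u => complex.Im (m u - z)).
Proof.
under eq_fun do rewrite ImD.
apply: (@rmeas_add _ _ (fun u => complex.Im (m u)) (fun=> complex.Im (- z))); last exact: rmeas_cst.
by apply: continuous_rmeas => v; exact: m_Im_continuous.
Qed.

(** By homogeneity and evenness [m u] is [m] at [u] divided by [s k]. This turns the Gaussian of
    unit width around [L k] into one of width $1/|s_k|$ around a point close to [xi], where [m] is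
    almost constant. The error is an integral over the frequencies, so it is uniform in [t]. *)
Lemma wave_multiplier (L : nat -> 'rV[R]_d) (xi : 'rV[R]_d) (eta : R) :
  xi != 0 -> dirto L xi -> 0 < eta ->
  \forall k \near \oo, forall t,
    normc (ifourier (fun u => m u * fourier (wave (L k)) u) t - m xi * wave (L k) t) <= eta.
Proof.
move=> xi0 [s [soo Ls]] eta0; have [M M0 mM] := m_bounded.
pose D := kap R ^+ d * Num.sqrt (pi / 4^-1) ^+ d.
have D0 : 0 <= D by rewrite mulr_ge0// exprn_ge0 ?kap_ge0// sqrtr_ge0.
have D1 : 0 < D + 1 by rewrite ltr_wpDl.
(* The real and the imaginary part of the error are each at most $(e + 4q) D \le 2 e D$, where $D$
   is the integral of the dominating Gaussian. *)
pose e := eta / (4 * (D + 1)).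
have e0 : 0 < e by apply: divr_gt0 => //; rewrite mulr_gt0.
have [r r0 mr] := m_cont_eps xi0 e0.
(* Chosen so that $K (r/2)^2 = 2M$: away from the direction [xi] the trivial bound $2M$ lies below a
   quadratic function of [u - L k] with small coefficient, which the Gaussian absorbs. *)
pose K := 8 * M / r ^+ 2.
have K0 : 0 <= K by apply: divr_ge0; [rewrite mulr_ge0|exact: sqr_ge0].
near=> k.
have s1 : 1 <= `|s k| by near: k; exact: soo.
have s2 : 4 * K / e <= `|s k| by near: k; exact: soo.
have Lk : `|L k - s k *: xi| <= r / 2 * `|s k| by near: k; apply: Ls; exact: divr_gt0.
have s0 : s k != 0 by rewrite -normr_gt0 (lt_le_trans ltr01).
have sp : 0 < `|s k| by rewrite normr_gt0.
pose q := K / `|s k| ^+ 2.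
have q0 : 0 <= q by apply: divr_ge0 => //; exact: sqr_ge0.
have q4 : 4 * q <= e.
  rewrite /q mulrA ler_pdivrMr ?exprn_gt0//.
  move: s2; rewrite ler_pdivrMr// => s2; apply: (le_trans s2).
  by rewrite mulrC ler_wpM2l ?(ltW e0)// expr2 ler_peMr// ltW.
have md u : normc (m u - m xi) <= e + q * `|u - L k| ^+ 2.
  have [uL|uL] := ltP `|u - L k| (r / 2 * `|s k|).
    apply: (@le_trans _ _ e); last by rewrite lerDl mulr_ge0// ?sqr_ge0.
    rewrite -(@m_scale (s k)^-1) ?invr_eq0//; apply: ltW; apply: mr.
    have -> : xi - (s k)^-1 *: u = (s k)^-1 *: (s k *: xi - u).
      by rewrite scalerBr scalerA mulVf// scale1r.
    rewrite normrZ normfV ltr_pdivrMl// distrC.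
    rewrite (_ : u - s k *: xi = (u - L k) + (L k - s k *: xi)); last by rewrite addrA subrK.
    apply: (le_lt_trans (ler_normD _ _)); rewrite (_ : `|s k| * r = r / 2 * `|s k| + r / 2 * `|s k|); last by field.
    exact: ltr_leD.
  apply: (@le_trans _ _ (2 * M)).
    apply: (le_trans (normcD _ _)); rewrite normcN.
    by rewrite mulr_natl mulr2n lerD.
  rewrite -[leLHS]add0r lerD ?(ltW e0)//.
  have -> : 2 * M = q * (r / 2 * `|s k|) ^+ 2.
    rewrite /q /K; field; rewrite ?gt_eqF//.
  by rewrite ler_wpM2l// lerXn2r// ?nnegrE// mulr_ge0// divr_ge0// ltW.
move=> t; pose w u := expi (dotR t u) * (kap R ^+ d * gauss (u - L k))%:C%C.
have [wi wE] : cintgr w /\ intCd w = wave (L k) t.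
  split; last exact: ifourier_wave.
  have -> : w = (fun u => (kap R ^+ d)%:C%C * (expi (dotR t u) * (gauss (u - L k))%:C%C)).
    by apply/funext => u; rewrite /w rmorphM /= mulrCA.
  by apply: cintgrZ; exact: (intCd_wave _ _).1.
pose h u := (m u - m xi) * w u.
pose G u := (e + 4 * q) * kap R ^+ d * gaussa 4^-1 (u - L k).
have iG : intgr G by apply: intgrZ; exact: intgr_gaussa.
have hG u : normc (h u) <= G u.
  rewrite /h /w normcM [normc (_ * _%:C%C)]normcM normc_expi mul1r normc_real.
  rewrite ger0_norm; last by rewrite mulr_ge0 ?gauss_ge0// exprn_ge0// kap_ge0.
  apply: (@le_trans _ _ ((e + q * `|u - L k| ^+ 2) * (kap R ^+ d * gauss (u - L k)))).
    by rewrite ler_wpM2r// mulr_ge0 ?gauss_ge0// exprn_ge0// kap_ge0.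
  rewrite /G -gauss4E; clearbody q.
  have kd : 0 <= kap R ^+ d by rewrite exprn_ge0// kap_ge0.
  have g1 := gauss_le4 (u - L k); have g2 := norm2_gauss_le (u - L k).
  have {}g1 := ler_wpM2l (ltW e0) g1; have {}g2 := ler_wpM2l q0 g2.
  have := ler_wpM2l kd (lerD g1 g2).
  by congr (_ <= _); ring.
have rw1 : rmeas (fun u => complex.Re (w u)) by exact: wi.1.1.
have rw2 : rmeas (fun u => complex.Im (w u)) by exact: wi.2.1.
have rh1 : rmeas (fun u => complex.Re (h u)).
  under eq_fun do rewrite ReM.
  exact: (rmeas_add (rmeas_mul (rmeas_mRe _) rw1) (rmeas_opp (rmeas_mul (rmeas_mIm _) rw2))).
have rh2 : rmeas (fun u => complex.Im (h u)).
  under eq_fun do rewrite ImM.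
  exact: (rmeas_add (rmeas_mul (rmeas_mRe _) rw2) (rmeas_mul (rmeas_mIm _) rw1)).
have hG1 u : `|complex.Re (h u)| <= G u by exact: le_trans (normc_Re _) (hG u).
have hG2 u : `|complex.Im (h u)| <= G u by exact: le_trans (normc_Im _) (hG u).
have ih : cintgr h by split; [exact: (intgr_le rh1 hG1)|exact: (intgr_le rh2 hG2)].
have -> : ifourier (fun u => m u * fourier (wave (L k)) u) t - m xi * wave (L k) t = intCd h.
  rewrite /ifourier (_ : (fun u => _) = (fun u => h u + m xi * w u)); last first.
    by apply/funext => u; rewrite fourier_wave /h /w; ring.
  by rewrite intCdD//; [rewrite intCdZ// wE addrK|exact: cintgrZ].
have GD : intRd G = (e + 4 * q) * D.
  rewrite intRdZ; last exact: intgr_gaussa.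
  rewrite intRd_ge0; last by move=> v; exact: gaussa_ge0.
  by rewrite iint_gaussa ?invr_gt0//= /D mulrA.
apply: (le_trans (normc_le _)).
apply: (@le_trans _ _ (intRd G + intRd G)).
  by apply: lerD; [exact: (le_abs_intRd rh1 iG hG1)|exact: (le_abs_intRd rh2 iG hG2)].
rewrite GD; apply: (@le_trans _ _ (4 * e * (D + 1))).
  have : (e + 4 * q) * D <= (e + e) * D by rewrite ler_wpM2r// lerD2l.
  by nra.
by rewrite /e; have -> : 4 * (eta / (4 * (D + 1))) * (D + 1) = eta by field; rewrite gt_eqF.
Unshelve. all: by end_near. Qed.

End multiplier.

(** * Modulated Gaussians are Schwartz functions *)

Section schwartz_wave.
Context (R : realType) (d : nat) (L : 'rV[R]_d).

(* Contains the parts of [wave L], is stable under partial derivatives, and consists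
   of rapidly decreasing functions. *)
Inductive gclass : ('rV[R]_d -> R) -> Prop :=
| gc_cos : gclass (fun t => cos (dotR L t) * gauss t)
| gc_sin : gclass (fun t => sin (dotR L t) * gauss t)
| gc_coord j f : gclass f -> gclass (fun t => t 0 j * f t)
| gc_scale c f : gclass f -> gclass (fun t => c * f t)
| gc_add f g : gclass f -> gclass g -> gclass (fun t => f t + g t).

Lemma is_derive_line (f : 'rV[R]_d -> R) (x v : 'rV[R]_d) (df : R) :
  is_derive (0 : R) (1 : R) (fun h : R => f (h *: v + x)) df -> is_derive x v f df.
Proof.
move=> H.
have D := @ex_derive _ _ _ _ _ _ _ H.
have V := @derive_val _ _ _ _ _ _ _ H.
have EE : (fun h : R => h^-1 *: ((fun h : R => f (h *: v + x)) (h *: (1 : R) + 0) - f (0 *: v + x))) =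
         (fun h : R => h^-1 *: (f (h *: v + x) - f x)).
  by apply/funext => h; rewrite scale0r add0r addr0 /GRing.scale/= mulr1.
apply: DeriveDef.
  by move: D; rewrite /derivable; rewrite [X in cvg (X @ _)]EE.
by move: V; rewrite /derive; rewrite [X in lim (X @ _)]EE.
Qed.

Lemma dotR_line (u v : 'rV[R]_d) (h : R) x : dotR u (h *: v + x) = h * dotR u v + dotR u x.
Proof.
rewrite /dotR mulr_sumr -big_split/=; apply: eq_bigr => j _; rewrite !mxE; ring.
Qed.

Lemma dotR_delta (u : 'rV[R]_d) j : dotR u (delta_mx 0 j) = u 0 j.
Proof.
rewrite /dotR (bigD1 j)//= mxE !eqxx mulr1 big1 ?addr0// => i ij.
by rewrite mxE (negbTE ij) andbF mulr0.
Qed.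

Lemma gaussE (t : 'rV[R]_d) : gauss t = expR (- (2^-1 * dotR t t)).
Proof.
rewrite /gauss /dotR mulr_sumr -sumrN expR_sum.
by apply: eq_bigr => j _; rewrite /gs expr2.
Qed.

Lemma is_derive_affine (a b : R) : is_derive (0 : R) (1 : R) (fun h : R => h * a + b) a.
Proof. by apply: is_derive_eq; rewrite /GRing.scale/=; ring. Qed.

Lemma is_derive_cosdot x j : is_derive x (delta_mx 0 j : 'rV[R]_d)
  (fun t => cos (dotR L t)) (- L 0 j * sin (dotR L x)).
Proof.
apply: is_derive_line.
under eq_fun do rewrite dotR_line dotR_delta.
have := @is_derive1_comp R cos (fun h => h * L 0 j + dotR L x) 0 _ _ (is_derive_cos _)
  (is_derive_affine _ _).
by rewrite mul0r add0r mulNr mulNr [sin _ * _]mulrC.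
Qed.

Lemma is_derive_sindot x j : is_derive x (delta_mx 0 j : 'rV[R]_d)
  (fun t => sin (dotR L t)) (L 0 j * cos (dotR L x)).
Proof.
apply: is_derive_line.
under eq_fun do rewrite dotR_line dotR_delta.
have := @is_derive1_comp R sin (fun h => h * L 0 j + dotR L x) 0 _ _ (is_derive_sin _)
  (is_derive_affine _ _).
by rewrite mul0r add0r [cos _ * _]mulrC.
Qed.

Lemma is_derive_gauss x j : is_derive x (delta_mx 0 j : 'rV[R]_d)
  (@gauss R d) (- x 0 j * gauss x).
Proof.
apply: is_derive_line.
have dotC (u v : 'rV[R]_d) : dotR u v = dotR v u.
  by apply: eq_bigr => i _; rewrite mulrC.
have E h : gauss (h *: delta_mx 0 j + x) =
    expR (- (2^-1 * (h ^+ 2 + h * (2 * x 0 j) + dotR x x))).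
  rewrite gaussE; congr (expR (- (_ * _))).
  rewrite dotR_line dotR_delta [dotR _ x]dotC dotR_line dotR_delta !mxE !eqxx/=.
  by ring.
under eq_fun do rewrite E.
have d1 : is_derive (0 : R) (1 : R)
    (fun h : R => - (2^-1 * (h ^+ 2 + h * (2 * x 0 j) + dotR x x))) (- x 0 j).
  by apply: is_derive_eq; rewrite /GRing.scale/=; field.
apply: (is_derive_eq (@is_derive1_comp R expR _ 0 _ _ (is_derive_expR _) d1)).
by rewrite expr0n/= mul0r !add0r -gaussE; ring.
Qed.

Lemma is_derive_coord x i j : is_derive x (delta_mx 0 j : 'rV[R]_d)
  (fun t : 'rV[R]_d => t 0 i) ((i == j)%:R).
Proof.
apply: is_derive_line.
under eq_fun do rewrite !mxE eqxx/=.
exact: is_derive_affine.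
Qed.

Lemma gclass_derive f j : gclass f ->
  exists2 g, gclass g & forall x, is_derive x (delta_mx 0 j : 'rV[R]_d) f (g x).
Proof.
elim=> [||i {}f cf [g cg dg]|c {}f cf [g cg dg]|f1 f2 cf1 [g1 cg1 dg1] cf2 [g2 cg2 dg2]].
- exists (fun t => (- L 0 j) * (sin (dotR L t) * gauss t) + (-1) * (t 0 j * (cos (dotR L t) * gauss t))).
    by apply: gc_add; apply: gc_scale; [exact: gc_sin|apply: gc_coord; exact: gc_cos].
  move=> x; apply: (is_derive_eq (is_deriveM (is_derive_cosdot x j) (is_derive_gauss x j))).
  by rewrite /GRing.scale/=; ring.
- exists (fun t => L 0 j * (cos (dotR L t) * gauss t) + (-1) * (t 0 j * (sin (dotR L t) * gauss t))).
    by apply: gc_add; apply: gc_scale; [exact: gc_cos|apply: gc_coord; exact: gc_sin].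
  move=> x; apply: (is_derive_eq (is_deriveM (is_derive_sindot x j) (is_derive_gauss x j))).
  by rewrite /GRing.scale/=; ring.
- exists (fun t => (i == j)%:R * f t + t 0 i * g t).
    by apply: gc_add; [exact: gc_scale|exact: gc_coord].
  move=> x; apply: (is_derive_eq (is_deriveM (is_derive_coord x i j) (dg x))).
  by rewrite /GRing.scale/=; ring.
- exists (fun t => c * g t); first exact: gc_scale.
  move=> x; apply: (is_derive_eq (is_deriveM (is_derive_cst c x (delta_mx 0 j)) (dg x))).
  by rewrite /GRing.scale/=; ring.
- exists (fun t => g1 t + g2 t); first exact: gc_add.
  by move=> x; exact: is_deriveD.
Qed.

Lemma gclass_iterpd f l : gclass f -> gclass (iterpd l f).
Proof.
move=> cf; elim: l => [//|j l IH] /=.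
have [g cg dg] := gclass_derive j IH.
suff -> : partialR j (iterpd l f) = g by [].
by apply/funext => x; rewrite /partialR; exact: (@derive_val _ _ _ _ _ _ _ (dg x)).
Qed.

(** From $(1+|x|)^N \le e^{N|x|}$ and $N|x| - |x|^2/2 \le N^2/2$. *)
Lemma gauss_decay N (x : 'rV[R]_d) : (1 + `|x|) ^+ N * gauss x <= expR (2^-1 * N%:R ^+ 2).
Proof.
have gx : gauss x <= expR (- (2^-1 * `|x| ^+ 2)).
  have [->|x0] := eqVneq `|x| 0.
    rewrite expr0n mulr0 oppr0 expR0; apply: prodr_ile1 => j _.
    by rewrite (ltW (gs_gt0 _)) /gs -expR0 ler_expR oppr_le0 mulr_ge0// sqr_ge0.
  have [[i j] /= E] := @mx_norm_neq0 _ _ _ x x0.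
  rewrite -[`|x|]/(mx_norm x) E ord1 real_normK ?num_real// /gauss (bigD1 j)//=.
  rewrite ler_piMr ?(ltW (gs_gt0 _))//; apply: prodr_ile1 => k _.
  by rewrite (ltW (gs_gt0 _)) /gs -expR0 ler_expR oppr_le0 mulr_ge0// sqr_ge0.
have x1 : (1 + `|x|) ^+ N <= expR (`|x| * N%:R).
  rewrite mulrC expRM_natl ?lerXn2r// ?nnegrE ?expR_ge0 ?addr_ge0//.
  exact: expR_ge1Dx.
apply: (@le_trans _ _ (expR (`|x| * N%:R) * expR (- (2^-1 * `|x| ^+ 2)))).
  by apply: ler_pM => //; exact: gauss_ge0.
rewrite -expRD ler_expR; have := sqr_ge0 (`|x| - N%:R); rewrite !expr2; lra.
Qed.

Lemma gclass_bounded f : gclass f -> forall N : nat, exists M : R, forall x,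
  (1 + `|x|) ^+ N * `|f x| <= M.
Proof.
have B N (x : 'rV[R]_d) (c : R) : `|c| <= 1 -> (1 + `|x|) ^+ N * `|c * gauss x| <= expR (2^-1 * N%:R ^+ 2).
  move=> c1; apply: le_trans (gauss_decay N x).
  rewrite ler_wpM2l ?exprn_ge0 ?addr_ge0// normrM (ger0_norm (gauss_ge0 _)).
  by rewrite ler_piMl ?gauss_ge0.
elim=> [||i {}f cf IH|c {}f cf IH|f1 f2 cf1 IH1 cf2 IH2] N.
- by exists (expR (2^-1 * N%:R ^+ 2)) => x; apply: B; exact: norm_cos_le1.
- by exists (expR (2^-1 * N%:R ^+ 2)) => x; apply: B; exact: norm_sin_le1.
- have [M HM] := IH N.+1; exists M => x; apply: le_trans (HM x).
  rewrite exprSr -mulrA ler_wpM2l ?exprn_ge0 ?addr_ge0// normrM ler_wpM2r//.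
  by apply: (le_trans (coord_le_norm x i)); rewrite lerDr.
- have [M HM] := IH N; exists (`|c| * M) => x.
  by rewrite normrM mulrCA ler_wpM2l.
- have [M1 H1] := IH1 N; have [M2 H2] := IH2 N; exists (M1 + M2) => x.
  apply: le_trans (lerD (H1 x) (H2 x)); rewrite -mulrDr ler_wpM2l ?exprn_ge0 ?addr_ge0//.
  exact: ler_normD.
Qed.

Lemma gclass_schwartz f : gclass f -> schwartzR f.
Proof.
move=> cf l; have cl := gclass_iterpd l cf; split; last exact: gclass_bounded.
move=> j x; have [g _ dg] := gclass_derive j cl.
exact: (@ex_derive _ _ _ _ _ _ _ (dg x)).
Qed.

Lemma schwartz_wave : schwartz (wave L).
Proof.
split.
  rewrite (_ : (fun x => _) = (fun t => cos (dotR L t) * gauss t)).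
    by apply: gclass_schwartz; exact: gc_cos.
  by apply/funext => t; rewrite ReM /= mulr0 subr0.
rewrite (_ : (fun x => _) = (fun t => sin (dotR L t) * gauss t)).
  by apply: gclass_schwartz; exact: gc_sin.
by apply/funext => t; rewrite ImM /= mulr0 add0r.
Qed.

End schwartz_wave.

(** * Transference to the torus *)

Section torus.
Context (R : realType).
Local Notation leb := (@lebesgue_measure R).

Lemma twopi_gt0 : (0 : R) < 2 * pi.
Proof. by rewrite mulr_gt0// pi_gt0. Qed.

(** The circle is represented by periodic functions integrated against this law. *)
Definition unif : probability (measurableTypeR R) R := uniform_prob twopi_gt0.

Lemma integral_unif (f : R -> \bar R) :
  measurable_fun [set: measurableTypeR R] (f : measurableTypeR R -> \bar R) ->
  (forall x, 0 <= f x)%E ->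
  (\int[unif]_x f x = ((2 * pi)^-1)%:E * \int[leb]_(x in `[0%R, (2 * pi)%R[) f x)%E.
Proof.
move=> mf f0; rewrite integral_uniform// subr0; congr (_ * _)%E.
by rewrite (@integral_itv_bndo_bndc _ (BLeft 0) (2 * pi) f)//; exact: measurable_funTS.
Qed.

Lemma ge0_integral_itv_shift (a b c : R) (f : R -> \bar R) :
  measurable_fun [set: measurableTypeR R] (f : measurableTypeR R -> \bar R) ->
  (forall x, 0 <= f x)%E ->
  (\int[leb]_(x in `[(a + c)%R, (b + c)%R[) f x = \int[leb]_(x in `[a, b[) f (x + c)%R)%E.
Proof.
move=> mf f0; rewrite integral_mkcond [RHS]integral_mkcond.
rewrite -(@ge0_integral_shift R c (f \_ `[(a + c)%R, (b + c)%R[)).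
- apply: eq_integral => x _; rewrite /patch !mem_setE !in_itv/=.
  by rewrite lerD2r ltrD2r.
- by apply/(measurable_restrictT _ _).1 => //; exact: measurable_funTS.
- by move=> x; rewrite /patch; case: ifP.
Qed.

(** The shift [c] is reduced modulo the period; then the interval from [c] to [T + c] is cut at [T]
    and its second piece moved back by one period. *)
Lemma unif_shift (c : R) (f : R -> \bar R) :
  measurable_fun [set: measurableTypeR R] (f : measurableTypeR R -> \bar R) ->
  (forall x, 0 <= f x)%E -> (forall x, f (x + 2 * pi)%R = f x) ->
  (\int[unif]_x f (x + c)%R = \int[unif]_x f x)%E.
Proof.
move=> mf f0 fper; set T := 2 * pi in fper.
have T0 : 0 < T := twopi_gt0.
have mfc c' : measurable_fun [set: measurableTypeR R] ((fun x => f (x + c')%R) : measurableTypeR R -> \bar R).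
  by apply: measurableT_comp => //; exact: measurable_funD.
have pern (n : nat) x : f (x + n%:R * T) = f x.
  elim: n x => [|n IH] x; first by rewrite mul0r addr0.
  by rewrite -natr1 mulrDl mul1r addrA fper IH.
have perz (k : int) x : f (x + k%:~R * T) = f x.
  case: k => n; first exact: pern.
  by rewrite NegzE mulrNz mulNr -[in RHS](subrK (n.+1%:R * T) x) pern.
wlog : c / 0 <= c < T.
  move=> H; have := H (c - (Num.floor (c / T))%:~R * T).
  have /andP[h1 h2] := floor_itv (c / T).
  have h3 : 0 <= c - (Num.floor (c / T))%:~R * T < T.
    rewrite subr_ge0 -ler_pdivlMr// h1/= ltrBlDr.
    by move: h2; rewrite intrD ltr_pdivrMr// mulrDl mul1r addrC.
  move=> /(_ h3) <-.
  apply: eq_integral => x _.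
  by rewrite -[in RHS](perz (Num.floor (c / T))) -addrA subrK.
move=> /andP[c0 cT]; rewrite !integral_unif//; congr (_ * _)%E.
have ms (A : set R) : measurable_fun A (f : measurableTypeR R -> \bar R).
  exact: measurable_funTS.
have split3 (a b e : R) : a <= b -> b <= e ->
    (\int[leb]_(x in `[a, e[) f x = \int[leb]_(x in `[a, b[) f x + \int[leb]_(x in `[b, e[) f x)%E.
  move=> ab be; rewrite -ge0_integral_setU//=.
    by rewrite -itv_bndbnd_setU// bnd_simp.
    exact: ms.
  by apply/disj_setPS => x [] /=; rewrite !in_itv/= => /andP[_ h1] /andP[h2 _]; have := lt_le_trans h1 h2; rewrite ltxx.
rewrite -/T -ge0_integral_itv_shift// add0r (split3 c T)//; [|exact: ltW|by rewrite lerDl].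
rewrite [RHS](split3 0 c)//; [|exact: ltW]; rewrite addeC; congr (_ + _)%E.
have := @ge0_integral_itv_shift 0 c T f mf f0; rewrite add0r [c + T]addrC => ->.
by apply: eq_integral => x _; rewrite fper.
Qed.

Lemma torus_shift n (f : 'rV[R]_n -> \bar R) (s : 'rV[R]_n) :
  bmeas f -> (forall v, 0 <= f v)%E ->
  (forall v j, f (v + (2 * pi) *: delta_mx 0 j) = f v) ->
  iintm unif (fun v => f (v + s)) = iintm unif f.
Proof.
elim: n f s => [|n IH] f s mf f0 fper /=.
  by congr f; apply/rowP => -[].
have vD (x y : R) (u w : 'rV[R]_n) : vcons x u + vcons y w = vcons (x + y) (u + w).
  apply/rowP => j; rewrite mxE; case: (unliftP 0 j) => [i ->|->]; last by rewrite !vcons0.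
  by rewrite !vconsS mxE.
have dE k (j i : 'I_k) : ((2 * pi) *: delta_mx 0 j : 'rV[R]_k) 0 i = 2 * pi * (i == j)%:R.
  by rewrite !mxE eqxx.
transitivity (\int[unif]_x iintm unif (fun v => f (vcons (x + s 0 0)%R v)))%E.
  apply: eq_integral => x _.
  under eq_iintm do rewrite [in X in f X](vconsP s) vD.
  apply: (IH (fun v => f (vcons (x + s 0 0)%R v))) => //.
    exact: bmeas_vcons.
  move=> v j; rewrite -[RHS](fper _ (lift 0 j)); congr f; apply/rowP => k.
  rewrite [RHS]mxE dE.
  case: (unliftP 0 k) => [i ->|->].
    by rewrite !vconsS mxE dE (inj_eq lift_inj).
  by rewrite !vcons0 (negbTE (neq_lift _ _)) mulr0 addr0.
apply: (@unif_shift (s 0 0) (fun x => iintm unif (fun v => f (vcons x v)))).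
- exact: measurable_iintm_vcons.
- by move=> x; exact: iintm_ge0.
- move=> x; apply: eq_iintm => v; rewrite -[RHS](fper _ 0); congr f; apply/rowP => k.
  rewrite [RHS]mxE dE.
  case: (unliftP 0 k) => [i ->|->]; last by rewrite !vcons0 eqxx mulr1.
  by rewrite !vconsS eq_sym (negbTE (neq_lift _ _)) mulr0 addr0.
Qed.

Lemma iintm_unif_cst n (k : \bar R) : iintm unif (fun _ : 'rV[R]_n => k) = k.
Proof.
elim: n => [//|n IH] /=; under eq_integral do rewrite IH.
rewrite integral_cst// [X in (_ * X)%E](_ : _ = 1%E) ?mule1//.
exact: (@probability_setT _ _ _ unif).
Qed.

End torus.

(** Only [a] is bounded by [B]: in the application [b] is the norm of a value of $T_m$, for which no
    a priori bound is at hand. If $b < a$, both numbers lie below [B] and the tangent at [a] gives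
    the constant. *)
Lemma powR_lip (R : realType) (p a b B h : R) : 1 < p -> 0 <= a -> a <= B -> 0 <= b ->
  0 <= h -> a <= b + h -> a `^ p <= b `^ p + p * B `^ (p - 1) * h.
Proof.
move=> p1 a0 aB b0 h0 abh; have p0 : 0 < p by rewrite (lt_trans ltr01).
have p10 : 0 <= p - 1 by rewrite subr_ge0 ltW.
have B0 : 0 <= B by exact: le_trans aB.
have c0 : 0 <= p * B `^ (p - 1) * h by rewrite !mulr_ge0 ?powR_ge0// ltW.
have [ab|ba] := leP a b.
  by rewrite -[leLHS]addr0 lerD// ge0_ler_powR ?nnegrE// ltW.
have a1 : 0 < a by exact: le_lt_trans b0 ba.
(* Divided by $a^p$ this reads $1 - t^p \le p(1 - t)$, which is Young's inequality for the numbers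
   $t$ and 1. *)
have tang : a `^ p - b `^ p <= p * a `^ (p - 1) * (a - b).
  pose t := b / a; have t0 : 0 <= t by rewrite divr_ge0// ltW.
  have -> : b = t * a by rewrite /t divfK// gt_eqF.
  rewrite powRM//.
  have -> : p * a `^ (p - 1) * (a - t * a) = p * (1 - t) * a `^ p.
    by rewrite -(mulr_powRB1 (ltW a1) p0); ring.
  rewrite -[X in X - _]mul1r -mulrBl ler_wpM2r ?powR_ge0//.
  have q0 : 0 < (1 - p^-1)^-1 by rewrite invr_gt0 subr_gt0 invf_lt1.
  have := @conjugate_powR R t 1 p (1 - p^-1)^-1 t0 ler01 p0 q0.
  rewrite invrK addrC subrK powR1 !mulr1 mul1r => /(_ erefl) H.
  have := ler_wpM2l (ltW p0) H.
  have -> : p * (t `^ p / p + (1 - p^-1)) = t `^ p + p - 1 by field; rewrite gt_eqF.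
  by lra.
have : p * a `^ (p - 1) * (a - b) <= p * B `^ (p - 1) * h.
  apply: ler_pM; rewrite ?subr_ge0 ?mulr_ge0 ?powR_ge0 ?(ltW p0) ?(ltW ba)//.
    by rewrite ler_wpM2l ?(ltW p0)// ge0_ler_powR ?nnegrE.
  by rewrite lerBlDl.
lra.
Qed.

Section measurability_of_norms.
Context (R : realType) (X : normedModType R[i]).

(** [X] carries no sigma-algebra. The norm is a Lipschitz function of the real and imaginary parts
    of finitely many coefficients, so [continuous_rmeas] applies. *)
Lemma measurable_normX_sum d (S : measurableType d) (I : Type) (ts : seq I)
    (z : I -> S -> R[i]) (x : I -> X) (y : X) :
  (forall i, measurable_fun [set: S] ((fun s => complex.Re (z i s)) : S -> R)) ->
  (forall i, measurable_fun [set: S] ((fun s => complex.Im (z i s)) : S -> R)) ->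
  measurable_fun [set: S] ((fun s => normX (y + \sum_(i <- ts) z i s *: x i)) : S -> R).
Proof.
move=> mRe mIm; pose n := size ts; pose e i := tnth (in_tuple ts) i.
pose w (v : 'rV[R]_(n + n)) (i : 'I_n) : R[i] := (v 0 (lshift n i) +i* v 0 (rshift n i))%C.
pose f (v : 'rV[R]_(n + n)) : R := normX (y + \sum_(i < n) w v i *: x (e i)).
have mf : rmeas f.
  apply: continuous_rmeas => v _.
  apply/(@cvgrPdist_le _ _ _ _ (nbhs_filter (v : 'rV[R]_(n + n)))) => q q0.
  pose C := 1 + \sum_(i < n) 2 * normX (x (e i)).
  have C0 : 0 < C by rewrite ltr_pwDl// sumr_ge0// => i _; rewrite mulr_ge0 ?normX_ge0.
  apply/nbhs_ballP; exists (q / C) => /=; first exact: divr_gt0.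
  move=> u; rewrite -ball_normE /= => vu.
  have -> : `|f v - f u| = `|normX (y + \sum_(i < n) w v i *: x (e i)) -
    normX (y + \sum_(i < n) w u i *: x (e i))| by [].
  apply: (@le_trans _ _ (normX (\sum_(i < n) (w v i - w u i) *: x (e i)))).
    have -> : \sum_(i < n) (w v i - w u i) *: x (e i) =
      (y + \sum_(i < n) w v i *: x (e i)) - (y + \sum_(i < n) w u i *: x (e i)).
      rewrite opprD addrACA subrr add0r -sumrB; apply: eq_bigr => i _.
      by rewrite scalerBl.
    rewrite ler_norml normXBl andbT lerNl opprB.
    exact: normXBr.
  apply: (le_trans (normX_sum _ _)).
  apply: (@le_trans _ _ (`|v - u| * C)); last by rewrite -ler_pdivlMr// ltW.
  rewrite /C mulrDr mulr1 mulr_sumr -[leLHS]add0r lerD//.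
  apply: ler_sum => i _; rewrite normXZ mulrA ler_wpM2r ?normX_ge0//.
  apply: (le_trans (normc_le _)); rewrite ReD ImD ReN ImN /= mulr_natr mulr2n.
  have c1 := coord_le_norm (v - u) (lshift n i).
  have c2 := coord_le_norm (v - u) (rshift n i).
  by rewrite !mxE in c1 c2; exact: lerD.
pose h s : 'rV[R]_(n + n) := row_mx (\row_i complex.Re (z (e i) s)) (\row_i complex.Im (z (e i) s)).
have mh : vmeas h.
  move=> j; rewrite -(splitK j); case: (fintype.split j) => i /=.
    by under eq_fun do rewrite row_mxEl mxE; exact: mRe.
  by under eq_fun do rewrite row_mxEr mxE; exact: mIm.
have := mf _ _ _ mh; congr (measurable_fun _ _).
apply/funext => s; rewrite /f [in RHS]big_tnth; congr (normX (y + _)).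
apply: eq_bigr => i _; congr (_ *: _); apply: complexP => /=.
  by rewrite row_mxEl mxE.
by rewrite row_mxEr mxE.
Qed.

End measurability_of_norms.

(** * Lacunary frequencies *)

Section frequencies.
Context (R : realType) (d : nat).
Implicit Types (xi : nat -> 'rV[R]_d).

(* As [L] tends to infinity, the last [j] with [nu 0 j != 0] dominates, so that
   [Lam xi nu L] tends to infinity in the direction [xi j]. *)
Definition Lam N xi (nu : 'rV[int]_N) (L : nat) : 'rV[R]_d :=
  \sum_(j < N) ((nu 0 j)%:~R * L%:R ^+ j.+1) *: xi j.

Definition dotZ N (nu : 'rV[int]_N) (th : 'rV[R]_N) : R :=
  \sum_(j < N) (nu 0 j)%:~R * th 0 j.

(** A Horner scheme, in the form to which [dirto_step] applies. *)
Lemma LamS N xi (nu : 'rV[int]_N.+1) L : Lam xi nu L =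
  L%:R *: ((nu 0 0)%:~R *: xi 0%N + Lam (fun j => xi j.+1) (\row_j nu 0 (lift 0 j)) L).
Proof.
rewrite /Lam big_ord_recl scalerDr scaler_sumr scalerA; congr (_ *: _ + _).
  by rewrite expr1 mulrC.
apply: eq_bigr => j _; rewrite scalerA mxE; congr (_ *: _).
by rewrite [in RHS]mulrCA -exprS.
Qed.

Lemma dirto_base (xi : 'rV[R]_d) (l : int) : l != 0 ->
  dirto (fun L => L%:R *: (l%:~R *: xi)) xi.
Proof.
move=> l0; exists (fun L => L%:R * l%:~R); split.
  move=> A; near=> L; rewrite normrM ger0_norm//.
  apply: (@le_trans _ _ L%:R).
    by near: L; exact: nbhs_infty_ger.
  rewrite ler_peMr// -intr_norm -[1]/(1%:~R) ler_int.
  by move: l0; rewrite -normr_gt0.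
move=> r r0; near=> L; rewrite scalerA subrr normr0 mulr_ge0 ?(ltW r0)//.
Unshelve. all: by end_near. Qed.

(** The fixed vector [v] is negligible because [s] tends to infinity, and the factor [n] changes the
    length only. *)
Lemma dirto_step (L : nat -> 'rV[R]_d) (xi v : 'rV[R]_d) : dirto L xi ->
  dirto (fun n => n%:R *: (v + L n)) xi.
Proof.
move=> [s [soo Ls]]; exists (fun n => n%:R * s n); split.
  move=> A; near=> n.
  have n1 : (1 : R) <= n%:R by near: n; exact: nbhs_infty_ger.
  rewrite normrM ger0_norm//; apply: (@le_trans _ _ `|s n|).
    by near: n; exact: soo.
  by rewrite ler_peMl.
move=> r r0; near=> n.
rewrite -scalerA -scalerBr normrZ normrM ger0_norm// mulrCA ler_wpM2l//.
rewrite -addrA; apply: (le_trans (ler_normD _ _)).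
have -> : r * `|s n| = r / 2 * `|s n| + r / 2 * `|s n| by field.
apply: lerD; last by near: n; apply: Ls; exact: divr_gt0.
rewrite -ler_pdivrMl ?divr_gt0//.
by near: n; exact: soo.
Unshelve. all: by end_near. Qed.

Lemma dotR_sumZ N (c : 'I_N -> R) (x : 'I_N -> 'rV[R]_d) t :
  dotR (\sum_(j < N) c j *: x j) t = \sum_(j < N) c j * dotR (x j) t.
Proof.
rewrite /dotR; under eq_bigr do rewrite summxE mulr_suml.
rewrite exchange_big/=; apply: eq_bigr => j _; rewrite mulr_sumr.
by apply: eq_bigr => i _; rewrite mxE mulrA.
Qed.

Lemma dotRDl (u v t : 'rV[R]_d) : dotR (u + v) t = dotR u t + dotR v t.
Proof. by rewrite /dotR -big_split; apply: eq_bigr => j _; rewrite mxE mulrDl. Qed.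

Lemma dotRZl (c : R) (u t : 'rV[R]_d) : dotR (c *: u) t = c * dotR u t.
Proof. by rewrite /dotR mulr_sumr; apply: eq_bigr => j _; rewrite mxE mulrA. Qed.

(** The translation of the torus that the evaluation at the point [t] of R^d produces. The exponent
    [j.+2] includes the outer factor [L] of the frequencies in [dotR_Lam]. *)
Definition tau N xi (L : nat) (t : 'rV[R]_d) : 'rV[R]_N :=
  \row_j (L%:R ^+ j.+2 * dotR (xi j) t).

Lemma dotR_Lam N (v0 : 'rV[R]_d) xi (nu : 'rV[int]_N) L t :
  dotR (L%:R *: (v0 + Lam xi nu L)) t = L%:R * dotR v0 t + dotZ nu (tau N xi L t).
Proof.
rewrite dotRZl dotRDl mulrDr; congr (_ + _).
rewrite /Lam dotR_sumZ mulr_sumr; apply: eq_bigr => j _.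
by rewrite mxE [L%:R ^+ j.+2]exprS; ring.
Qed.

Lemma dotZD N (nu : 'rV[int]_N) (a b : 'rV[R]_N) : dotZ nu (a + b) = dotZ nu a + dotZ nu b.
Proof. by rewrite /dotZ -big_split; apply: eq_bigr => j _; rewrite mxE mulrDr. Qed.

Lemma expi_int2pi (k : int) : expi (k%:~R * (2 * pi)) = 1 :> R[i].
Proof.
have P : expi (2 * pi) = 1 :> R[i].
  by rewrite /expi mulr_natl cos2pi sin2pi.
have N n : expi (n%:R * (2 * pi)) = 1 :> R[i].
  elim: n => [|n IH]; first by rewrite mul0r expi0.
  by rewrite -natr1 mulrDl mul1r expiD IH P mulr1.
case: k => n; first exact: N.
have := expiD (n.+1%:R * (2 * pi)) (- (n.+1%:R * (2 * pi)) : R).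
by rewrite subrr expi0 N mul1r NegzE mulrNz mulNr => <-.
Qed.

Lemma expi_dotZ_per N (nu : 'rV[int]_N) (a : 'rV[R]_N) j :
  expi (dotZ nu (a + (2 * pi) *: delta_mx 0 j)) = expi (dotZ nu a).
Proof.
rewrite dotZD expiD [X in _ * expi X](_ : _ = (nu 0 j)%:~R * (2 * pi)).
  by rewrite expi_int2pi mulr1.
rewrite /dotZ (bigD1 j)//= !mxE !eqxx/= mulr1 big1 ?addr0// => i ij.
by rewrite !mxE (negbTE ij) andbF !mulr0.
Qed.

Lemma measurable_dotZ d' (S : measurableType d') N (nu : 'rV[int]_N) (h : S -> 'rV[R]_N) :
  vmeas h -> measurable_fun [set: S] ((fun s => dotZ nu (h s)) : S -> R).
Proof.
move=> mh; apply: measurable_sum => j; apply: measurable_funM => //; exact: mh.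
Qed.

Lemma measurable_expi_dotZ d' (S : measurableType d') N (nu : 'rV[int]_N) (h : S -> 'rV[R]_N) (c : R[i]) :
  vmeas h ->
  measurable_fun [set: S] ((fun s => complex.Re (c * expi (dotZ nu (h s)))) : S -> R) /\
  measurable_fun [set: S] ((fun s => complex.Im (c * expi (dotZ nu (h s)))) : S -> R).
Proof.
move=> mh; have mz := measurable_dotZ nu mh.
have mc : measurable_fun setT ((fun s => cos (dotZ nu (h s))) : S -> R).
  by apply: measurableT_comp => //; exact: (continuous_measurable_fun (@continuous_cos R)).
have ms : measurable_fun setT ((fun s => sin (dotZ nu (h s))) : S -> R).
  by apply: measurableT_comp => //; exact: (continuous_measurable_fun (@continuous_sin R)).
split.
  by under eq_fun do rewrite ReM /=; apply: measurable_funB; apply: measurable_funM.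
by under eq_fun do rewrite ImM /=; apply: measurable_funD; apply: measurable_funM.
Qed.

End frequencies.

Lemma near_all_seq (T : eqType) (s : seq T) (P : T -> nat -> Prop) :
  (forall t, t \in s -> \forall n \near \oo, P t n) ->
  \forall n \near \oo, forall t, t \in s -> P t n.
Proof.
elim: s => [|a s IH] H; first by near=> n.
have Ha := H a (mem_head _ _).
have Hs : \forall n \near \oo, forall t, t \in s -> P t n.
  by apply: IH => t ts; apply: H; rewrite in_cons ts orbT.
apply: filterS2 Ha Hs => n ha hs t.
by rewrite in_cons => /orP[/eqP ->//|]; exact: hs.
Unshelve. all: by end_near. Qed.

(** The passage to the limit as $r \to 1$, by Bernoulli's inequality $(1-q)^d \ge 1 - dq$. *)
Lemma le_of_expr_lt1 (R : realType) (a b : R) d : 0 <= a ->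
  (forall r, 0 < r < 1 -> r ^+ d * a <= b) -> a <= b.
Proof.
move=> a0 H; apply/ler_addgt0Pr => e e0.
pose q := Num.min 2^-1 (e / (d%:R * a + 1)).
have da : 0 < d%:R * a + 1 by rewrite ltr_pwDr// mulr_ge0.
have q0 : 0 < q by rewrite lt_min invr_gt0 ltr0n/= divr_gt0.
have q1 : q <= 2^-1 by rewrite ge_min lexx.
have q2 : q * (d%:R * a + 1) <= e by rewrite -ler_pdivlMr// ge_min lexx orbT.
have r01 : 0 < 1 - q < 1 by apply/andP; split; lra.
have B : 1 - d%:R * q <= (1 - q) ^+ d.
  have {}q1 : q <= 1 by lra.
  clearbody q; elim: d {H da q2} => [|n IH]; first by rewrite mul0r subr0 expr0.
  rewrite exprS; apply: (@le_trans _ _ ((1 - q) * (1 - n%:R * q))).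
    have := mulr_ge0 (ler0n R n) (mulr_ge0 (ltW q0) (ltW q0)).
    rewrite -natr1; lra.
  by rewrite ler_wpM2l// subr_ge0.
have := H _ r01; have := ler_wpM2r a0 B; nra.
Qed.

Section transference.
Context (R : realType) (X : normedModType R[i]) (p : R) (d : nat)
  (m : 'rV[R]_d -> (R[i])^o) (c : R).
Hypothesis p1 : 1 < p.
Hypothesis m_even : forall xi : 'rV[R]_d, m (- xi) = m xi.
Hypothesis m_homog : forall (c : R) (xi : 'rV[R]_d), 0 < c -> m (c *: xi) = m xi.
Hypothesis m_cont : {within [set xi : 'rV[R]_d | xi != 0], continuous m}.
Hypothesis c0 : 0 <= c.
Hypothesis Tm_le : forall s : seq (('rV[R]_d -> R[i]) * X),
  (forall k, k \in s -> schwartz k.1) ->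
  (LpRd p (Tm m s) <= c%:E * LpRd p (tensor s))%E.

Local Notation iint := (iintm (@lebesgue_measure R)).
Local Notation tint := (iintm (@unif R)).
Local Notation term N := ('rV[int]_N * 'rV[R]_d * X)%type.

(* In a term [(nu, xi, x)], [xi] is the direction in which the frequencies of R^d
   attached to the torus frequency [nu] tend to infinity. *)
Definition tpf N (ts : seq (term N)) (th : 'rV[R]_N) : X :=
  \sum_(k <- ts) expi (dotZ k.1.1 th) *: k.2.

Definition tpg N (ts : seq (term N)) (th : 'rV[R]_N) : X :=
  \sum_(k <- ts) (m k.1.2 * expi (dotZ k.1.1 th)) *: k.2.

Lemma iint_Tm_le (s : seq (('rV[R]_d -> R[i]) * X)) :
  (forall k, k \in s -> schwartz k.1) ->
  (iint (fun t => (normX (Tm m s t) `^ p)%:E) <=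
   (c `^ p)%:E * iint (fun t => (normX (tensor s t) `^ p)%:E))%E.
Proof.
move=> /Tm_le; rewrite /LpRd !iintRdE.
set A := iint _; set B := iint _ => H.
have p0 : 0 < p by rewrite (lt_trans ltr01).
have A0 : (0 <= A)%E by apply: iintm_ge0 => v; rewrite lee_fin powR_ge0.
have B0 : (0 <= B)%E by apply: iintm_ge0 => v; rewrite lee_fin powR_ge0.
have pp : p^-1 * p = 1 by rewrite mulVf// gt_eqF.
have K (Z : \bar R) : (0 <= Z)%E -> poweR (poweR Z p^-1) p = Z.
  by move=> Z0; rewrite -poweRrM pp poweRe1.
rewrite -(K A A0) -(K B B0) -poweR_EFin -poweRM ?lee_fin ?poweR_ge0//.
apply: gt0_ler_poweR => //; first exact: ltW.
  by rewrite in_itv/= poweR_ge0 leey.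
by rewrite in_itv/= leey andbT mule_ge0 ?lee_fin ?poweR_ge0.
Qed.

Lemma measurable_tpg d' (S : measurableType d') N (ts : seq (term N)) (h : S -> 'rV[R]_N) :
  vmeas h -> measurable_fun [set: S] ((fun s => normX (tpg ts (h s))) : S -> R).
Proof.
move=> mh; rewrite (_ : (fun _ => _) = (fun s => normX (0 + \sum_(k <- ts)
    ((fun k s => (m k.1.2 * expi (dotZ k.1.1 (h s)))) k s) *: k.2))); last first.
  by apply/funext => s; rewrite add0r.
by apply: measurable_normX_sum => k; [exact: (measurable_expi_dotZ _ _ mh).1|exact: (measurable_expi_dotZ _ _ mh).2].
Qed.

Lemma measurable_tpf d' (S : measurableType d') N (ts : seq (term N)) (x : X) (h : S -> 'rV[R]_N) :
  vmeas h -> measurable_fun [set: S] ((fun s => normX (x + tpf ts (h s))) : S -> R).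
Proof.
move=> mh; rewrite (_ : (fun _ => _) = (fun s => normX (x + \sum_(k <- ts)
    ((fun k s => (1 * expi (dotZ k.1.1 (h s)))) k s) *: k.2))); last first.
  by apply/funext => s; rewrite /tpf; congr (normX (_ + _)); apply: eq_bigr => k _; rewrite mul1r.
by apply: measurable_normX_sum => k; [exact: (measurable_expi_dotZ _ _ mh).1|exact: (measurable_expi_dotZ _ _ mh).2].
Qed.

Lemma tpf_per N (ts : seq (term N)) th j :
  tpf ts (th + (2 * pi) *: delta_mx 0 j) = tpf ts th.
Proof. by apply: eq_bigr => k _; rewrite expi_dotZ_per. Qed.

Lemma tpg_per N (ts : seq (term N)) th j :
  tpg ts (th + (2 * pi) *: delta_mx 0 j) = tpg ts th.
Proof. by apply: eq_bigr => k _; rewrite expi_dotZ_per. Qed.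

Variables (N : nat) (xi0 : 'rV[R]_d) (xi : nat -> 'rV[R]_d) (ts : seq (term N)).
Hypothesis ts_dir : forall k, k \in ts -> k.1.2 != 0 /\
  dirto (fun L => L%:R *: (xi0 + Lam xi k.1.1 L)) k.1.2.

Let FL (L : nat) (nu : 'rV[int]_N) : 'rV[R]_d := L%:R *: (xi0 + Lam xi nu L).

(** A translation [th] of the torus enters through unimodular factors of the vectors. The bound for
    $T_m$ thus holds for every [th] with the same constant and may be averaged over [th]. *)
Let st (L : nat) (th : 'rV[R]_N) : seq (('rV[R]_d -> R[i]) * X) :=
  [seq (wave (FL L k.1.1), expi (dotZ k.1.1 th) *: k.2) | k <- ts].

Lemma st_schwartz L th k : k \in st L th -> schwartz k.1.
Proof. by move=> /mapP[k' _ ->]; exact: schwartz_wave. Qed.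

Lemma wave_FL L (nu : 'rV[int]_N) (th : 'rV[R]_N) t :
  wave (FL L nu) t * expi (dotZ nu th) =
  (expi (L%:R * dotR xi0 t) * (gauss t)%:C%C) * expi (dotZ nu (th + tau N xi L t)).
Proof. by rewrite /wave dotR_Lam dotZD !expiD; ring. Qed.

Lemma tensor_st L th t : normX (tensor (st L th) t) =
  gauss t * normX (tpf ts (th + tau N xi L t)).
Proof.
have -> : tensor (st L th) t =
    (expi (L%:R * dotR xi0 t) * (gauss t)%:C%C) *: tpf ts (th + tau N xi L t).
  rewrite /tensor /st big_map scaler_sumr; apply: eq_bigr => k _.
  by rewrite !scalerA wave_FL.
by rewrite normXZ normcM normc_expi mul1r normc_real ger0_norm ?gauss_ge0.
Qed.

Let B := \sum_(k <- ts) normX k.2.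

Lemma B_ge0 : 0 <= B.
Proof. by apply: sumr_ge0 => k _; exact: normX_ge0. Qed.

Lemma Tm_st (eta : R) : 0 < eta -> \forall L \near \oo, forall th t,
  gauss t * normX (tpg ts (th + tau N xi L t)) <= normX (Tm m (st L th) t) + eta * B.
Proof.
move=> eta0.
have : \forall L \near \oo, forall k, k \in ts -> forall t,
   normc (ifourier (fun u => m u * fourier (wave (FL L k.1.1)) u) t - m k.1.2 * wave (FL L k.1.1) t) <= eta.
  apply: near_all_seq => k kts; have [k0 kd] := ts_dir kts.
  exact: wave_multiplier.
apply: filterS => L HL th t.
have -> : gauss t * normX (tpg ts (th + tau N xi L t)) =
    normX (\sum_(k <- ts) (m k.1.2 * wave (FL L k.1.1) t) *: (expi (dotZ k.1.1 th) *: k.2)).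
  have -> : \sum_(k <- ts) (m k.1.2 * wave (FL L k.1.1) t) *: (expi (dotZ k.1.1 th) *: k.2) =
      (expi (L%:R * dotR xi0 t) * (gauss t)%:C%C) *: tpg ts (th + tau N xi L t).
    rewrite scaler_sumr; apply: eq_bigr => k _.
    by rewrite !scalerA; congr (_ *: _); rewrite -mulrA wave_FL mulrCA.
  by rewrite normXZ normcM normc_expi mul1r normc_real ger0_norm ?gauss_ge0.
rewrite -lerBlDl; apply: (le_trans (normXBl _ _)).
rewrite /Tm /st big_map -sumrB.
apply: (le_trans (normX_sum _ _)); rewrite /B mulr_sumr !big_seq.
apply: ler_sum => k kts; rewrite -scalerBl normXZ normXZ normc_expi mul1r.
rewrite ler_wpM2r ?normX_ge0//; apply: le_trans (HL k kts t).
by rewrite -normcN opprB.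
Qed.

Lemma gauss_powR (t : 'rV[R]_d) : gauss t `^ p = gaussa (p / 2) t.
Proof.
have E a : gaussa a t = expR (- (a * dotR t t)).
  rewrite /gaussa -expR_sum /dotR mulr_sumr -sumrN.
  by congr expR; apply: eq_bigr => j _; rewrite expr2.
by rewrite gaussE E -expRM; congr expR; field.
Qed.

Lemma gaussaM (a b : R) (t : 'rV[R]_d) : gaussa a t * gaussa b t = gaussa (a + b) t.
Proof.
rewrite /gaussa -big_split; apply: eq_bigr => j _ /=.
by rewrite -expRD; congr expR; ring.
Qed.

Lemma gaussa_le1 (a : R) (t : 'rV[R]_d) : 0 < a -> gaussa a t <= 1.
Proof.
move=> a0; apply: prodr_ile1 => j _.
by rewrite expR_ge0 -[leRHS]expR0 ler_expR oppr_le0 mulr_ge0 ?sqr_ge0// ltW.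
Qed.

(** This is what averaging achieves: after the exchange of the integrals, for each fixed [t] the
    translation by [tau] disappears by invariance, and the integral factors. *)
Lemma tint_shift_const (f : 'rV[R]_N -> X) (w : 'rV[R]_d -> R) L :
  (forall d' (S : measurableType d') (h : S -> 'rV[R]_N), vmeas h ->
    measurable_fun [set: S] ((fun s => normX (f (h s))) : S -> R)) ->
  (forall th j, f (th + (2 * pi) *: delta_mx 0 j) = f th) ->
  rmeas w -> (forall t, 0 <= w t) ->
  tint (fun th => iint (fun t => (w t * normX (f (th + tau N xi L t)) `^ p)%:E)) =
  (tint (fun th => (normX (f th) `^ p)%:E) * iint (fun t => (w t)%:E))%E.
Proof.
move=> mf fper mw w0.
have mp : measurable_fun setT ((fun x => x `^ p) : R -> R) by exact: measurable_powR.
have mtau d' (S : measurableType d') (h : S -> 'rV[R]_d) : vmeas h -> vmeas (fun s => tau N xi L (h s)).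
  move=> mh j; under eq_fun do rewrite mxE.
  apply: measurable_funM => //; apply: measurable_sum => i; apply: measurable_funM => //; exact: mh.
rewrite exchange_iintm.
- rewrite -iintmZl.
  + apply: eq_iintm => t; under eq_iintm do rewrite EFinM.
    rewrite iintmZl ?lee_fin//; last 2 first.
    * apply: rmeas_bmeas => d' S h mh; apply: (measurableT_comp mp); apply: mf.
      by move=> j; under eq_fun do rewrite mxE; apply: measurable_funD => //; exact: mh.
    * by move=> v; rewrite lee_fin powR_ge0.
    rewrite muleC (torus_shift (f := fun th => (normX (f th) `^ p)%:E))//.
    * by apply: rmeas_bmeas => d' S h mh; apply: (measurableT_comp mp); exact: mf.
    * by move=> v; rewrite lee_fin powR_ge0.
    * by move=> v j; rewrite fper.
  + by apply: iintm_ge0 => v; rewrite lee_fin powR_ge0.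
  + exact: rmeas_bmeas.
  + by move=> v; rewrite lee_fin.
- move=> d' S a h ma mh; apply/measurable_EFinP; apply: measurable_funM; first exact: mw.
  apply: (measurableT_comp mp); apply: mf => j; under eq_fun do rewrite mxE.
  exact: (measurable_funD (ma j) (mtau _ _ _ mh j)).
- by move=> u v; rewrite lee_fin mulr_ge0// powR_ge0.
Qed.
(** The error in [Tm_st] is uniform in [t] but not integrable over R^d. The weight [gaussa kk] makes
    it integrable, at the price of [kk + p / 2] instead of [p / 2] in the Gaussian integral on the
    left. *)
Lemma transference_pre (kk eta : R) : 0 < kk -> 0 < eta ->
  (tint (fun th => (normX (tpg ts th) `^ p)%:E) * (Num.sqrt (pi / (kk + p / 2)) ^+ d)%:E <=
   (c `^ p)%:E * (tint (fun th => (normX (tpf ts th) `^ p)%:E) *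
     (Num.sqrt (pi / (p / 2)) ^+ d)%:E) +
   (eta * Num.sqrt (pi / kk) ^+ d)%:E)%E.
Proof.
move=> kk0 eta0; have [M M0 mM] := m_bounded m_homog m_cont.
have p0 : 0 < p by rewrite (lt_trans ltr01).
have p20 : 0 < p / 2 by rewrite divr_gt0.
have B0 := B_ge0.
pose D := M * B; have D0 : 0 <= D by rewrite mulr_ge0.
(* [C] is the Lipschitz constant of the p-th power on $[0, D]$ times the sum [B] of the norms. An
   error of $\eta/(C+1)$ per wave hence changes the p-th power by at most $\eta$. *)
pose C := p * D `^ (p - 1) * B.
have C0 : 0 <= C by rewrite !mulr_ge0 ?powR_ge0 ?(ltW p0).
have eC : 0 < eta / (C + 1) by rewrite divr_gt0// ltr_pwDr.
near \oo => L.
have HL : forall th t, gauss t * normX (tpg ts (th + tau N xi L t)) <=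
    normX (Tm m (st L th) t) + eta / (C + 1) * B.
  by near: L; exact: Tm_st.
have gB th : normX (tpg ts th) <= D.
  apply: (le_trans (normX_sum _ _)); rewrite /D mulr_sumr; apply: ler_sum => k _.
  by rewrite normXZ normcM normc_expi mulr1 ler_wpM2r ?normX_ge0.
have g1 t : @gauss R d t <= 1.
  apply: prodr_ile1 => j _; rewrite (ltW (gs_gt0 _)) /gs -[leRHS]expR0 ler_expR.
  by rewrite oppr_le0 mulr_ge0 ?sqr_ge0.
pose a th t := gauss t * normX (tpg ts (th + tau N xi L t)).
have a0 th t : 0 <= a th t by rewrite mulr_ge0 ?gauss_ge0 ?normX_ge0.
have aP th t : a th t `^ p <= normX (Tm m (st L th) t) `^ p + eta.
  have aD : a th t <= D.
    by apply: le_trans (gB (th + tau N xi L t)); rewrite ler_piMl ?normX_ge0.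
  have h0 : 0 <= eta / (C + 1) * B by rewrite mulr_ge0// ltW.
  apply: (le_trans (powR_lip p1 (a0 th t) aD (normX_ge0 _) h0 (HL th t))).
  rewrite lerD2l.
  have -> : p * D `^ (p - 1) * (eta / (C + 1) * B) = C * (eta / (C + 1)) by rewrite /C; ring.
  rewrite mulrA ler_pdivrMr ?ltr_pwDr// mulrC ler_wpM2l ?(ltW eta0)// lerDl//.
pose w (t : 'rV[R]_d) := gaussa kk t * gauss t `^ p.
have wE t : w t = gaussa (kk + p / 2) t by rewrite /w gauss_powR gaussaM.
have mgs (b : R) : rmeas (@gaussa R d b).
  by have := @rmeas_gaussa R d b 0; under eq_fun do rewrite subr0.
have igs (b : R) : 0 < b -> iint (fun t => (@gaussa R d b t)%:E) = (Num.sqrt (pi / b) ^+ d)%:E.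
  by move=> b0; have := @iint_gaussa R d b 0 b0; under eq_iintm do rewrite subr0.
have step th : (iint (fun t => (w t * normX (tpg ts (th + tau N xi L t)) `^ p)%:E) <=
    (c `^ p)%:E * iint (fun t => (gaussa (p / 2) t * normX (tpf ts (th + tau N xi L t)) `^ p)%:E) +
    (eta * Num.sqrt (pi / kk) ^+ d)%:E)%E.
  have wa t : w t * normX (tpg ts (th + tau N xi L t)) `^ p = gaussa kk t * a th t `^ p.
    by rewrite /a powRM ?gauss_ge0 ?normX_ge0// mulrA.
  (* A measurable nonnegative minorant of the p-th power of the norm of [Tm], so that additivity of
     the integral is only applied to measurable functions. *)
  pose lo t := Num.max (gaussa kk t * a th t `^ p - eta * gaussa kk t) 0.
  have mlo : rmeas lo.
    apply: rmeas_max; last exact: rmeas_cst.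
    apply: rmeas_add; last by apply: rmeas_opp; apply: rmeas_mul => //; exact: rmeas_cst.
    apply: rmeas_mul => // d' S h mh.
    apply: (measurableT_comp (measurable_powR p)); apply: measurable_funM.
      have := @rmeas_gaussa R d 2^-1 0; under eq_fun do rewrite subr0.
      by move=> /(_ _ _ _ mh).
    apply: measurable_tpg => j; under eq_fun do rewrite !mxE.
    apply: measurable_funD => //; apply: measurable_funM => //.
    by apply: measurable_sum => i; apply: measurable_funM => //; exact: mh.
  have lo0 t : 0 <= lo t by rewrite le_max lexx orbT.
  apply: (@le_trans _ _ (iint (fun t => ((lo t)%:E + (eta * gaussa kk t)%:E)%E))).
    apply: le_iintm => t; first by rewrite lee_fin mulr_ge0 ?powR_ge0// mulr_ge0 ?gaussa_ge0 ?powR_ge0.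
    by rewrite -EFinD lee_fin wa -lerBlDr le_max lexx.
  rewrite iintmD; last 4 first.
  - exact: rmeas_bmeas.
  - by apply: rmeas_bmeas; apply: rmeas_mul => //; exact: rmeas_cst.
  - by move=> t; rewrite lee_fin.
  - by move=> t; rewrite lee_fin mulr_ge0 ?gaussa_ge0// ltW.
  apply: leeD.
    apply: (@le_trans _ _ (iint (fun t => (normX (Tm m (st L th) t) `^ p)%:E))).
      apply: le_iintm => t; first by rewrite lee_fin.
      rewrite lee_fin ge_max powR_ge0 andbT mulrC -mulrBl.
      have [ae|ae] := leP (a th t `^ p) eta.
        by apply: le_trans (powR_ge0 _ _); rewrite mulr_le0_ge0 ?gaussa_ge0// subr_le0.
      apply: (@le_trans _ _ (a th t `^ p - eta)).
        by rewrite ler_piMr ?gaussa_le1// subr_ge0 ltW.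
      by rewrite lerBlDr.
    apply: (le_trans (iint_Tm_le _)); first by move=> k; exact: st_schwartz.
    rewrite lee_wpmul2l ?lee_fin ?powR_ge0// le_iintm// => t; rewrite lee_fin ?powR_ge0//.
    by rewrite tensor_st powRM ?gauss_ge0 ?normX_ge0// gauss_powR.
  under eq_iintm do rewrite EFinM.
  rewrite iintmZl ?igs ?lee_fin ?(ltW eta0)//.
  - exact: rmeas_bmeas.
  - by move=> t; rewrite lee_fin gaussa_ge0.
have mg d' (S : measurableType d') (h : S -> 'rV[R]_N) : vmeas h ->
    measurable_fun [set: S] ((fun s => normX (tpf ts (h s))) : S -> R).
  by move=> mh; have := measurable_tpf ts 0 mh; under eq_fun do rewrite add0r.
have mp : measurable_fun setT ((fun x => x `^ p) : R -> R) by exact: measurable_powR.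
have mtau d' (S : measurableType d') (h : S -> 'rV[R]_d) : vmeas h -> vmeas (fun s => tau N xi L (h s)).
  move=> mh j; under eq_fun do rewrite mxE.
  apply: measurable_funM => //; apply: measurable_sum => i; apply: measurable_funM => //; exact: mh.
have jF : bmeas (fun th => iint (fun t => (gaussa (p / 2) t * normX (tpf ts (th + tau N xi L t)) `^ p)%:E)).
  move=> d' S h mh; apply: jmeas_iintm; last by move=> s t; rewrite lee_fin mulr_ge0 ?gaussa_ge0 ?powR_ge0.
  move=> d'' S' a' h' ma' mh'; apply/measurable_EFinP; apply: measurable_funM; first exact: mgs.
  apply: (measurableT_comp mp); apply: mg => j; under eq_fun do rewrite mxE.
  exact: (measurable_funD (measurableT_comp (mh j) ma') (mtau _ _ _ mh' j)).
have iF0 th : (0 <= iint (fun t => (gaussa (p / 2) t * normX (tpf ts (th + tau N xi L t)) `^ p)%:E))%E.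
  by apply: iintm_ge0 => t; rewrite lee_fin mulr_ge0 ?gaussa_ge0 ?powR_ge0.
have wf : (fun t => (w t)%:E) = (fun t => (gaussa (kk + p / 2) t)%:E).
  by apply/funext => t; rewrite wE.
have w0 t : 0 <= w t by rewrite wE gaussa_ge0.
have mw : rmeas w by rewrite (_ : w = gaussa (kk + p / 2)); [exact: mgs|exact/funext].
rewrite -igs ?addr_gt0// -wf.
rewrite -(@tint_shift_const (tpg ts) w L)//; last 2 first.
- by move=> d' S h mh; exact: measurable_tpg.
- by move=> th j; exact: tpg_per.
apply: (@le_trans _ _ (tint (fun th => ((c `^ p)%:E *
    iint (fun t => (gaussa (p / 2) t * normX (tpf ts (th + tau N xi L t)) `^ p)%:E) +
    (eta * Num.sqrt (pi / kk) ^+ d)%:E)%E))).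
  apply: le_iintm => th //; apply: iintm_ge0 => t.
  by rewrite lee_fin mulr_ge0// powR_ge0.
rewrite iintmD; last 4 first.
- by apply: bmeas_mul => //; exact: bmeas_cst.
- exact: bmeas_cst.
- by move=> th; rewrite mule_ge0 ?lee_fin ?powR_ge0.
- by move=> th; rewrite lee_fin mulr_ge0 ?exprn_ge0 ?sqrtr_ge0// ltW.
rewrite iintm_unif_cst iintmZl ?lee_fin ?powR_ge0//.
rewrite (@tint_shift_const (tpf ts) (gaussa (p / 2)) L)//; last 2 first.
- by move=> th j; exact: tpf_per.
- by move=> t; exact: gaussa_ge0.
by rewrite igs.
Unshelve. all: by end_near. Qed.

Lemma transference :
  (tint (fun th => (normX (tpg ts th) `^ p)%:E) <=
   (c `^ p)%:E * tint (fun th => (normX (tpf ts th) `^ p)%:E))%E.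
Proof.
have [M M0 mM] := m_bounded m_homog m_cont.
have p0 : 0 < p by rewrite (lt_trans ltr01).
have p20 : 0 < p / 2 by rewrite divr_gt0.
have fin (f : 'rV[R]_N -> X) (K : R) : (forall th, normX (f th) <= K) ->
    tint (fun th => (normX (f th) `^ p)%:E) \is a fin_num.
  move=> fK; rewrite ge0_fin_numE; last by apply: iintm_ge0 => th; rewrite lee_fin powR_ge0.
  apply: (@le_lt_trans _ _ (tint (fun _ => (K `^ p)%:E))); last by rewrite iintm_unif_cst ltry.
  apply: le_iintm => th; rewrite lee_fin ?powR_ge0//.
  by rewrite ge0_ler_powR ?nnegrE ?normX_ge0 ?(ltW p0)// (le_trans (normX_ge0 (f th))).
have fg : tint (fun th => (normX (tpg ts th) `^ p)%:E) \is a fin_num.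
  apply: (fin _ (M * B)) => th.
  apply: (le_trans (normX_sum _ _)); rewrite mulr_sumr; apply: ler_sum => k _.
  by rewrite normXZ normcM normc_expi mulr1 ler_wpM2r ?normX_ge0.
have ff : tint (fun th => (normX (tpf ts th) `^ p)%:E) \is a fin_num.
  apply: (fin _ B) => th.
  apply: (le_trans (normX_sum _ _)); apply: ler_sum => k _.
  by rewrite normXZ normc_expi mul1r.
have := transference_pre.
have : (0 <= tint (fun th => (normX (tpg ts th) `^ p)%:E))%E.
  by apply: iintm_ge0 => th; rewrite lee_fin powR_ge0.
rewrite -(fineK fg) -(fineK ff); move: (fine _) (fine _) => b a; rewrite lee_fin => a0 H.
rewrite -EFinM lee_fin.
have J0 : 0 < Num.sqrt (pi / (p / 2)) ^+ d.
  by rewrite exprn_gt0// sqrtr_gt0 divr_gt0// pi_gt0.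
apply: (@le_of_expr_lt1 R a _ d) => // r /andP[r0 r1].
(* The solution of $kk + p/2 = r^{-2} p/2$; the quotient of the two Gaussian integrals is then
   exactly $r^d$. *)
pose kk := p / 2 * (r ^- 2 - 1).
have kk0 : 0 < kk.
  by rewrite mulr_gt0// subr_gt0 invf_gt1 ?exprn_gt0// expr_lt1// ltW.
have kE : Num.sqrt (pi / (kk + p / 2)) = r * Num.sqrt (pi / (p / 2)).
  rewrite -[r in RHS]ger0_norm ?(ltW r0)// -sqrtr_sqr -sqrtrM ?sqr_ge0//.
  congr Num.sqrt; rewrite /kk; field.
  by rewrite !gt_eqF// ?exprn_gt0//= ?mulr_gt0//; lra.
rewrite -(ler_pM2r J0); apply/ler_addgt0Pr => e e0.
have K0 : 0 < Num.sqrt (pi / kk) ^+ d by rewrite exprn_gt0// sqrtr_gt0 divr_gt0// pi_gt0.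
have := H kk (e / Num.sqrt (pi / kk) ^+ d) kk0 ltac:(by rewrite divr_gt0).
rewrite -!EFinM -EFinD lee_fin kE exprMn divfK ?gt_eqF//.
by rewrite !mulrA [a * _]mulrC.
Qed.

End transference.

(** * Trigonometric polynomials close to indicator functions *)

Section trigonometric_polynomials.
Context (R : realType).

Definition trigsum (ks : seq (int * R[i])) (s : R) : R[i] :=
  \sum_(k <- ks) k.2 * expi (k.1%:~R * s).

Definition trigpoly (w : R -> R) := exists ks, forall s, (w s)%:C%C = trigsum ks s.

Lemma trigpoly_cst (c : R) : trigpoly (fun=> c).
Proof.
by exists [:: (0, c%:C%C)] => s; rewrite /trigsum big_seq1 mul0r expi0 mulr1.
Qed.

Lemma trigpolyD f g : trigpoly f -> trigpoly g -> trigpoly (fun s => f s + g s).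
Proof.
move=> [k1 h1] [k2 h2]; exists (k1 ++ k2) => s.
by rewrite rmorphD/= h1 h2 /trigsum big_cat.
Qed.

Lemma trigpolyM f g : trigpoly f -> trigpoly g -> trigpoly (fun s => f s * g s).
Proof.
move=> [k1 h1] [k2 h2].
exists [seq (a.1 + b.1, a.2 * b.2) | a <- k1, b <- k2] => s.
rewrite rmorphM/= h1 h2 /trigsum big_allpairs_dep/= mulr_suml.
apply: eq_bigr => a _; rewrite mulr_sumr; apply: eq_bigr => b _.
by rewrite intrD mulrDl expiD; ring.
Qed.

Lemma trigpolyX f n : trigpoly f -> trigpoly (fun s => f s ^+ n).
Proof.
move=> tf; elim: n => [|n IH].
  by under eq_fun do rewrite expr0; exact: trigpoly_cst.
by under eq_fun do rewrite exprS; exact: trigpolyM.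
Qed.

Lemma trigpoly_cos : trigpoly cos.
Proof.
exists [:: (1, 2^-1%:C%C); (-1, 2^-1%:C%C)] => s.
rewrite /trigsum big_cons big_seq1/= mul1r mulN1r -mulrDr.
by apply: complexP; rewrite ?ReM ?ImM ?ReD ?ImD /= ?cosN ?sinN; field.
Qed.

Local Notation U := (@unif R).

Definition mean (f : R -> R) : R := fine (\int[U]_s (f s)%:E).

Lemma unif_integrable (f : R -> R) (M : R) : measurable_fun setT f ->
  (forall s, `|f s| <= M) -> U.-integrable setT (EFin \o f).
Proof.
move=> mf fM; apply: (@le_integrable _ _ _ U setT measurableT _ (fun=> M%:E)).
- exact/measurable_EFinP.
- by move=> s _; rewrite lee_fin (le_trans (fM s))// ler_norm.
- exact: finite_measure_integrable_cst.
Qed.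

Lemma meanD (f g : R -> R) : U.-integrable setT (EFin \o f) -> U.-integrable setT (EFin \o g) ->
  mean (fun s => f s + g s) = mean f + mean g.
Proof.
move=> fi gi; rewrite /mean; under eq_integral do rewrite EFinD.
by rewrite integralD// fineD//; exact: integrable_fin_num.
Qed.

Lemma meanZ (c : R) (f : R -> R) : U.-integrable setT (EFin \o f) ->
  mean (fun s => c * f s) = c * mean f.
Proof.
move=> fi; rewrite /mean; under eq_integral do rewrite EFinM.
by rewrite integralZl// fineM//; exact: integrable_fin_num.
Qed.

Lemma mean_cst (c : R) : mean (fun=> c) = c.
Proof.
rewrite /mean integral_cst// [X in (_ * X)%E](_ : _ = 1%E) ?mule1//.
exact: (@probability_setT _ _ _ U).
Qed.

Lemma mean_le (f g : R -> R) : U.-integrable setT (EFin \o f) -> U.-integrable setT (EFin \o g) ->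
  (forall s, f s <= g s) -> mean f <= mean g.
Proof.
move=> fi gi fg; apply: fine_le; [exact: integrable_fin_num|exact: integrable_fin_num|].
by apply: le_integral => // s _; rewrite lee_fin.
Qed.

Lemma measurable_cos_lin (l : R) : measurable_fun setT ((fun s => cos (l * s)) : R -> R).
Proof.
apply: measurableT_comp; first exact: (continuous_measurable_fun (@continuous_cos R)).
exact: measurable_funM.
Qed.

Lemma measurable_sin_lin (l : R) : measurable_fun setT ((fun s => sin (l * s)) : R -> R).
Proof.
apply: measurableT_comp; first exact: (continuous_measurable_fun (@continuous_sin R)).
exact: measurable_funM.
Qed.

Lemma integrable_cos_lin (l : R) : U.-integrable setT (EFin \o (fun s => cos (l * s))).
Proof.
by apply: (@unif_integrable _ 1); [exact: measurable_cos_lin|move=> s; exact: norm_cos_le1].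
Qed.

Lemma integrable_sin_lin (l : R) : U.-integrable setT (EFin \o (fun s => sin (l * s))).
Proof.
by apply: (@unif_integrable _ 1); [exact: measurable_sin_lin|move=> s; exact: norm_sin_le1].
Qed.

(* f changes sign under a translation, which the uniform measure does not see *)
Lemma mean_antiperiodic (f : R -> R) (c : R) : measurable_fun setT f ->
  (forall s, `|f s| <= 1) -> (forall s, f (s + 2 * pi) = f s) ->
  (forall s, f (s + c) = - f s) -> mean f = 0.
Proof.
move=> mf f1 fper fc; have fi := unif_integrable mf f1.
have ci : U.-integrable setT (EFin \o (fun=> 1 : R)) by exact: finite_measure_integrable_cst.
have f0 s : 0 <= 1 + f s by have := f1 s; rewrite ler_norml; lra.
have H1 : measurable_fun setT (fun s => (1 + f s)%:E).
  by apply/measurable_EFinP; exact: measurable_funD.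
have E := @unif_shift R c _ H1 (fun s => ltac:(by rewrite lee_fin)) (fun s => ltac:(by rewrite /= fper)).
have {E} : mean (fun s => 1 + (-1) * f s) = mean (fun s => 1 + f s).
  by rewrite /mean -E; congr fine; apply: eq_integral => s _; rewrite fc mulN1r.
rewrite !meanD ?meanZ ?mean_cst//; first lra.
by rewrite (_ : _ \o _ = (fun s => (-1)%:E * (EFin \o f) s)%E); [exact: integrableZl|
  apply/funext => s; rewrite /= EFinM].
Qed.

Lemma cos_int_per (l : int) (s : R) : cos (l%:~R * (s + 2 * pi)) = cos (l%:~R * s).
Proof.
have := congr1 (fun z => complex.Re (expi (l%:~R * s) * z)) (expi_int2pi R l).
by rewrite -expiD -mulrDr mulr1.
Qed.

Lemma sin_int_per (l : int) (s : R) : sin (l%:~R * (s + 2 * pi)) = sin (l%:~R * s).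
Proof.
have := congr1 (fun z => complex.Im (expi (l%:~R * s) * z)) (expi_int2pi R l).
by rewrite -expiD -mulrDr mulr1.
Qed.

Lemma mean_cos (l : int) : l != 0 -> mean (fun s => cos (l%:~R * s)) = 0.
Proof.
move=> l0; apply: (@mean_antiperiodic _ (pi / l%:~R)).
- exact: measurable_cos_lin.
- by move=> s; exact: norm_cos_le1.
- by move=> s; exact: cos_int_per.
- move=> s; rewrite mulrDr mulrCA divff ?intr_eq0// mulr1 cosD cospi sinpi; ring.
Qed.

Lemma mean_sin (l : int) : l != 0 -> mean (fun s => sin (l%:~R * s)) = 0.
Proof.
move=> l0; apply: (@mean_antiperiodic _ (pi / l%:~R)).
- exact: measurable_sin_lin.
- by move=> s; exact: norm_sin_le1.
- by move=> s; exact: sin_int_per.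
- move=> s; rewrite mulrDr mulrCA divff ?intr_eq0// mulr1 sinD cospi sinpi; ring.
Qed.

(** Stated for an additive [P] in order to serve both the real and the imaginary part: only the zero
    frequency survives in the mean. *)
Lemma trigsum_part (ks : seq (int * R[i])) (P : R[i] -> R) :
  (forall z w, P (z + w) = P z + P w) -> P 0 = 0 ->
  (forall (k : int * R[i]), exists a b : R, forall s, P (k.2 * expi (k.1%:~R * s)) = a * cos (k.1%:~R * s) + b * sin (k.1%:~R * s)) ->
  U.-integrable setT (EFin \o (fun s => P (trigsum ks s))) /\
  mean (fun s => P (trigsum ks s)) = P (\sum_(k <- ks | k.1 == 0) k.2).
Proof.
move=> PD P0 Pk; elim: ks => [|k ks [IH1 IH2]].
  rewrite big_nil; have E : (fun s => P (trigsum [::] s)) = (fun=> 0).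
    by apply/funext => s; rewrite /trigsum big_nil.
  rewrite E P0 mean_cst; split => //; exact: finite_measure_integrable_cst.
have [a [b ab]] := Pk k.
have E : (fun s => P (trigsum (k :: ks) s)) =
    (fun s => (a * cos (k.1%:~R * s) + b * sin (k.1%:~R * s)) + P (trigsum ks s)).
  by apply/funext => s; rewrite /trigsum big_cons PD ab.
have Zi (c : R) (f : R -> R) : U.-integrable setT (EFin \o f) -> U.-integrable setT (EFin \o (fun s => c * f s)).
  by move=> fi; rewrite (_ : _ \o _ = (fun s => c%:E * (EFin \o f) s)%E); [exact: integrableZl|
    apply/funext => s; rewrite /= EFinM].
have i1 := Zi a _ (integrable_cos_lin k.1%:~R); have i2 := Zi b _ (integrable_sin_lin k.1%:~R).
have i3 : U.-integrable setT (EFin \o (fun s => a * cos (k.1%:~R * s) + b * sin (k.1%:~R * s))).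
  exact: (integrableD measurableT i1 i2).
rewrite E; split; first exact: (integrableD measurableT i3 IH1).
rewrite meanD// meanD// !meanZ; [|exact: integrable_sin_lin|exact: integrable_cos_lin].
rewrite big_cons; have [k0|k0] := eqVneq k.1 0.
  rewrite PD -IH2; congr (_ + _); have := ab 0.
  rewrite k0 mulr0 expi0 mulr1 cos0 sin0 => ->.
  under eq_fun do rewrite mul0r cos0; under [X in _ + _ * mean X]eq_fun do rewrite mul0r sin0.
  by rewrite !mean_cst.
by rewrite mean_cos// mean_sin// IH2 !mulr0 !add0r.
Qed.

(** Consequently, deleting the terms of frequency zero subtracts the mean. *)
Lemma mean_trigpoly (w : R -> R) ks : (forall s, (w s)%:C%C = trigsum ks s) ->
  U.-integrable setT (EFin \o w) /\
  \sum_(k <- ks | k.1 == 0) k.2 = (mean w)%:C%C.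
Proof.
move=> wE.
have wRe s : complex.Re (trigsum ks s) = w s by rewrite -wE.
have wIm s : complex.Im (trigsum ks s) = 0 by rewrite -wE.
have [i1 m1] := @trigsum_part ks (@complex.Re R) (@ReD R) erefl
  ltac:(by move=> k; exists (complex.Re k.2), (- complex.Im k.2) => s; rewrite ReM /= mulNr).
have [i2 m2] := @trigsum_part ks (@complex.Im R) (@ImD R) erefl
  ltac:(by move=> k; exists (complex.Im k.2), (complex.Re k.2) => s; rewrite ImM /= addrC).
split; first by move: i1; under [X in EFin \o X]eq_fun do rewrite wRe.
apply: complexP => /=.
  by rewrite -m1; congr mean; apply/funext => s; rewrite wRe.
by rewrite -m2 (_ : (fun _ => _) = fun=> 0) ?mean_cst//; apply/funext => s; rewrite wIm.
Qed.

End trigonometric_polynomials.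

Section soft_indicator.
Context (R : realType).
Implicit Types (y s q : R).
Local Notation leb := (@lebesgue_measure R).
Local Notation U := (@unif R).

(* [1 - (1 - y ^ n) ^ (2 ^ n)] tends to 0 for [y < 1/2] and to 1 for [y > 1/2]. *)
Definition steep n y : R := 1 - (1 - y ^+ n) ^+ (2 ^ n)%N.

Lemma steep_itv n y : 0 <= y <= 1 -> 0 <= steep n y <= 1.
Proof.
move=> /andP[y0 y1]; have h0 : 0 <= 1 - y ^+ n by rewrite subr_ge0 exprn_ile1.
have h1 : 1 - y ^+ n <= 1 by rewrite gerBl exprn_ge0.
by rewrite /steep subr_ge0 exprn_ile1//= gerBl exprn_ge0.
Qed.

(** Bernoulli's inequality $(1-z)^N \ge 1 - Nz$ for $z = y^n$ and $N = 2^n$. *)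
Lemma steep_le n y : 0 <= y <= 1 -> steep n y <= (2 * y) ^+ n.
Proof.
move=> /andP[y0 y1]; rewrite /steep.
have h (N : nat) (z : R) : 0 <= z <= 1 -> 1 - N%:R * z <= (1 - z) ^+ N.
  move=> /andP[z0 z1]; elim: N => [|N IH]; first by rewrite mul0r subr0 expr0.
  rewrite exprS; have h1 : 0 <= 1 - z by lra.
  apply: (@le_trans _ _ ((1 - z) * (1 - N%:R * z))); last exact: ler_wpM2l.
  have : 0 <= N%:R * z * z by rewrite !mulr_ge0.
  rewrite -natr1; lra.
have := h (2 ^ n)%N (y ^+ n); rewrite exprn_ge0// exprn_ile1// natrX -exprMn => /(_ isT).
lra.
Qed.

(** The companion inequality $(1-z)^N (1 + Nz) \le 1$ for the same $z$ and $N$. *)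
Lemma steep_ge n y : 0 <= y <= 1 -> (1 - steep n y) * (2 * y) ^+ n <= 1.
Proof.
move=> /andP[y0 y1]; rewrite /steep subKr exprMn -natrX.
have h (N : nat) (z : R) : 0 <= z <= 1 -> (1 - z) ^+ N * (1 + N%:R * z) <= 1.
  move=> /andP[z0 z1]; elim: N => [|N IH]; first by rewrite mul0r addr0 expr0 mulr1.
  apply: le_trans IH; rewrite exprSr -mulrA.
  have h0 : 0 <= (1 - z) ^+ N by rewrite exprn_ge0//; lra.
  apply: ler_wpM2l => //.
  have : 0 <= N%:R * z * z by rewrite !mulr_ge0.
  rewrite -natr1; nra.
have hz : 0 <= y ^+ n <= 1 by rewrite exprn_ge0// exprn_ile1.
apply: le_trans (h (2 ^ n)%N _ hz); apply: ler_wpM2l; last by rewrite lerDr.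
by rewrite exprn_ge0// subr_ge0; case/andP: hz.
Qed.

Lemma steep_cvg0 y : 0 <= y < 2^-1 -> (fun n => steep n y) @ \oo --> (0 : R).
Proof.
move=> /andP[y0 y1]; have yy : 0 <= y <= 1 by apply/andP; lra.
apply: (@squeeze_cvgr _ _ _ _ (fun=> 0) (fun n => (2 * y) ^+ n)).
- by apply: nearW => n; rewrite steep_le// andbT; case/andP: (steep_itv n yy).
- exact: cvg_cst.
- by apply: cvg_expr; rewrite ger0_norm; lra.
Qed.

Lemma steep_cvg1 y : 2^-1 < y <= 1 -> (fun n => steep n y) @ \oo --> (1 : R).
Proof.
move=> /andP[y0 y1]; have yy : 0 <= y <= 1 by apply/andP; lra.
have E : (fun n => steep n y) = (fun n => 1 - (1 - steep n y)) by apply/funext => n; rewrite subKr.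
rewrite E -[X in _ --> X]subr0; apply: cvgB; first exact: cvg_cst.
apply: (@squeeze_cvgr _ _ _ _ (fun=> 0) (fun n => ((2 * y)^-1) ^+ n)).
- apply: nearW => n; rewrite subr_ge0; have /andP[_ -> /=] := steep_itv n yy.
  by rewrite exprVn -[leRHS]mul1r ler_pdivlMr ?steep_ge// exprn_gt0//; lra.
- exact: cvg_cst.
- apply: cvg_expr; rewrite ger0_norm ?invr_ge0; last lra.
  by rewrite invf_lt1; lra.
Qed.

(* On [[0, 2 pi[] the set where [- cos s > cos s0] is the interval of radius [s0] around [pi]. *)
Definition cosarg s0 s : R := 2^-1 + (- cos s - cos s0) / 4.

Lemma cosarg_itv s0 s : 0 <= cosarg s0 s <= 1.
Proof.
have := cos_le1 s; have := cos_le1 s0; have := cos_geN1 s; have := cos_geN1 s0.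
by rewrite /cosarg => ? ? ? ?; apply/andP; lra.
Qed.

Lemma cosarg_lt s0 s : 0 <= s0 <= pi -> 0 <= s < 2 * pi ->
  (`|s - pi| < s0 -> 2^-1 < cosarg s0 s) /\ (s0 < `|s - pi| -> cosarg s0 s < 2^-1).
Proof.
move=> hs0 /andP[h1 h2].
have E : - cos s = cos `|s - pi|.
  have -> : cos `|s - pi| = cos (s - pi) by case: (ger0P (s - pi)) => // _; rewrite cosN.
  by rewrite cosB cospi sinpi; ring.
have hn : 0 <= `|s - pi| <= pi by rewrite normr_ge0 ler_norml; lra.
rewrite /cosarg E; split => h.
  have : cos s0 < cos `|s - pi| by rewrite ltr_cos// in_itv.
  lra.
have : cos `|s - pi| < cos s0 by rewrite ltr_cos// in_itv.
lra.
Qed.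

Definition chi s0 s : R := if `|s - pi| < s0 then 1 else 0.

Lemma chiE s0 : chi s0 = \1_`]pi - s0, pi + s0[%classic.
Proof.
apply/funext => s; rewrite /chi indicE mem_setE in_itv/= ltr_norml.
by rewrite ltrBrDr ltrBlDr [- s0 + pi]addrC [s0 + pi]addrC; case: ifP.
Qed.

Lemma measurable_chi s0 : measurable_fun setT (chi s0 : measurableTypeR R -> R).
Proof. by rewrite chiE; exact: measurable_indic. Qed.

Lemma mean_chi q : 0 < q < 1 -> mean (chi (pi * q)) = q.
Proof.
move=> /andP[q0 q1]; rewrite /mean integral_unif.
- have pi0 := pi_gt0 R.
  have E : (\int[leb]_(x in `[0%R, (2 * pi)%R[) (chi (pi * q) x)%:E = (2 * pi * q)%:E)%E.
    rewrite chiE integral_indic//= setIidl.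
      have /= -> := lebesgue_measure_itv `]pi - pi * q, pi + pi * q[%R.
      rewrite lte_fin ifT; first by rewrite -EFinD; congr EFin; ring.
      by rewrite ltrBlDr -addrA ltrDl addr_gt0// mulr_gt0.
    by move=> x /=; rewrite !in_itv/= => /andP[h1 h2]; apply/andP; split; nra.
  by rewrite E/= mulrA mulVf ?mul1r// gt_eqF// twopi_gt0.
- by apply/measurable_EFinP; exact: measurable_chi.
- by move=> x; rewrite lee_fin /chi; case: ifP.
Qed.

Lemma trigpoly_steep n s0 : trigpoly (fun s => steep n (cosarg s0 s)).
Proof.
have T1 : trigpoly (fun s => cosarg s0 s).
  have -> : (fun s => cosarg s0 s) = (fun s => (2^-1 - cos s0 / 4) + (- 4^-1) * cos s).
    by apply/funext => s; rewrite /cosarg; ring.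
  apply: trigpolyD; first exact: trigpoly_cst.
  by apply: trigpolyM; [exact: trigpoly_cst|exact: trigpoly_cos].
have T2 : trigpoly (fun s => 1 + (-1) * cosarg s0 s ^+ n).
  apply: trigpolyD; first exact: trigpoly_cst.
  by apply: trigpolyM; [exact: trigpoly_cst|exact: trigpolyX].
have -> : (fun s => steep n (cosarg s0 s)) = (fun s => 1 + (-1) * (1 + (-1) * cosarg s0 s ^+ n) ^+ (2 ^ n)).
  by apply/funext => s; rewrite /steep !mulN1r.
apply: trigpolyD; first exact: trigpoly_cst.
by apply: trigpolyM; [exact: trigpoly_cst|exact: trigpolyX].
Qed.

Lemma measurable_trigpoly w : trigpoly w -> measurable_fun setT (w : measurableTypeR R -> R).
Proof.
move=> [ks /mean_trigpoly[/measurable_int]].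
by move=> /measurable_EFinP.
Qed.

Lemma steep_cvg_mean s0 : 0 < s0 < pi ->
  (fun n => \int[U]_s (`|steep n (cosarg s0 s) - chi s0 s|)%:E)%E @ \oo --> 0%E.
Proof.
move=> /andP[s00 s0pi].
pose F n s : \bar R := (`|steep n (cosarg s0 s) - chi s0 s|)%:E.
have mF n : measurable_fun setT (F n : measurableTypeR R -> \bar R).
  apply/measurable_EFinP; apply: measurableT_comp => //; apply: measurable_funB.
    exact: (measurable_trigpoly (trigpoly_steep n s0)).
  exact: measurable_chi.
have F0 n s : (0 <= F n s)%E by rewrite lee_fin.
have mD : measurable (`[0%R, (2 * pi)%R[%classic : set (measurableTypeR R)) by exact: measurable_itv.
have H : (\forall x \ae leb, (`[0%R, (2 * pi)%R[%classic : set R) x -> F n x @[n --> \oo] --> 0%E).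
  (* At these two points [cosarg] is 1/2 and [steep] tends to neither 0 nor 1. *)
  exists [set pi - s0; pi + s0]; split.
  - by apply: measurableU; exact: measurable_set1.
  - by apply: countable_lebesgue_measure0; apply: finite_set_countable.
  - move=> s /= hs; apply: contrapT => hne; apply: hs; rewrite in_itv/= => hs.
    have hs0 : 0 <= s0 <= pi by rewrite !ltW.
    have [c1 c2] := cosarg_lt hs0 hs.
    have /andP[y0 y1] := cosarg_itv s0 s.
    rewrite /F; apply: cvg_EFin; first exact: nearW.
    rewrite [X in X @ _ --> _](_ : _ = (fun n => `|steep n (cosarg s0 s) - chi s0 s|))//.
    rewrite -(@normr0 _ R); apply: cvg_norm; rewrite -[X in _ --> X](subrr (chi s0 s)).
    apply: cvgB; last exact: cvg_cst.
    rewrite /chi; case: ltP => h; first by apply: steep_cvg1; rewrite y1 c1.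
    apply: steep_cvg0; rewrite y0 c2// lt_neqAle h andbT; apply/eqP => e; apply: hne.
    have [sp|sp] := ger0P (s - pi).
      by right; rewrite e ger0_norm// subrKC.
    by left; rewrite e ltr0_norm//; ring.
have H2 : leb.-integrable `[0%R, (2 * pi)%R[ (fun=> 1%E : \bar R).
  apply/integrableP; split => //; rewrite integral_cst//=.
  have /= -> := lebesgue_measure_itv `[0%R, (2 * pi)%R[%R.
  by case: ifP => _; rewrite /= normr1 mul1e ltry.
have H3 : (\forall x \ae leb, forall n, (`[0%R, (2 * pi)%R[%classic : set R) x -> (`|F n x| <= 1)%E).
  apply: aeW => x n _; rewrite /F abse_EFin lee_fin normr_id ler_norml.
  have /andP[h1 h2] := steep_itv n (cosarg_itv s0 x).
  by rewrite /chi; case: ifP => _; lra.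
have [_ _] := @dominated_convergence _ _ _ leb _ mD F (fun=> 0%E) (fun=> 1%E)
  (fun n => measurable_funTS (mF n)) (measurable_cst _) H H2 H3.
rewrite integral0 => H4.
rewrite (_ : (fun _ => _) = fun n => ((2 * pi)^-1%:E * \int[leb]_(x in `[0%R, (2 * pi)%R[) F n x)%E); last first.
  by apply/funext => n; exact: (integral_unif (mF n) (F0 n)).
rewrite -(mule0 ((2 * pi)^-1)%:E).
exact: (cvgeZl _ H4).
Qed.

(* A small mean of [w (1 - w)] says that [w] is close to an indicator function. *)
Lemma binary_split q (e : R) : 0 <= q <= 1 -> 0 < e ->
  exists w, [/\ trigpoly w, forall s, 0 <= w s <= 1, mean w = q &
    mean (fun s => w s * (1 - w s)) <= e].
Proof.
move=> /andP[]; rewrite le_eqVlt => /predU1P[<- _ e0|q0].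
  exists (fun=> 0); split; [exact: trigpoly_cst|by move=> s; rewrite lexx ler01|exact: mean_cst|].
  by under eq_fun do rewrite mul0r; rewrite mean_cst ltW.
rewrite le_eqVlt => /predU1P[-> e0|q1 e0].
  exists (fun=> 1); split; [exact: trigpoly_cst|by move=> s; rewrite lexx ler01|exact: mean_cst|].
  by under eq_fun do rewrite subrr mulr0; rewrite mean_cst ltW.
pose l := Num.min (e / 2) (2^-1).
have l0 : 0 < l by rewrite lt_min; lra.
have [le le2] : l <= e / 2 /\ l <= 2^-1 by rewrite !ge_min !lexx orbT.
pose e1 := Num.min (e / 2) (l * Num.min q (1 - q)).
have e10 : 0 < e1 by rewrite lt_min divr_gt0// mulr_gt0// lt_min q0 subr_gt0.
have e1e : e1 <= e / 2 by rewrite ge_min lexx.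
have e1q : e1 <= l * q.
  by rewrite (@le_trans _ _ (l * Num.min q (1 - q)))// ?ge_min ?lexx ?orbT// ler_pM2l// ge_min lexx.
have e1q' : e1 <= l * (1 - q).
  by rewrite (@le_trans _ _ (l * Num.min q (1 - q)))// ?ge_min ?lexx ?orbT// ler_pM2l// ge_min lexx orbT.
have hs0 : 0 < pi * q < pi by rewrite mulr_gt0 ?pi_gt0//= gtr_pMr// pi_gt0.
have /fine_cvgP[_ /cvgrPdist_le /(_ _ e10)[n _ /(_ n (leqnn n))]] := steep_cvg_mean hs0.
rewrite sub0r normrN => /(le_trans (ler_norm _)); rewrite -/(mean _).
set w := (fun s => steep n (cosarg (pi * q) s)); set c := chi (pi * q) => hm.
have {}hm : mean (fun s => `|w s - c s|) <= e1 := hm.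
have tw : trigpoly w by exact: trigpoly_steep.
have w01 s : 0 <= w s <= 1 by apply: steep_itv; exact: cosarg_itv.
have c01 s : (c s == 0) || (c s == 1) by rewrite /c /chi; case: ifP => _; rewrite eqxx ?orbT.
have c01' s : 0 <= c s <= 1 by case/orP: (c01 s) => /eqP ->; rewrite ?lexx ?ler01.
have mw := measurable_trigpoly tw; have mc : measurable_fun setT (c : measurableTypeR R -> R) by exact: measurable_chi.
have iw : U.-integrable setT (EFin \o w).
  by apply: (@unif_integrable _ _ 1) => // s; rewrite ger0_norm; case/andP: (w01 s).
have ic : U.-integrable setT (EFin \o c).
  by apply: (@unif_integrable _ _ 1) => // s; rewrite ger0_norm; case/andP: (c01' s).
have iwc : U.-integrable setT (EFin \o (fun s => `|w s - c s|)).
  apply: (@unif_integrable _ _ 1); first by apply: measurableT_comp => //; exact: measurable_funB.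
  by move=> s; rewrite normr_id ler_norml; have := w01 s; have := c01' s; lra.
have mcq : mean c = q by apply: mean_chi; rewrite q0.
have u1 : mean w <= q + e1.
  rewrite -mcq; apply: (@le_trans _ _ (mean (fun s => c s + `|w s - c s|))).
    apply: mean_le => //; first exact: (integrableD measurableT ic iwc).
    by move=> s; rewrite -lerBlDl ler_norm.
  by rewrite meanD// lerD2l.
have u2 : q <= mean w + e1.
  rewrite -[in leLHS]mcq; apply: (@le_trans _ _ (mean (fun s => w s + `|w s - c s|))).
    apply: mean_le => //; first exact: (integrableD measurableT iw iwc).
    by move=> s; rewrite -lerBlDl distrC ler_norm.
  by rewrite meanD// lerD2l.
(* The mean of [w] differs from [q] by at most [e1]. Mixing with the constant [r] restores it
   exactly, and $e_1 \le l \min(q, 1-q)$ is what keeps [r] between 0 and 1. *)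
pose r := (q - (1 - l) * mean w) / l.
have r0 : 0 <= r by apply: divr_ge0; [nra|exact: ltW].
have r1 : r <= 1 by rewrite ler_pdivrMr// mul1r; nra.
have v01 s : 0 <= (1 - l) * w s + l * r <= 1 by have := w01 s; nra.
have tv : trigpoly (fun s => (1 - l) * w s + l * r).
  apply: trigpolyD; last exact: trigpoly_cst.
  by apply: trigpolyM => //; exact: trigpoly_cst.
exists (fun s => (1 - l) * w s + l * r); split => //.
  rewrite meanD ?mean_cst ?meanZ//.
  - by rewrite /r mulrCA mulfV ?gt_eqF// mulr1 subrKC.
  - by rewrite (_ : _ \o _ = (fun s => (1 - l)%:E * (EFin \o w) s)%E); [exact: integrableZl|
      apply/funext => s; rewrite /= EFinM].
  - exact: finite_measure_integrable_cst.
apply: (@le_trans _ _ (mean (fun s => `|w s - c s| + l))); last first.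
  rewrite meanD ?mean_cst//; first lra.
  exact: finite_measure_integrable_cst.
apply: mean_le.
- apply: (@unif_integrable _ _ 1).
    have mv := measurable_trigpoly tv.
    by apply: measurable_funM => //; exact: measurable_funB.
  by move=> s; rewrite ger0_norm; have := v01 s; nra.
- have il : U.-integrable setT (EFin \o (fun=> l)) by exact: finite_measure_integrable_cst.
  exact: (integrableD measurableT iwc il).
(* Since [c] only takes the values 0 and 1, the product is at most the distance from [w] to [c];
   mixing with weight [l] then adds at most [l]. *)
- move=> s; have h1 : w s * (1 - w s) <= `|w s - c s|.
    have := w01 s; case/orP: (c01 s) => /eqP -> /andP[a1 a2].
      by rewrite subr0 ger0_norm//; nra.
    by rewrite distrC ger0_norm ?subr_ge0//; nra.
  apply: le_trans (lerD h1 (lexx l)).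
  have /andP[a1 a2] := w01 s; have rr : 0 <= r <= 1 by rewrite r0.
  have := v01 s.
  have E : ((1 - l) * w s + l * r) * (1 - ((1 - l) * w s + l * r)) = w s * (1 - w s) + l * ((r - w s) * (1 - 2 * w s - l * (r - w s))) by ring.
  rewrite E lerD2l => _; rewrite -[leRHS]mulr1; apply: ler_wpM2l; first exact: ltW.
  have [ra|ra] := leP (w s) r.
    by have : (r - w s) * (1 - 2 * w s - l * (r - w s)) <= (r - w s) * 1; [apply: ler_wpM2l; nra|lra].
  rewrite -mulrNN opprB; have : (w s - r) * - (1 - 2 * w s - l * (r - w s)) <= (w s - r) * 1.
    by apply: ler_wpM2l; nra.
  lra.
Qed.

End soft_indicator.

(** * Martingale trees *)

Section convexity.
Context (R : realType) (X : normedModType R[i]) (p : R).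
Hypothesis p1 : 1 < p.

Lemma powR_convex (t a b : R) : 0 <= t <= 1 -> 0 <= a -> 0 <= b ->
  (t * a + (1 - t) * b) `^ p <= t * a `^ p + (1 - t) * b `^ p.
Proof.
move=> /andP[t0 t1] a0 b0.
have := @convex_powR R p (ltW p1) (Itv01 t0 t1) a b.
rewrite !inE/= !in_itv/= !andbT => /(_ a0 b0); exact.
Qed.

Lemma normX_pow_convex (t : R) (x y : X) : 0 <= t <= 1 ->
  normX (t%:C%C *: x + (1 - t)%:C%C *: y) `^ p <=
  t * normX x `^ p + (1 - t) * normX y `^ p.
Proof.
move=> /[dup] ht /andP[t0 t1]; apply: le_trans (powR_convex ht (normX_ge0 _) (normX_ge0 _)).
have t1' : 0 <= 1 - t by rewrite subr_ge0.
apply: ge0_ler_powR; rewrite ?nnegrE ?normX_ge0 ?addr_ge0 ?mulr_ge0 ?normX_ge0//.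
  by rewrite (le_trans ler01)// ltW.
by apply: le_trans (normXD _ _) _; rewrite !normXZ !normc_real !ger0_norm.
Qed.

(** A converse of convexity. The distances from [z] to [x] and [y] are at most $2M(1-t)$ and $2Mt$,
    so by [powR_lip] each end contributes $p M^{p-1} \cdot 2M\, t(1-t)$ after weighting. *)
Lemma normX_pow_concave (t M : R) (x y : X) : 0 <= t <= 1 ->
  normX x <= M -> normX y <= M ->
  t * normX x `^ p + (1 - t) * normX y `^ p <=
  normX (t%:C%C *: x + (1 - t)%:C%C *: y) `^ p + 4 * p * M `^ (p - 1) * M * (t * (1 - t)).
Proof.
move=> /andP[t0 t1] xM yM; set z : X := _ *: x + _; have t1' : 0 <= 1 - t by rewrite subr_ge0.
have M0 : 0 <= M by rewrite (le_trans _ xM)// normX_ge0.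
have cmb (a b : R[i]) (u v : X) : a + b = 1 -> u - (a *: u + b *: v) = b *: (u - v).
  move=> ab; rewrite -[X in X - _]scale1r -ab scalerDl opprD addrACA subrr add0r.
  by rewrite scalerBr.
have xy : normX (x - y) <= 2 * M.
  by rewrite (le_trans (normXD _ _))// normXN; lra.
have h (u : R) (v w : X) : 0 <= u -> normX v <= M -> normX (v - w) <= u * (2 * M) ->
    normX v `^ p <= normX w `^ p + p * M `^ (p - 1) * (u * (2 * M)).
  move=> u0 vM vw; apply: powR_lip; rewrite ?normX_ge0 ?mulr_ge0//.
  by rewrite -lerBlDl (le_trans (normXBl _ _)).
have hx := h (1 - t) x z t1' xM.
have hy := h t y z t0 yM.
have {}hx : normX x `^ p <= normX z `^ p + p * M `^ (p - 1) * ((1 - t) * (2 * M)).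
  apply: hx; rewrite (_ : x - z = (1 - t)%:C%C *: (x - y)).
    by rewrite normXZ normc_real ger0_norm// ler_wpM2l.
  by apply: cmb; rewrite -rmorphD/= subrKC.
have {}hy : normX y `^ p <= normX z `^ p + p * M `^ (p - 1) * (t * (2 * M)).
  apply: hy; rewrite (_ : y - z = t%:C%C *: (y - x)).
    by rewrite normXZ normc_real ger0_norm// ler_wpM2l// normXC.
  by rewrite /z [_ *: x + _]addrC; apply: cmb; rewrite -rmorphD/= subrK.
have := lerD (ler_wpM2l t0 hx) (ler_wpM2l t1' hy).
set a := normX x `^ p; set b := normX y `^ p; set k := M `^ _; set e := normX z `^ p.
move=> /le_trans; apply; rewrite le_eqVlt; apply/orP; left; apply/eqP; ring.
Qed.

End convexity.

Section frequency_step.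
Context (R : realType).

Definition zcons n (l : int) (nu : 'rV[int]_n) : 'rV[int]_n.+1 := row_mx (\row_(j < 1) l) nu.

Lemma zcons0 n l (nu : 'rV[int]_n) : zcons l nu 0 0 = l.
Proof.
have -> : (0 : 'I_n.+1) = lshift n (0 : 'I_1) by exact: val_inj.
by rewrite /zcons (@row_mxEl _ 1 1 n) mxE.
Qed.

Lemma zconsS n l (nu : 'rV[int]_n) j : zcons l nu 0 (lift 0 j) = nu 0 j.
Proof.
have -> : lift 0 j = rshift 1 j by exact: val_inj.
by rewrite /zcons (@row_mxEr _ 1 1 n).
Qed.

Lemma dotZ_zcons n l (nu : 'rV[int]_n) (s : R) th :
  dotZ (zcons l nu) (vcons s th) = l%:~R * s + dotZ nu th.
Proof.
rewrite /dotZ big_ord_recl zcons0 vcons0; congr (_ + _).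
by apply: eq_bigr => j _; rewrite zconsS vconsS.
Qed.

Lemma Lam_zcons d n l (nu : 'rV[int]_n) (xi : nat -> 'rV[R]_d) L :
  Lam xi (zcons l nu) L = L%:R *: (l%:~R *: xi 0%N + Lam (fun j => xi j.+1) nu L).
Proof.
rewrite LamS zcons0; congr (_ *: (_ + _)).
by apply: eq_bigr => j _; rewrite mxE zconsS.
Qed.

Lemma Lam0 d n (xi : nat -> 'rV[R]_d) L : Lam xi (0 : 'rV[int]_n) L = 0.
Proof. by apply: big1 => j _; rewrite mxE mul0r scale0r. Qed.

Lemma dotZ0 n (th : 'rV[R]_n) : dotZ 0 th = 0.
Proof. by apply: big1 => j _; rewrite mxE mul0r. Qed.

End frequency_step.

Section trees.
Context (R : realType) (X : normedModType R[i]) (p : R) (d : nat)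
  (m : 'rV[R]_d -> (R[i])^o).
Hypothesis p1 : 1 < p.
Local Notation tint := (iintm (@unif R)).
Local Notation term N := ('rV[int]_N * 'rV[R]_d * X)%type.
Local Notation Psi x := (normX x `^ p).

(* [tree xis E]: [E] is the expectation functional of the pair
   [(\sum_n dx_n, \sum_n m (xi_n) dx_n)] for a finite Walsh-Paley like martingale
   with difference sequence [dx_n] and directions [xi_n] listed in [xis]. *)
Inductive tree : seq 'rV[R]_d -> ((X -> X -> R) -> R) -> Prop :=
| tree_leaf : tree [::] (fun Phi => Phi 0 0)
| tree_node xi xis q xL xR EL ER E : 0 <= q <= 1 ->
    q%:C%C *: xL + (1 - q)%:C%C *: xR = 0 -> tree xis EL -> tree xis ER ->
    (forall Phi, E Phi = q * EL (fun a b => Phi (xL + a) ((m xi : R[i]) *: xL + b)) +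
       (1 - q) * ER (fun a b => Phi (xR + a) ((m xi : R[i]) *: xR + b))) ->
    tree (xi :: xis) E.

Definition dirs N (xi : nat -> 'rV[R]_d) (ts : seq (term N)) :=
  forall k, k \in ts -> k.1.2 != 0 /\ dirto (Lam xi k.1.1) k.1.2.

(** The variable of the new node is put in front. The powers of [L] grow to the right, so it does
    not disturb the directions of the later steps. *)
Definition extend N (kw : seq (int * R[i])) (ts : seq (term N)) : seq (term N.+1) :=
  [seq (zcons k.1 t.1.1, t.1.2, k.2 *: t.2) | k <- kw, t <- ts].

Lemma dirs_extend N xi kw (ts : seq (term N)) :
  dirs (fun j => xi j.+1) ts -> dirs xi (extend kw ts).
Proof.
move=> H k /allpairsP[[a t] /= [_ /H[t0 tl] ->]]; split => //=.
have -> : Lam xi (zcons a.1 t.1.1) = fun L => L%:R *: (a.1%:~R *: xi 0%N + Lam (fun j => xi j.+1) t.1.1 L).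
  by apply/funext => L; exact: Lam_zcons.
exact: dirto_step.
Qed.

Lemma tpf_extend N kw (ts : seq (term N)) s th :
  tpf (extend kw ts) (vcons s th) = trigsum kw s *: tpf ts th.
Proof.
rewrite /tpf /extend big_allpairs_dep/= /trigsum scaler_suml; apply: eq_bigr => k _.
rewrite scaler_sumr; apply: eq_bigr => t _.
by rewrite dotZ_zcons expiD !scalerA; congr (_ *: _); ring.
Qed.

Lemma tpg_extend N kw (ts : seq (term N)) s th :
  tpg m (extend kw ts) (vcons s th) = trigsum kw s *: tpg m ts th.
Proof.
rewrite /tpg /extend big_allpairs_dep/= /trigsum scaler_suml; apply: eq_bigr => k _.
rewrite scaler_sumr; apply: eq_bigr => t _.
by rewrite dotZ_zcons expiD !scalerA; congr (_ *: _); ring.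
Qed.

(** The increment at a node. Its zero frequency is filtered out, since it would have no direction;
    the remaining frequencies involve the first variable only and point along [xi]. *)
Definition rootterms N (xi : 'rV[R]_d) (kw : seq (int * R[i])) (x : X) : seq (term N.+1) :=
  [seq (zcons k.1 0, xi, k.2 *: x) | k <- kw & k.1 != 0].

Lemma dirs_root N (xi : nat -> 'rV[R]_d) kw x : xi 0%N != 0 ->
  dirs xi (rootterms N (xi 0%N) kw x).
Proof.
move=> x0 k /mapP[a]; rewrite mem_filter => /andP[a0 _] -> /=; split => //.
have -> : Lam xi (zcons a.1 (0 : 'rV_N)) = fun L => L%:R *: (a.1%:~R *: xi 0%N).
  by apply/funext => L; rewrite Lam_zcons Lam0 addr0.
exact: dirto_base.
Qed.

Lemma tpf_root N xi kw x s (th : 'rV[R]_N) :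
  tpf (rootterms N xi kw x) (vcons s th) =
  (trigsum kw s - \sum_(k <- kw | k.1 == 0) k.2) *: x.
Proof.
rewrite /tpf /rootterms big_map big_filter /trigsum [X in X - _](bigID (fun k => k.1 == 0))/=.
rewrite [X in X + _ - _](eq_bigr (fun k => k.2)) => [|k /eqP->]; last first.
  by rewrite mul0r expi0 mulr1.
rewrite addrC addKr scaler_suml; apply: eq_bigr => k _.
by rewrite dotZ_zcons dotZ0 addr0 scalerA mulrC.
Qed.

Lemma tpg_root N xi kw x s (th : 'rV[R]_N) :
  tpg m (rootterms N xi kw x) (vcons s th) =
  (m xi : R[i]) *: ((trigsum kw s - \sum_(k <- kw | k.1 == 0) k.2) *: x).
Proof.
rewrite -(tpf_root xi kw x s th) /tpg /tpf /rootterms !big_map scaler_sumr.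
by apply: eq_bigr => k _; rewrite scalerA.
Qed.

Lemma tpf_cat N (t1 t2 : seq (term N)) th : tpf (t1 ++ t2) th = tpf t1 th + tpf t2 th.
Proof. exact: big_cat. Qed.

Lemma tpg_cat N (t1 t2 : seq (term N)) th : tpg m (t1 ++ t2) th = tpg m t1 th + tpg m t2 th.
Proof. exact: big_cat. Qed.

Lemma dirs_cat N xi (t1 t2 : seq (term N)) : dirs xi t1 -> dirs xi t2 -> dirs xi (t1 ++ t2).
Proof. by move=> h1 h2 k; rewrite mem_cat => /orP[/h1|/h2]. Qed.

Lemma tpg_bounded N (ts : seq (term N)) : exists2 B, 0 <= B & forall th, normX (tpg m ts th) <= B.
Proof.
exists (\sum_(k <- ts) normc (m k.1.2) * normX k.2).
  by apply: sumr_ge0 => k _; rewrite mulr_ge0 ?normc_ge0 ?normX_ge0.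
move=> th; apply: le_trans (normX_sum _ _) _; apply: ler_sum => k _.
by rewrite normXZ normcM normc_expi mulr1.
Qed.

Lemma bmeas_tpf N (ts : seq (term N)) x : bmeas (fun th => (Psi (x + tpf ts th))%:E).
Proof.
move=> d' S h mh; apply/measurable_EFinP.
by apply: (measurableT_comp (measurable_powR p)); exact: measurable_tpf.
Qed.

Lemma bmeas_tpg N (ts : seq (term N)) y : bmeas (fun th => (Psi (y + tpg m ts th))%:E).
Proof.
rewrite (_ : (fun _ => _) = (fun th => (Psi (y + tpf [seq (k.1, (m k.1.2 : R[i]) *: k.2) | k <- ts] th))%:E)).
  exact: bmeas_tpf.
apply/funext => th; congr ((Psi (y + _))%:E); rewrite /tpf big_map; apply: eq_bigr => k _.
by rewrite /= scalerA mulrC.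
Qed.

Lemma integral_unifE (f : R -> R) : (@unif R).-integrable setT (EFin \o f) ->
  (\int[@unif R]_s (f s)%:E = (mean f)%:E)%E.
Proof. by move=> fi; rewrite /mean fineK//; exact: integrable_fin_num. Qed.

Section node.
Variables (w : R -> R) (q : R).
Hypotheses (tw : trigpoly w) (w01 : forall s, 0 <= w s <= 1) (mw : mean w = q).

Let w0 s : 0 <= w s. Proof. by case/andP: (w01 s). Qed.
Let w1 s : 0 <= 1 - w s. Proof. by rewrite subr_ge0; case/andP: (w01 s). Qed.

Lemma integral_mix (a b : \bar R) : (0 <= a -> 0 <= b ->
  \int[@unif R]_s ((w s)%:E * a + (1 - w s)%:E * b) = q%:E * a + (1 - q)%:E * b)%E.
Proof.
move=> a0 b0; have mW := measurable_trigpoly tw.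
have iw : (@unif R).-integrable setT (EFin \o w).
  by apply: (@unif_integrable _ _ 1) => // s; rewrite ger0_norm//; case/andP: (w01 s).
have i1 : (@unif R).-integrable setT (EFin \o (fun=> 1)) by exact: finite_measure_integrable_cst.
have mW1 : measurable_fun setT ((fun s => 1 - w s) : measurableTypeR R -> R) by exact: measurable_funB.
rewrite ge0_integralD//.
- rewrite ge0_integralZr//; last 2 first.
    by apply/measurable_EFinP.
    by move=> s _; rewrite lee_fin.
  rewrite ge0_integralZr//; last 2 first.
    by apply/measurable_EFinP.
    by move=> s _; rewrite lee_fin.
  rewrite !integral_unifE//; last exact: (integrableB measurableT i1 iw).
  rewrite mw; congr (_ + _%:E * _)%E.
  under eq_fun do rewrite -mulN1r.
  rewrite meanD ?mean_cst ?meanZ ?mw//; first by rewrite mulN1r.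
  rewrite (_ : _ \o _ = (fun s => (-1)%:E * (EFin \o w) s)%E); first exact: integrableZl.
  by apply/funext => s; rewrite /= EFinM.
- by move=> s _; rewrite mule_ge0// lee_fin.
- by apply: emeasurable_funM; [exact/measurable_EFinP|exact: measurable_cst].
- by move=> s _; rewrite mule_ge0// lee_fin.
- by apply: emeasurable_funM; [exact/measurable_EFinP|exact: measurable_cst].
Qed.

Lemma tint_mix N (f g : 'rV[R]_N -> R) (a b : R) : 0 <= a -> 0 <= b ->
  bmeas (fun th => (f th)%:E) -> bmeas (fun th => (g th)%:E) ->
  (forall th, 0 <= f th) -> (forall th, 0 <= g th) ->
  tint (fun th => (a * f th + b * g th)%:E) =
  (a%:E * tint (fun th => (f th)%:E) + b%:E * tint (fun th => (g th)%:E))%E.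
Proof.
move=> a0 b0 mf mg f0 g0.
rewrite -!iintmZl ?lee_fin// -iintmD.
- by apply: eq_iintm => th; rewrite EFinD !EFinM.
- by apply: bmeas_mul => //; exact: bmeas_cst.
- by apply: bmeas_mul => //; exact: bmeas_cst.
- by move=> th; rewrite mule_ge0 ?lee_fin.
- by move=> th; rewrite mule_ge0 ?lee_fin.
Qed.

End node.

(** Rewrites the increment at a branching as the centred polynomial that [rootterms] represents. *)
Lemma affine_comb (a q : R) (u v : X) : q%:C%C *: u + (1 - q)%:C%C *: v = 0 ->
  a%:C%C *: u + (1 - a)%:C%C *: v = (a%:C%C - q%:C%C) *: (u - v).
Proof.
have aff (c : R) : c%:C%C *: u + (1 - c)%:C%C *: v = c%:C%C *: (u - v) + v.
  by rewrite rmorphB rmorph1 scalerBl scale1r scalerBr addrA addrAC.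
move=> h; rewrite -[LHS]subr0 -h !aff opprD addrACA subrr addr0.
by rewrite -scaleNr -scalerDl.
Qed.

Lemma affine_shift (a : R) (x u v : X) :
  a%:C%C *: (x + u) + (1 - a)%:C%C *: (x + v) = x + (a%:C%C *: u + (1 - a)%:C%C *: v).
Proof. by rewrite !scalerDr addrACA -scalerDl -rmorphD/= subrKC scale1r. Qed.

(** At a node the polynomial interpolates between the two subtrees with weights [w] and [1 - w].
    Pointwise convexity and [mean w = q] give the upper bound without loss. The lower bound loses $C
    w (1-w)$, where [C] depends on the size of the vectors; this is why [y] is restricted to a
    ball. *)
Lemma tree_terms xis E : tree xis E -> {in xis, forall xi, xi != 0} ->
  forall (r del : R), 0 < del -> exists ts : seq (term (size xis)),
  [/\ dirs (nth 0 xis) ts,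
    forall x, (tint (fun th => (Psi (x + tpf ts th))%:E) <= (E (fun a _ => Psi (x + a)))%:E)%E &
    forall y, normX y <= r ->
      ((E (fun _ b => Psi (y + b)))%:E <= tint (fun th => (Psi (y + tpg m ts th))%:E) + del%:E)%E].
Proof.
elim=> [_ r del del0|xi xs q xL xR EL ER E0 q01 qx tL IHL tR IHR E0E xi0 r del del0].
  exists [::]; split=> [//|x|y _] /=; first by rewrite /tpf big_nil.
  by rewrite /tpg big_nil leeDl// lee_fin ltW.
have xs0 : {in xs, forall xi, xi != 0} by move=> v hv; apply: xi0; rewrite in_cons hv orbT.
have [q0 q1] := andP q01.
(* The subtrees are entered after the increment of the root, so the radius for them is enlarged by
   the norms of both increments. *)
pose e : R[i] := m xi; pose r' := r + normc e * normX xL + normc e * normX xR.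
have del2 : 0 < del / 2 by rewrite divr_gt0.
have [tsL [dL uL lL]] := IHL xs0 r' _ del2.
have [tsR [dR uR lR]] := IHR xs0 r' _ del2.
have [BL BL0 hBL] := tpg_bounded tsL; have [BR BR0 hBR] := tpg_bounded tsR.
pose M := `|r'| + BL + BR; pose C := 4 * p * M `^ (p - 1) * M.
have p0 : 0 < p := lt_trans ltr01 p1.
have C0 : 0 <= C by rewrite /C !mulr_ge0 ?powR_ge0 ?(ltW p0)// /M !addr_ge0.
(* One half of [del] is spent in the subtrees, the other on the concavity defect [C] times the mean
   of [w (1 - w)]. *)
have eps0 : 0 < del / 2 / (C + 1) by rewrite divr_gt0// ltr_wpDl.
have [w [tw w01 mw mww]] := binary_split q01 eps0.
have w0 s : 0 <= w s by case/andP: (w01 s).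
have w1 s : 0 <= 1 - w s by rewrite subr_ge0; case/andP: (w01 s).
have Cw0 s : 0 <= C * (w s * (1 - w s)) by rewrite mulr_ge0// mulr_ge0.
have [kw hkw] := tw.
have [_ kw0] := mean_trigpoly hkw; rewrite mw in kw0.
have tw' : trigpoly (fun s => 1 + (-1) * w s).
  by apply: trigpolyD; [exact: trigpoly_cst|apply: trigpolyM => //; exact: trigpoly_cst].
have [kw' hkw'] := tw'.
have {}hkw' s : trigsum kw' s = (1 - w s)%:C%C by rewrite -hkw' mulN1r.
exists (extend kw tsL ++ extend kw' tsR ++ rootterms _ xi kw (xL - xR)).
have fE s th : tpf (extend kw tsL ++ extend kw' tsR ++ rootterms _ xi kw (xL - xR)) (vcons s th) =
    (w s)%:C%C *: (xL + tpf tsL th) + (1 - w s)%:C%C *: (xR + tpf tsR th).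
  rewrite !tpf_cat !tpf_extend tpf_root -hkw hkw' kw0.
  by rewrite -(affine_comb (w s) qx) !scalerDr addrA addrC addrACA.
have gE s th : tpg m (extend kw tsL ++ extend kw' tsR ++ rootterms _ xi kw (xL - xR)) (vcons s th) =
    (w s)%:C%C *: (e *: xL + tpg m tsL th) + (1 - w s)%:C%C *: (e *: xR + tpg m tsR th).
  rewrite !tpg_cat !tpg_extend tpg_root -hkw hkw' kw0 -/e.
  have qex : q%:C%C *: (e *: xL) + (1 - q)%:C%C *: (e *: xR) = 0.
    by rewrite !scalerA ![_ * e]mulrC -!scalerA -scalerDr qx scaler0.
  rewrite scalerA mulrC -scalerA [e *: (_ - _)]scalerBr.
  by rewrite -(affine_comb (w s) qex) !scalerDr addrA addrC addrACA.
split.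
- apply: dirs_cat; first exact: dirs_extend.
  by apply: dirs_cat; [exact: dirs_extend|apply: dirs_root; apply: xi0; rewrite mem_head].
- move=> x /=; rewrite E0E EFinD !EFinM.
  set al := tint (fun th => (Psi (x + xL + tpf tsL th))%:E).
  set be := tint (fun th => (Psi (x + xR + tpf tsR th))%:E).
  apply: (@le_trans _ _ (q%:E * al + (1 - q)%:E * be)%E); last first.
    apply: leeD; apply: lee_wpmul2l; rewrite ?lee_fin ?subr_ge0//.
      by apply: le_trans (uL (x + xL)) _; under eq_fun do rewrite -addrA.
    by apply: le_trans (uR (x + xR)) _; under eq_fun do rewrite -addrA.
  have al0 : (0 <= al)%E by apply: iintm_ge0 => th; rewrite lee_fin powR_ge0.
  have be0 : (0 <= be)%E by apply: iintm_ge0 => th; rewrite lee_fin powR_ge0.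
  rewrite -(integral_mix tw w01 mw)//.
  apply: ge0_le_integral_nomeas => s; first by apply: iintm_ge0 => th; rewrite lee_fin powR_ge0.
  rewrite -tint_mix//; [|exact: bmeas_tpf|exact: bmeas_tpf|by move=> th; exact: powR_ge0|by move=> th; exact: powR_ge0].
  apply: le_iintm => th; first by rewrite lee_fin powR_ge0.
  rewrite lee_fin fE; apply: le_trans (normX_pow_convex p1 _ _ (w01 s)).
  rewrite le_eqVlt; apply/orP; left; apply/eqP; congr (Psi _).
  by rewrite -!addrA affine_shift.
- move=> y yr /=; rewrite E0E EFinD !EFinM.
  set al := tint (fun th => (Psi (y + e *: xL + tpg m tsL th))%:E).
  set be := tint (fun th => (Psi (y + e *: xR + tpg m tsR th))%:E).
  have nL : normX (y + e *: xL) <= r'.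
    apply: le_trans (normXD _ _) _; rewrite normXZ /r'.
    have : 0 <= normc e * normX xR by rewrite mulr_ge0 ?normc_ge0 ?normX_ge0.
    lra.
  have nR : normX (y + e *: xR) <= r'.
    apply: le_trans (normXD _ _) _; rewrite normXZ /r'.
    have : 0 <= normc e * normX xL by rewrite mulr_ge0 ?normc_ge0 ?normX_ge0.
    lra.
  apply: (@le_trans _ _ (q%:E * (al + (del / 2)%:E) + (1 - q)%:E * (be + (del / 2)%:E))%E).
    apply: leeD; apply: lee_wpmul2l; rewrite ?lee_fin ?subr_ge0//.
      by apply: le_trans (lL _ nL); under [X in (_ <= (EL X)%:E)%E]eq_fun do under eq_fun do rewrite -addrA.
    by apply: le_trans (lR _ nR); under [X in (_ <= (ER X)%:E)%E]eq_fun do under eq_fun do rewrite -addrA.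
  have al0 : (0 <= al)%E by apply: iintm_ge0 => th; rewrite lee_fin powR_ge0.
  have be0 : (0 <= be)%E by apply: iintm_ge0 => th; rewrite lee_fin powR_ge0.
  have -> : (q%:E * (al + (del / 2)%:E) + (1 - q)%:E * (be + (del / 2)%:E) =
      (q%:E * al + (1 - q)%:E * be) + (del / 2)%:E)%E.
    rewrite !ge0_muleDr ?lee_fin ?(ltW del2)// addeACA -!EFinM -EFinD; congr (_ + _%:E)%E; ring.
  rewrite [X in (_ <= _ + X)%E](_ : _ = (del / 2)%:E + (del / 2)%:E)%E; last by rewrite -EFinD -splitr.
  rewrite addeA; apply: leeD2r.
  rewrite -(integral_mix tw w01 mw)//.
  have mww' : measurable_fun setT ((fun s => w s * (1 - w s)) : measurableTypeR R -> R).
    have mW := measurable_trigpoly tw.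
    by apply: measurable_funM => //; exact: measurable_funB.
  have iww : (@unif R).-integrable setT (EFin \o (fun s => w s * (1 - w s))).
    apply: (@unif_integrable _ _ 1) => // s; rewrite ger0_norm ?mulr_ge0//.
    by rewrite mulr_ile1//; have /andP[] := w01 s; lra.
  apply: (@le_trans _ _ (\int[@unif R]_s (tint (fun th => (Psi (y + tpg m (extend kw tsL ++ extend kw' tsR ++ rootterms _ xi kw (xL - xR)) (vcons s th)))%:E)
     + C%:E * (w s * (1 - w s))%:E))%E).
    apply: ge0_le_integral_nomeas => s.
      by apply: adde_ge0; apply: mule_ge0 => //; rewrite lee_fin.
    rewrite -(iintm_unif_cst (size xs) (C%:E * _)%E) -iintmD; last first.
    - by move=> th; rewrite -EFinM lee_fin.
    - by move=> th; rewrite lee_fin powR_ge0.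
    - exact: bmeas_cst.
    - exact: (bmeas_vcons (s : R) (bmeas_tpg _ y)).
    rewrite -tint_mix//; [|exact: bmeas_tpg|exact: bmeas_tpg|by move=> th; exact: powR_ge0|by move=> th; exact: powR_ge0].
    apply: le_iintm => th; first by rewrite lee_fin addr_ge0// mulr_ge0// ?powR_ge0.
    rewrite -EFinM -EFinD lee_fin gE.
    apply: le_trans (@normX_pow_concave _ _ p p1 _ M _ _ (w01 s) _ _) _.
    + apply: le_trans (normXD _ _) _; rewrite /M; have := hBL th; have := ler_norm r'; lra.
    + apply: le_trans (normXD _ _) _; rewrite /M; have := hBR th; have := ler_norm r'; lra.
    rewrite lerD2r le_eqVlt; apply/orP; left; apply/eqP; congr (Psi _).
    by rewrite -!addrA affine_shift.
  rewrite ge0_integralD//; last 4 first.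
  - by move=> s _; apply: iintm_ge0 => th; rewrite lee_fin powR_ge0.
  - exact: (measurable_iintm_vcons _ (bmeas_tpg _ y) (fun th => ltac:(by rewrite lee_fin powR_ge0))).
  - by move=> s _; rewrite -EFinM lee_fin.
  - by apply: emeasurable_funM; [exact: measurable_cst|exact/measurable_EFinP].
  apply: leeD2l; rewrite ge0_integralZl//; last 2 first.
  - exact/measurable_EFinP.
  - by move=> s _; rewrite lee_fin mulr_ge0.
  rewrite integral_unifE// -EFinM lee_fin.
  apply: (@le_trans _ _ (C * (del / 2 / (C + 1)))); first exact: ler_wpM2l.
  rewrite mulrA ler_pdivrMr ?ltr_wpDl//; nra.
Qed.

Variable c : R.
Hypothesis m_even : forall xi : 'rV[R]_d, m (- xi) = m xi.
Hypothesis m_homog : forall (c : R) (xi : 'rV[R]_d), 0 < c -> m (c *: xi) = m xi.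
Hypothesis m_cont : {within [set xi : 'rV[R]_d | xi != 0], continuous m}.
Hypothesis c0 : 0 <= c.
Hypothesis Tm_le : forall s : seq (('rV[R]_d -> R[i]) * X),
  (forall k, k \in s -> schwartz k.1) ->
  (LpRd p (Tm m s) <= c%:E * LpRd p (tensor s))%E.

(** The initial vector has torus frequency 0. The frequency [xi0] common to all terms provides its
    direction and, by [dirto_step], leaves the other directions unchanged. *)
Lemma tree_transform_le xi0 xis E (x0 : X) : tree xis E -> xi0 != 0 ->
  {in xis, forall xi, xi != 0} ->
  E (fun _ b => Psi ((m xi0 : R[i]) *: x0 + b)) <= c `^ p * E (fun a _ => Psi (x0 + a)).
Proof.
move=> tE xi00 xis0; apply/ler_addgt0Pr => del del0.
have [ts [dts uts lts]] := tree_terms tE xis0 (normX ((m xi0 : R[i]) *: x0)) del0.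
pose ts0 := ((0 : 'rV[int]_(size xis)), xi0, x0) :: ts.
have H k : k \in ts0 -> k.1.2 != 0 /\
    dirto (fun L => L%:R *: (xi0 + Lam (nth 0 xis) k.1.1 L)) k.1.2.
  rewrite in_cons => /predU1P[->|/dts[? ?]] /=; split => //; last exact: dirto_step.
  have -> : (fun L => L%:R *: (xi0 + Lam (nth 0 xis) (0 : 'rV_(size xis)) L)) =
      (fun L => L%:R *: (1%:~R *: xi0)).
    by apply/funext => L; rewrite Lam0 addr0 scale1r.
  exact: dirto_base.
have := transference p1 m_even m_homog m_cont c0 Tm_le H.
under eq_iintm do rewrite /tpg big_cons/= dotZ0 expi0 mulr1 -/(tpg m ts _).
under [X in (_ * X)%E]eq_iintm do rewrite /tpf big_cons/= dotZ0 expi0 scale1r -/(tpf ts _).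
move=> T; rewrite -lee_fin EFinD EFinM.
apply: le_trans (lts _ (lexx _)) _; apply: leeD2r; apply: le_trans T _.
by apply: lee_wpmul2l (uts x0); rewrite lee_fin powR_ge0.
Qed.

End trees.

(** * Norming functionals *)

Section norming_functional.
Context (R : realType) (X : normedModType R[i]).
Implicit Types (q : X -> R) (x y v : X).

Definition sublinear q := [/\ forall x y, q (x + y) <= q x + q y,
  forall (t : R) x, 0 <= t -> q (t%:C%C *: x) <= t * q x & forall x, q x <= normX x].

Lemma sublinear_normX : sublinear (@normX R X).
Proof.
by split=> // [|t x t0]; [exact: normXD|rewrite normXZ normc_real ger0_norm].
Qed.

Lemma sublinear0 q : sublinear q -> q 0 = 0.
Proof.
move=> [qD qZ _]; have h1 := qZ 0 0 (lexx 0); have h2 := qD 0 0.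
by move: h1 h2; rewrite scaler0 mul0r addr0; lra.
Qed.

Lemma sublinear_ge q x : sublinear q -> - q (- x) <= q x.
Proof.
by move=> sq; have [qD _ _] := sq; have := qD x (- x); rewrite subrr (sublinear0 sq); lra.
Qed.

(** It lies below [q] (take [t = 0]). If it equals [q], then [t = 1] gives $q(x) + q(v) \le q(x+v)$,
    hence additivity in the direction [v]. *)
Definition refine q v x : R := inf [set q (x + t%:C%C *: v) - t * q v | t in [set t : R | 0 <= t]].

Lemma refine_lb q v x : sublinear q ->
  lbound [set q (x + t%:C%C *: v) - t * q v | t in [set t : R | 0 <= t]] (- q (- x)).
Proof.
move=> sq; have [qD qZ _] := sq => _ [t /= t0 <-].
rewrite lerBrDr; have [->|tn0] := eqVneq t 0.
  by rewrite mul0r scale0r !addr0 sublinear_ge.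
have h : t * q v <= q (t%:C%C *: v).
  have := qZ t^-1 (t%:C%C *: v); rewrite invr_ge0 => /(_ t0).
  rewrite scalerA -rmorphM/= mulVf// scale1r -(ler_pM2l (_ : 0 < t)) ?lt0r ?tn0//.
  by rewrite mulrA mulfV// mul1r.
apply: le_trans (lerD (lexx _) h) _.
by have := qD (- x) (x + t%:C%C *: v); rewrite addKr; lra.
Qed.

Lemma refine_le q v x t : sublinear q -> 0 <= t ->
  refine q v x <= q (x + t%:C%C *: v) - t * q v.
Proof.
move=> sq t0; apply: ge_inf; first by exists (- q (- x)); exact: refine_lb.
by exists t.
Qed.

Lemma refine_ge q v x (a : R) : (forall t, 0 <= t -> a <= q (x + t%:C%C *: v) - t * q v) ->
  a <= refine q v x.
Proof.
move=> h; apply: lb_le_inf; first by exists (q (x + 0%:C%C *: v) - 0 * q v), 0 => //=.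
by move=> _ [t /= t0 <-]; exact: h.
Qed.

Lemma refine_le_self q v x : sublinear q -> refine q v x <= q x.
Proof.
by move=> sq; have := @refine_le q v x 0 sq (lexx 0); rewrite scale0r addr0 mul0r subr0.
Qed.

Lemma sublinear_refine q v : sublinear q -> sublinear (refine q v).
Proof.
move=> sq; have [qD qZ qN] := sq; split.
- move=> x y; rewrite -lerBlDr; apply: refine_ge => s s0.
  rewrite lerBlDl -lerBlDr; apply: refine_ge => t t0.
  rewrite lerBlDr; apply: le_trans (refine_le v (x + y) sq (addr_ge0 s0 t0)) _.
  have := qD (x + s%:C%C *: v) (y + t%:C%C *: v).
  by rewrite rmorphD/= scalerDl addrACA; lra.
- move=> s x; rewrite le_eqVlt => /predU1P[<-|s0].
    by rewrite scale0r mul0r (le_trans (refine_le_self _ _ sq))// sublinear0.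
  rewrite -ler_pdivrMl//; apply: refine_ge => t t0; rewrite ler_pdivrMl//.
  apply: le_trans (refine_le v _ sq (mulr_ge0 (ltW s0) t0)) _.
  have := qZ s (x + t%:C%C *: v) (ltW s0); rewrite scalerDr scalerA -rmorphM/=; lra.
- by move=> x; exact: le_trans (refine_le_self _ _ sq) (qN x).
Qed.

(** Zorn's lemma. A chain is bounded by its pointwise infimum, which is finite because $q(x) \ge
    -\|x\|$; totality of the chain gives subadditivity. *)
Lemma minimal_sublinear q0 : sublinear q0 -> exists q, [/\ sublinear q, forall x, q x <= q0 x &
  forall q', sublinear q' -> (forall x, q' x <= q x) -> q' = q].
Proof.
move=> sq0; pose T := {q : X -> R | sublinear q /\ forall x, q x <= q0 x}.
pose le_T (q q' : T) := `[< forall x, sval q' x <= sval q x >].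
have ext (q q' : T) : sval q = sval q' -> q = q'.
  by case: q q' => [q h] [q' h'] /= E; subst q'; congr exist; exact: Prop_irrelevance.
have [//|||A totA|t tmax] := @Zorn T le_T.
- by move=> t; apply/asboolP.
- by move=> r s t /asboolP h1 /asboolP h2; apply/asboolP => x; exact: le_trans (h2 x) (h1 x).
- move=> s t /asboolP h1 /asboolP h2; apply: ext; apply/funext => x.
  by apply/eqP; rewrite eq_le h1 h2.
- have [[a0 Aa0]|A0] := pselect (exists a, A a); last first.
    have t0 : T by exists q0.
    by exists t0 => s As; exfalso; apply: A0; exists s.
  pose V x := [set sval a x | a in A].
  have V0 x : V x !=set0 by exists (sval a0 x), a0.
  have Vlb x : has_lbound (V x).
    exists (- normX x) => _ [a _ <-]; have [[_ _ aN] _] := svalP a.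
    have := sublinear_ge x (svalP a).1; have := aN (- x); rewrite normXN; lra.
  pose q x := inf (V x).
  have qle a x : A a -> q x <= sval a x by move=> Aa; apply: ge_inf => //; exists a.
  have sq : sublinear q.
    split.
    + move=> x y; rewrite -lerBlDr; apply: lb_le_inf => // _ [a Aa <-].
      rewrite lerBlDl -lerBlDr; apply: lb_le_inf => // _ [b Ab <-]; rewrite lerBlDr.
      have [ab|ba] := totA a b Aa Ab.
        move/asboolP: ab => ab; have [[bD _ _] _] := svalP b.
        by rewrite (le_trans (qle b _ Ab))// (le_trans (bD _ _))// addrC lerD2l.
      move/asboolP: ba => ba; have [[aD _ _] _] := svalP a.
      by rewrite (le_trans (qle a _ Aa))// (le_trans (aD _ _))// addrC lerD2r.
    + move=> s x s0; have [->|sn0] := eqVneq s 0.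
        rewrite scale0r mul0r (le_trans (qle a0 _ Aa0))//.
        by rewrite sublinear0//; case: (svalP a0).
      have sp : 0 < s by rewrite lt0r sn0.
      rewrite -ler_pdivrMl//; apply: lb_le_inf => // _ [a Aa <-]; rewrite ler_pdivrMl//.
      have [[_ aZ _] _] := svalP a.
      exact: le_trans (qle a _ Aa) (aZ _ _ s0).
    + by move=> x; have [[_ _ aN] _] := svalP a0; exact: le_trans (qle a0 _ Aa0) (aN x).
  have q0le : sublinear q /\ forall x, q x <= q0 x.
    by split=> // x; have [_ h] := svalP a0; exact: le_trans (qle a0 _ Aa0) (h x).
  by exists (exist _ q q0le) => s As; apply/asboolP => x; exact: qle.
exists (sval t); have [st tq0] := svalP t; split=> // q' sq' q't.
have h : sublinear q' /\ forall x, q' x <= q0 x by split=> // x; exact: le_trans (q't x) (tq0 x).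
by rewrite -(tmax (exist _ q' h))//; apply/asboolP.
Qed.

(* A minimal sublinear functional is additive, because it agrees with its refinements. *)
Lemma real_norming v : exists q, [/\ forall x y, q (x + y) = q x + q y,
  forall (t : R) x, q (t%:C%C *: x) = t * q x, forall x, q x <= normX x & q v = normX v].
Proof.
(* Starting from the refinement of the norm at [v] forces $q(-v) \le -\|v\|$, so that [q] attains
   the norm at [v]. *)
have [q [sq qle qmin]] := minimal_sublinear (sublinear_refine v sublinear_normX).
have [qD' qZ' qN] := sq.
have qD x y : q (x + y) = q x + q y.
  apply/eqP; rewrite eq_le qD'/=.
  have E := qmin _ (sublinear_refine y sq) (fun x => refine_le_self y x sq).
  have := refine_le y x sq ler01; rewrite E scale1r mul1r; lra.
have qO x : q (- x) = - q x.
  by apply/eqP; rewrite -subr_eq0 opprK -qD addNr (sublinear0 sq).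
have qZ (t : R) x : q (t%:C%C *: x) = t * q x.
  have h (s : R) y : 0 <= s -> q (s%:C%C *: y) = s * q y.
    move=> s0; apply/eqP; rewrite eq_le qZ'//=.
    by have := qZ' s (- y) s0; rewrite scalerN !qO mulrN lerN2.
  have [t0|t0] := leP 0 t; first exact: h.
  rewrite -[t]opprK rmorphN scaleNr qO mulNr h//; lra.
exists q; split=> //; apply/eqP; rewrite eq_le qN/=.
have := qle (- v); have := @refine_le (@normX R X) v (- v) 1 sublinear_normX ler01.
rewrite scale1r addNr normX0 mul1r qO; lra.
Qed.

(** The complexification $q(x) - i\,q(ix)$ of the real functional; continuity follows from $|q(x)|
    \le \|x\|$. *)
Lemma norming_functional v : exists phi : X -> (R[i])^o,
  [/\ clinfun phi, forall x, complex.Re (phi x) <= normX x & complex.Re (phi v) = normX v].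
Proof.
have [q [qD qZ qN qv]] := real_norming v.
pose phi x : (R[i])^o := (q x +i* - q ('i%C *: x))%C.
have q_norm x : `|q x| <= normX x.
  rewrite ler_norml qN andbT lerNl -[- q x]mulN1r -qZ.
  by rewrite rmorphN1 scaleN1r (le_trans (qN _))// normXN.
exists phi; split=> //; split.
- move=> a x y; rewrite /phi.
  have Ea (z : X) : a *: z = (complex.Re a)%:C%C *: z + (complex.Im a)%:C%C *: ('i%C *: z).
    rewrite scalerA -scalerDl; congr (_ *: _); apply: complexP.
      by rewrite ReD ReM /=; ring.
    by rewrite ImD ImM /=; ring.
  have Ei (z : X) : 'i%C *: ('i%C *: z) = - z.
    by rewrite scalerA -expr2 sqr_i scaleN1r.
  have qO z : q (- z) = - q z by have := qZ (-1) z; rewrite rmorphN1 scaleN1r mulN1r.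
  rewrite scalerDr !qD scalerA mulrC -scalerA !Ea !qD !qZ Ei qO.
  by apply: complexP; rewrite ?ReD ?ImD ?ReM ?ImM /=; ring.
- move=> x; apply/cvgrPdist_lt => e e0.
  have lin (y : X) : normc (phi x - phi y) <= 2 * normX (x - y).
    have qB (a b : X) : q a - q b = q (a - b) by rewrite qD -[- b]scaleN1r -(rmorphN1 (real_complex R)) qZ mulN1r.
    apply: le_trans (normc_le _) _; rewrite /= opprK [- _ + _]addrC !qB -scalerBr.
    rewrite mulr_natl mulr2n; apply: lerD => //; apply: le_trans (q_norm _) _.
    by rewrite normXZ normXC /= expr0n/= add0r expr1n sqrtr1 mul1r.
  have [/eqP ei re] : complex.Im e == 0 /\ 0 < complex.Re e.
    by move: e0; rewrite ltcE /= => /andP[].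
  have e20 : 0 < (complex.Re e / 2)%:C%C :> R[i] by rewrite ltcR divr_gt0.
  apply/nbhs_normP; exists (complex.Re e / 2)%:C%C => //= y.
  rewrite /= normXE ltcR ltr_pdivlMr// mulrC => h.
  by rewrite normCE ltcE/= ei eqxx/= (le_lt_trans (lin y)).
Qed.

End norming_functional.

(** * Discretization of martingale difference sequences *)

Section finite_valued.
Context (T : Type) (G : set (set T)).
Hypothesis sG : sigma_algebra setT G.

Lemma sigmaT : G setT.
Proof. by have [h0 hC _] := sG; rewrite -(setD0 setT); exact: hC. Qed.

Lemma sigmaU A B : G A -> G B -> G (A `|` B).
Proof.
move=> GA GB; have [h0 _ hU] := sG; rewrite -bigcup2E; apply: hU => -[//|[//|n]].
exact: h0.
Qed.

Lemma sigmaI A B : G A -> G B -> G (A `&` B).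
Proof.
move=> GA GB; have [h0 hC _] := sG.
rewrite (_ : A `&` B = setT `\` ((setT `\` A) `|` (setT `\` B))); last first.
  by rewrite !setTD setCU !setCK.
by apply: (hC); apply: sigmaU; apply: hC.
Qed.

Lemma sigma_bigcup_finite (I : choiceType) (D : set I) (F : I -> set T) :
  finite_set D -> (forall i, D i -> G (F i)) -> G (\bigcup_(i in D) F i).
Proof.
move=> /finite_seqP[s ->] GF; rewrite bigcup_seq; have [h0 _ _] := sG.
have {}GF i : i \in s -> G (F i) by exact: GF.
elim: s GF => [|a s IH] GF; first by rewrite big_nil.
rewrite big_cons; apply: sigmaU; first by apply: GF; rewrite mem_head.
by apply: IH => i si; apply: GF; rewrite in_cons si orbT.
Qed.

(** The condition on the approximants in [strongly_meas], for values in any type, for instance in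
    sets when atoms are regarded as functions of the point. *)
Definition fmeas (Y : Type) (g : T -> Y) :=
  finite_set (range g) /\ forall y, G (g @^-1` [set y]).

(** Compositions, sums and the path-dependent transforms of a martingale all have the form
    [K (g w) w]. *)
Lemma fmeas_glue (Y : choiceType) (Z : Type) (g : T -> Y) (K : Y -> T -> Z) :
  fmeas g -> (forall y, fmeas (K y)) -> fmeas (fun w => K (g w) w).
Proof.
move=> [fg mg] hK; split.
  apply: (@sub_finite_set _ _ (\bigcup_(y in range g) range (K y))).
    by move=> _ [w _ <-]; exists (g w); [exists w|exists w].
  by apply: bigcup_finite => // y _; case: (hK y).
move=> z; rewrite (_ : _ @^-1` _ = \bigcup_(y in range g) (g @^-1` [set y] `&` (K y) @^-1` [set z])).
  by apply: sigma_bigcup_finite => // y _; apply: sigmaI => //; case: (hK y).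
apply/seteqP; split=> [w /= h|w [y _ [/= -> h]]//].
by exists (g w) => //; exists w.
Qed.

Lemma fmeas_cst (Y : Type) (y : Y) : fmeas (fun=> y).
Proof.
split.
  apply: (@sub_finite_set _ _ [set y]); last exact: finite_set1.
  by move=> _ [w _ <-].
move=> z; have [->|yz] := pselect (y = z).
  by rewrite (_ : _ @^-1` _ = setT); [exact: sigmaT|apply/seteqP; split].
rewrite (_ : _ @^-1` _ = set0); first by case: sG.
by apply/seteqP; split.
Qed.

Lemma fmeas_comp (Y : choiceType) (Z : Type) (g : T -> Y) (h : Y -> Z) :
  fmeas g -> fmeas (fun w => h (g w)).
Proof. by move=> fg; apply: (@fmeas_glue _ _ g (fun y _ => h y)) => // y; exact: fmeas_cst. Qed.

Lemma fmeas_comp2 (Y Z : choiceType) (W : Type) (g : T -> Y) (g' : T -> Z) (h : Y -> Z -> W) :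
  fmeas g -> fmeas g' -> fmeas (fun w => h (g w) (g' w)).
Proof.
move=> fg fg'; apply: (@fmeas_glue _ _ g (fun y w => h y (g' w))) => // y.
exact: (@fmeas_comp _ _ g' (h y)).
Qed.

Lemma fmeas_preimage (Y : choiceType) (g : T -> Y) (B : set Y) : fmeas g -> G (g @^-1` B).
Proof.
move=> [fg mg].
rewrite (_ : g @^-1` B = \bigcup_(y in range g `&` B) g @^-1` [set y]).
  by apply: sigma_bigcup_finite => //; exact: finite_setIl.
apply/seteqP; split=> [w /= h|w [y [_ By] /= ->]//].
by exists (g w) => //; split => //; exists w.
Qed.

Lemma fmeas_values (Y : choiceType) (g : T -> Y) : fmeas g ->
  exists2 V : seq Y, uniq V & forall w, g w \in V.
Proof.
move=> [/finite_seqP[s sE] _]; exists (undup s); first exact: undup_uniq.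
move=> w; rewrite mem_undup; have : range g (g w) by exists w.
by rewrite sE.
Qed.

End finite_valued.

Section strongly_measurable.
Context (T : Type) (R : realType) (X : normedModType R[i]) (G : set (set T)).
Hypothesis sG : sigma_algebra setT G.
Implicit Types f g : T -> X.

Lemma fmeas_smeas f : fmeas G f -> strongly_meas G f.
Proof. by move=> ff; exists (fun=> f); split=> // w; exact: cvg_cst. Qed.

Lemma smeasD f g : strongly_meas G f -> strongly_meas G g ->
  strongly_meas G (fun w => f w + g w).
Proof.
move=> [s [fs sf]] [t [ft tg]]; exists (fun k w => s k w + t k w); split=> [k|w].
  exact: (@fmeas_comp2 _ _ sG _ _ _ (s k) (t k) (fun x y => x + y)).
by apply: cvgD; [exact: sf|exact: tg].
Qed.

Lemma smeasZ (a : R[i]) f : strongly_meas G f -> strongly_meas G (fun w => a *: f w).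
Proof.
move=> [s [fs sf]]; exists (fun k w => a *: s k w); split=> [k|w].
  exact: (@fmeas_comp _ _ sG _ _ (s k) (fun x => a *: x)).
by apply: cvgZr; exact: sf.
Qed.

Lemma smeasB f g : strongly_meas G f -> strongly_meas G g ->
  strongly_meas G (fun w => f w - g w).
Proof.
move=> sf sg; rewrite (_ : (fun _ => _) = (fun w => f w + (-1) *: g w)).
  by apply: smeasD => //; exact: smeasZ.
by apply/funext => w; rewrite scaleN1r.
Qed.

Lemma smeas_sum (I : eqType) (r : seq I) (F : I -> T -> X) :
  {in r, forall i, strongly_meas G (F i)} -> strongly_meas G (fun w => \sum_(i <- r) F i w).
Proof.
elim: r => [|a r IH] sF.
  rewrite (_ : (fun _ => _) = fun=> 0); last by apply/funext => w; rewrite big_nil.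
  exact/fmeas_smeas/fmeas_cst.
rewrite (_ : (fun _ => _) = fun w => F a w + \sum_(i <- r) F i w).
  apply: smeasD; first by apply: sF; rewrite mem_head.
  by apply: IH => i ir; apply: sF; rewrite in_cons ir orbT.
by apply/funext => w; rewrite big_cons.
Qed.

Lemma smeas_sub (G' : set (set T)) f : G `<=` G' -> strongly_meas G f -> strongly_meas G' f.
Proof. by move=> GG [s [fs sf]]; exists s; split=> // k; have [h1 h2] := fs k; split=> // x; exact: GG. Qed.

End strongly_measurable.

Section measurability.
Context (d0 : measure_display) (T : measurableType d0) (R : realType) (X : normedModType R[i]).
Implicit Types f : T -> X.
Local Notation smeas := (strongly_meas (@measurable d0 T)).

Lemma sigma_measurable : sigma_algebra setT (@measurable d0 T).
Proof.
split; [exact: measurable0|by move=> A mA; exact: measurableD|by move=> F mF; exact: bigcupT_measurable].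
Qed.

Lemma fmeas_measurable (Y : choiceType) d1 (S : measurableType d1) (g : T -> Y) (h : Y -> S) :
  fmeas measurable g -> measurable_fun [set: T] (h \o g).
Proof.
move=> fg _ B mB; rewrite setTI comp_preimage.
exact: (fmeas_preimage sigma_measurable).
Qed.

Lemma lip_cvg (h : X -> R) (u : nat -> X) (x : X) :
  (forall y z, h y - h z <= normX (y - z)) -> u @ \oo --> x -> (fun k => h (u k)) @ \oo --> h x.
Proof.
move=> hl /normX_cvg ux; apply/cvgrPdist_lt => e e0; have := ux _ e0; apply: filterS => k hk.
by apply: le_lt_trans hk; rewrite ler_norml hl andbT lerNl opprB normXC hl.
Qed.

Lemma smeas_lip (h : X -> R) f : (forall y z, h y - h z <= normX (y - z)) ->
  smeas f -> measurable_fun [set: T] ((fun w => h (f w)) : T -> R).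
Proof.
move=> hl [s [fs sf]]; apply: (@measurable_fun_cvg _ _ _ _ (fun k w => h (s k w))).
  by move=> k; exact: (@fmeas_measurable _ _ _ (s k) h).
by move=> w _; apply: lip_cvg => //; exact: sf.
Qed.

Lemma smeas_normX f : smeas f -> measurable_fun [set: T] ((fun w => normX (f w)) : T -> R).
Proof. by apply: smeas_lip => y z; exact: normXBl. Qed.

Lemma smeas_pow (p : R) f : smeas f ->
  measurable_fun [set: T] ((fun w => (normX (f w) `^ p)%:E) : T -> \bar R).
Proof.
move=> sf; apply/measurable_EFinP.
by apply: (measurableT_comp (measurable_powR p)); exact: smeas_normX.
Qed.

End measurability.

Section radial_retraction.
Context (R : realType) (X : normedModType R[i]).
Implicit Types (M : R) (x y : X).

(** Radial truncation is continuous, unlike a cut-off to zero, and therefore passes to pointwise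
    limits of simple functions. *)
Definition retract M x : X := (M / Num.max M (normX x))%:C%C *: x.

Let max_gt0 M x : 0 < M -> 0 < Num.max M (normX x).
Proof. by move=> M0; rewrite lt_max M0. Qed.

Let coef_ge0 M x : 0 < M -> 0 <= M / Num.max M (normX x).
Proof. by move=> M0; apply: divr_ge0; apply: ltW => //; exact: max_gt0. Qed.

Lemma retract_le M x : 0 < M -> normX (retract M x) <= M.
Proof.
move=> M0; have m0 := max_gt0 x M0.
rewrite normXZ normc_real ger0_norm ?coef_ge0// mulrAC ler_pdivrMr//.
by rewrite ler_pM2l// le_max lexx orbT.
Qed.

Lemma retract_id M x : 0 < M -> normX x <= M -> retract M x = x.
Proof.
by move=> M0 xM; rewrite /retract max_l// divff ?gt_eqF// scale1r.
Qed.

Lemma retract_dist M x : 0 < M -> normX (retract M x - x) <= normX x.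
Proof.
move=> M0; have m0 := max_gt0 x M0; rewrite normXC.
rewrite (_ : x - _ = (1 - M / Num.max M (normX x))%:C%C *: x); last first.
  by rewrite rmorphB rmorph1 scalerBl scale1r.
have h : M / Num.max M (normX x) <= 1 by rewrite ler_pdivrMr// mul1r le_max lexx.
rewrite normXZ normc_real ger0_norm ?subr_ge0//.
by rewrite ler_piMl ?normX_ge0// lerBlDr lerDl coef_ge0.
Qed.

Lemma retract_lip M x y : 0 < M -> normX (retract M x - retract M y) <= 2 * normX (x - y).
Proof.
move=> M0; have mx := max_gt0 x M0; have my := max_gt0 y M0.
have lx : M <= Num.max M (normX x) by rewrite le_max lexx.
have ly : normX y <= Num.max M (normX y) by rewrite le_max lexx orbT.
set a := Num.max M (normX x) in mx lx *; set b := Num.max M (normX y) in my ly *.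
have ab : `|b - a| <= normX (x - y).
  have h1 := normXBl x y; have h2 := normXBr x y; have h0 := normX_ge0 (x - y).
  by rewrite /a /b ler_norml !maxEle; case: ifP => ?; case: ifP => ?; lra.
rewrite /retract -/a -/b (_ : _ - _ = (M / a)%:C%C *: (x - y) + (M / a - M / b)%:C%C *: y); last first.
  by rewrite scalerBr rmorphB scalerBl addrA subrK.
rewrite mulr_natl mulr2n; apply: le_trans (normXD _ _) _; apply: lerD.
  rewrite normXZ normc_real ger0_norm ?coef_ge0//.
  by rewrite ler_piMl ?normX_ge0// ler_pdivrMr// mul1r.
rewrite normXZ normc_real.
rewrite (_ : M / a - M / b = (M / a) * ((b - a) / b)); last by field; rewrite !gt_eqF.
rewrite normrM [`|M / a|]ger0_norm ?coef_ge0// normrM normfV [`|b|]gtr0_norm//.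
apply: le_trans ab; rewrite -[leRHS]mul1r -mulrA; apply: ler_pM.
- exact: coef_ge0.
- by rewrite !mulr_ge0 ?normX_ge0// invr_ge0 ltW.
- by rewrite ler_pdivrMr// mul1r.
- by rewrite -mulrA ler_piMr// mulrC ler_pdivrMr// mul1r.
Qed.

End radial_retraction.

Section approximation.
Context (d0 : measure_display) (T : measurableType d0) (R : realType) (X : normedModType R[i])
  (P : probability T R) (p : R).
Hypothesis p1 : 1 < p.
Local Notation smeas := (strongly_meas (@measurable d0 T)).
Local Notation Psi x := (normX x `^ p).

Let p0 : 0 < p. Proof. exact: lt_trans ltr01 p1. Qed.

Lemma le_pow (a b : R) : 0 <= a -> a <= b -> a `^ p <= b `^ p.
Proof.
move=> a0 ab; apply: ge0_ler_powR; rewrite ?nnegrE ?(ltW p0)//; exact: le_trans ab.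
Qed.

Lemma powD_le (a b : R) : 0 <= a -> 0 <= b -> (a + b) `^ p <= 2 `^ p * (a `^ p + b `^ p).
Proof.
move=> a0 b0; have ha := powR_ge0 a p; have hb := powR_ge0 b p.
have h2 : 0 <= (2 : R) `^ p by exact: powR_ge0.
wlog ab : a b a0 b0 ha hb / a <= b.
  move=> H; have [ab|ba] := leP a b; first exact: H.
  by rewrite addrC [_ `^ p + _]addrC; apply: H => //; exact: ltW.
apply: (@le_trans _ _ ((2 * b) `^ p)); first by apply: le_pow; lra.
by rewrite powRM//; apply: ler_wpM2l => //; lra.
Qed.

Lemma PsiD_le (x y : X) : Psi (x + y) <= 2 `^ p * (Psi x + Psi y).
Proof.
apply: le_trans (powD_le (normX_ge0 x) (normX_ge0 y)).
by apply: le_pow; [exact: normX_ge0|exact: normXD].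
Qed.

Lemma powR_lip_cvg (u : nat -> R) (l : R) : (forall n, 0 <= u n) -> u @ \oo --> l ->
  (fun n => u n `^ p) @ \oo --> l `^ p.
Proof.
move=> u0 ul.
have l0 : 0 <= l.
  rewrite -(cvg_lim (@Rhausdorff R) ul); apply: limr_ge; last exact: nearW.
  by apply/cvg_ex; exists l.
have lip (a b B : R) : 0 <= a -> 0 <= b -> a <= B -> b <= B ->
    `|a `^ p - b `^ p| <= p * B `^ (p - 1) * `|a - b|.
  move=> a0 b0 aB bB; rewrite ler_norml; apply/andP; split.
    rewrite lerNl opprB lerBlDl; apply: powR_lip => //.
    by rewrite -lerBlDl distrC ler_norm.
  by rewrite lerBlDl; apply: powR_lip => //; rewrite -lerBlDl ler_norm.
apply/cvgrPdist_le => e e0; pose K := p * (l + 1) `^ (p - 1) + 1.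
have K0 : 0 < K by rewrite ltr_wpDl// mulr_ge0 ?powR_ge0// ltW.
have /cvgrPdist_le H := ul; have h1 := H _ ltr01; have h2 := H _ (divr_gt0 e0 K0).
near=> n; have a1 : `|l - u n| <= 1 by near: n; exact: h1.
have a2 : `|l - u n| <= e / K by near: n; exact: h2.
apply: le_trans (lip l (u n) (l + 1) l0 (u0 n) _ _) _.
- by rewrite lerDl.
- by move: a1; rewrite ler_norml; lra.
apply: (@le_trans _ _ (K * `|l - u n|)).
  by apply: ler_wpM2r => //; rewrite lerDl.
by rewrite -ler_pdivlMl// mulrC.
Unshelve. all: by end_near. Qed.

Lemma Psi_cvg (u : nat -> X) (x y : X) : u @ \oo --> x ->
  (fun n => (Psi (u n - y))%:E) @ \oo --> (Psi (x - y))%:E.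
Proof.
move=> ux; apply: cvg_EFin; first exact: nearW.
apply: powR_lip_cvg => [n|]; first exact: normX_ge0.
apply: (@lip_cvg _ _ (fun v => normX (v - y))) ux => v w.
by apply: le_trans (normXBl _ _) _; rewrite opprB addrA subrK.
Qed.

Lemma retract_cvg (M : R) (u : nat -> X) (x : X) : 0 < M -> u @ \oo --> x ->
  (fun k => retract M (u k)) @ \oo --> retract M x.
Proof.
move=> M0 /normX_cvg ux; apply/normX_cvg => a a0.
have := ux _ (divr_gt0 a0 (ltr0Sn _ 1)); apply: filterS => k hk.
by apply: le_lt_trans (retract_lip _ _ M0) _; rewrite mulrC -ltr_pdivlMr.
Qed.

Lemma cvg_exists_lt (u : nat -> \bar R) (l e : \bar R) : u @ \oo --> l -> (l < e)%E ->
  exists n, (u n < e)%E.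
Proof.
move=> ul le; have /ul[n _ /(_ n (leqnn n)) h] : nbhs l [set y | (y < e)%E].
  by apply: open_nbhs_nbhs; split; [exact: open_ereal_lt_ereal|].
by exists n.
Qed.

(** The pointwise approximants of [f] carry no L^p bound. So [f] is truncated first, dominated by
    itself, and then the truncated approximants converge, dominated by means of the bound [M]. *)
Lemma Lp_simple_approx (G : set (set T)) (f : T -> X) (e : R) :
  sigma_algebra setT G -> G `<=` measurable -> strongly_meas G f ->
  (\int[P]_w (Psi (f w))%:E < +oo)%E -> 0 < e ->
  exists2 S, fmeas G S & (\int[P]_w (Psi (S w - f w))%:E <= e%:E)%E.
Proof.
move=> sG Gm sf fi e0; have [s [fs scf]] := sf.
have sm := sigma_measurable T; have sf' : smeas f by exact: smeas_sub sf.
have fint : P.-integrable setT (fun w => (Psi (f w))%:E).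
  apply/integrableP; split; first exact: smeas_pow.
  by under eq_integral do rewrite gee0_abs ?lee_fin ?powR_ge0//.
have fmM M k : fmeas G (fun w => retract M (s k w)).
  exact: (@fmeas_comp _ _ sG _ _ (s k) (retract M)).
have smM M : 0 < M -> smeas (fun w => retract M (f w)).
  move=> M0; exists (fun k w => retract M (s k w)); split=> [k|w].
    by have [h1 h2] := fmM M k; split=> // x; exact: Gm.
  exact/retract_cvg.
have [n hn] : exists n, (\int[P]_w (Psi (retract n.+1%:R (f w) - f w))%:E < e%:E)%E.
  apply: (@cvg_exists_lt _ (\int[P]_w (cst 0%E w))%E); last by rewrite integral0 lte_fin.
  apply: (@dominated_cvg _ _ _ P setT measurableT _ _ (fun w => (Psi (f w))%:E)) => //.
  - move=> n; apply: smeas_pow; apply: smeasB => //; exact: smM.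
  - move=> w _; have [N hN] : exists N : nat, normX (f w) <= N%:R.
      exists (Num.bound (normX (f w))); apply/ltW/archi_boundP; exact: normX_ge0.
    apply: cvg_near_cst; exists N => // n /= Nn.
    rewrite retract_id ?subrr ?normX0 ?powR0 ?gt_eqF//.
    by rewrite (le_trans hN)// ler_nat (leq_trans Nn).
  - move=> n w _; rewrite gee0_abs ?lee_fin ?powR_ge0//.
    by apply: le_pow; [exact: normX_ge0|exact: retract_dist].
pose M : R := n.+1%:R; have M0 : 0 < M by [].
have [k hk] : exists k, (\int[P]_w (Psi (retract M (s k w) - f w))%:E < e%:E)%E.
  apply: cvg_exists_lt hn.
  apply: (@dominated_cvg _ _ _ P setT measurableT _ _ (fun w => (2 `^ p * (M `^ p + Psi (f w)))%:E)) => //.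
  - move=> k; apply: smeas_pow; apply: smeasB => //.
    by apply: fmeas_smeas => //; have [h1 h2] := fmM M k; split=> // x; exact: Gm.
  - by move=> w _; apply: Psi_cvg; exact: retract_cvg.
  - rewrite (_ : (fun _ => _) = (fun w => (2 `^ p)%:E * ((M `^ p)%:E + (Psi (f w))%:E))%E); last first.
      by apply/funext => w; rewrite EFinM EFinD.
    apply: integrableZl => //; apply: integrableD => //.
    exact: finite_measure_integrable_cst.
  - move=> m w _; rewrite gee0_abs ?lee_fin ?powR_ge0//.
    apply: le_trans (PsiD_le _ _) _; rewrite normXN; apply: ler_wpM2l; first exact: powR_ge0.
    by rewrite lerD2r; apply: le_pow; [exact: normX_ge0|exact: retract_le].
by exists (fun w => retract M (s k w)); [exact: fmM|exact: ltW].
Qed.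

End approximation.

(** * Trees attached to simple martingales *)

Section tree_constructions.
Context (R : realType) (X : normedModType R[i]) (d : nat) (m : 'rV[R]_d -> (R[i])^o).
Local Notation tree := (@tree R X d m).

(** Both children of a node share the list of later directions. Steps with increment zero make
    branches of different depth comparable. *)
Lemma tree_pad xi n xis E : tree xis E ->
  exists2 E', tree (nseq n xi ++ xis) E' & forall Phi, E' Phi = E Phi.
Proof.
move=> tE; elim: n => [|n [E' tE' EE']]; first by exists E.
exists (fun Phi => 1 * E' (fun a b => Phi (0 + a) ((m xi : R[i]) *: (0 : X) + b)) +
       (1 - 1) * E' (fun a b => Phi (0 + a) ((m xi : R[i]) *: (0 : X) + b))).
  apply: (tree_node (q := 1) (xL := 0) (xR := 0) _ _ tE' tE') => //.
    by rewrite ler01 lexx.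
  by rewrite !scaler0 addr0.
move=> Phi; rewrite subrr mul0r addr0 mul1r EE'; congr E.
by apply/funext => a; apply/funext => b; rewrite scaler0 !add0r.
Qed.

Lemma tree_idle xis : exists E, tree xis E.
Proof.
elim: xis => [|xi xis [E tE]]; first by exists (fun Phi => Phi 0 0); exact: tree_leaf.
by have [E' tE' _] := tree_pad xi 1 tE; exists E'.
Qed.

(* A node with several children is a chain of binary nodes having the same direction. *)
Lemma tree_multi xi xis (I : eqType) (q : I -> R) (x : I -> X) (E : I -> (X -> X -> R) -> R) (s : seq I) :
  (forall i, 0 <= q i) -> (forall i, tree xis (E i)) -> 0 < \sum_(i <- s) q i ->
  let Q := \sum_(i <- s) q i in
  let mu := Q^-1%:C%C *: \sum_(i <- s) (q i)%:C%C *: x i in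
  exists2 E', tree (nseq (size s) xi ++ xis) E' & forall Phi, Q * E' Phi =
    \sum_(i <- s) q i * E i (fun a b => Phi (x i - mu + a) ((m xi : R[i]) *: (x i - mu) + b)).
Proof.
move=> q0 tE; elim: s => [|i s IH]; first by rewrite big_nil ltxx.
move=> Qgt0 Q mu; pose Q' := \sum_(j <- s) q j.
have QE : Q = q i + Q' by rewrite /Q big_cons.
have Qn0 : Q != 0 by rewrite gt_eqF.
have Q'0 : 0 <= Q' by apply: sumr_ge0.
have Qmu : Q%:C%C *: mu = (q i)%:C%C *: x i + \sum_(j <- s) (q j)%:C%C *: x j.
  by rewrite scalerA -rmorphM/= divff// scale1r big_cons.
(* If the other children have total weight zero, only [i] counts and the remaining steps are
   padded. *)
have [Q'e|Q'ne] := eqVneq Q' 0.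
  have sq j : j \in s -> q j = 0.
    move=> js; have /eqP := Q'e; rewrite psumr_eq0 => [/allP/(_ j js)|//].
    by rewrite /= => /eqP.
  have Qi : Q = q i by rewrite QE Q'e addr0.
  have mui : mu = x i.
    rewrite /mu big_cons [X in _ + X]big_seq big1 ?addr0 => [|j /sq ->]; last by rewrite scale0r.
    by rewrite scalerA -rmorphM/= -Qi mulVf// scale1r.
  have [E' tE' EE'] := tree_pad xi (size (i :: s)) (tE i).
  exists E' => // Phi; rewrite big_cons big_seq big1 ?addr0 => [|j /sq ->]; last by rewrite mul0r.
  rewrite EE' Qi mui; congr (_ * E i _).
  by apply/funext => a; apply/funext => b; rewrite subrr scaler0 !add0r.
have Q'gt0 : 0 < Q' by rewrite lt0r Q'ne.
have [ER tR RE] := IH Q'gt0; rewrite -/Q' in RE.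
(* The barycentre of the other children: the binary node moves to [x i] or to this point, from which
   the chain continues. *)
set mu' := _ *: _ in RE.
have Qmu' : Q'%:C%C *: mu' = \sum_(j <- s) (q j)%:C%C *: x j.
  by rewrite scalerA -rmorphM/= divff// scale1r.
have [EL tL LE] := tree_pad xi (size s) (tE i).
pose qq := q i / Q.
have qq1 : 1 - qq = Q' / Q by rewrite /qq -{1}(divff Qn0) -mulrBl QE addrAC subrr add0r.
exists (fun Phi => qq * EL (fun a b => Phi (x i - mu + a) ((m xi : R[i]) *: (x i - mu) + b)) +
       (1 - qq) * ER (fun a b => Phi (mu' - mu + a) ((m xi : R[i]) *: (mu' - mu) + b))).
  apply: (tree_node (q := qq) (xL := x i - mu) (xR := mu' - mu) _ _ tL tR) => //.
    by rewrite -[qq <= 1]subr_ge0 qq1 !divr_ge0// (ltW Qgt0).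
  rewrite qq1 /qq !(mulrC _ Q^-1) !rmorphM/= -!scalerA -scalerDr !scalerBr addrACA -opprD.
  by rewrite -scalerDl -rmorphD/= -QE Qmu Qmu' subrr scaler0.
have Qq : Q * qq = q i by rewrite /qq mulrCA divff// mulr1.
have Qq' : Q * (1 - qq) = Q' by rewrite qq1 mulrCA divff// mulr1.
move=> Phi; rewrite [RHS]big_cons [LHS]mulrDr [X in X + _]mulrA [X in _ + X]mulrA Qq Qq' LE RE.
congr (_ + _); apply: eq_bigr => j _; congr (_ * E j _).
apply/funext => a; apply/funext => b; congr Phi.
  by rewrite addrA [_ - _ + (_ - _)]addrC addrA subrK.
by rewrite addrA -scalerDr [_ - _ + (_ - _)]addrC addrA subrK.
Qed.

End tree_constructions.

Section event_tree.
Context (d0 : measure_display) (T : measurableType d0) (R : realType) (X : normedModType R[i])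
  (P : probability T R) (d : nat) (m : 'rV[R]_d -> (R[i])^o).
Local Notation fmeas := (fmeas (@measurable d0 T)).
Local Notation level := ('rV[R]_d * (T -> X) * seq X)%type.
Let sm := sigma_measurable T.

Definition pr (B : set T) : R := fine (P B).

Lemma prE B : measurable B -> P B = (pr B)%:E.
Proof. by move=> mB; rewrite /pr fineK// fin_num_measure. Qed.

Lemma pr_ge0 B : 0 <= pr B.
Proof. by rewrite /pr fine_ge0. Qed.

(* The conditional expectation of the simple function [S], with values listed in [V],
   given the event [B]; it is [0] when [B] has probability [0]. *)
Definition avg (S : T -> X) (V : seq X) (B : set T) : X :=
  (pr B)^-1%:C%C *: \sum_(v <- V) (pr (B `&` S @^-1` [set v]))%:C%C *: v.

(* The transform by [e] of the martingale that reveals the functions of the list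
   successively, started from the event [B]. *)
Fixpoint transform (e : 'rV[R]_d -> R[i]) (Ss : seq level) (B : set T) (w : T) : X :=
  match Ss with
  | [::] => 0
  | k :: Ss' => e k.1.1 *: (k.1.2 w - avg k.1.2 k.2 B) +
      transform e Ss' (B `&` k.1.2 @^-1` [set k.1.2 w]) w
  end.

Definition level_ok (k : level) :=
  [/\ uniq k.2, fmeas k.1.2 & forall w, k.1.2 w \in k.2].

Fixpoint levels_ok (Ss : seq level) : Prop :=
  match Ss with [::] => True | k :: Ss' => level_ok k /\ levels_ok Ss' end.

(** A level with several values becomes a chain of as many binary steps, so its direction is
    repeated. *)
Definition level_dirs (Ss : seq level) : seq 'rV[R]_d :=
  flatten [seq nseq (size k.2) k.1.1 | k <- Ss].

Lemma fmeas_transform e Ss B : levels_ok Ss -> fmeas (transform e Ss B).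
Proof.
elim: Ss B => [|k Ss IH] B /=; first by move=> _; exact: fmeas_cst.
move=> [[_ fS _] ok].
apply: (@fmeas_glue _ _ sm _ _ k.1.2 (fun v w => e k.1.1 *: (v - avg k.1.2 k.2 B) +
  transform e Ss (B `&` k.1.2 @^-1` [set v]) w)) => // v.
apply: (@fmeas_comp _ _ sm _ _ _ (fun x => e k.1.1 *: (v - avg k.1.2 k.2 B) + x)).
exact: IH.
Qed.

Lemma integral_split (Y : choiceType) (g : T -> Y) (V : seq Y) B (f : T -> R) :
  uniq V -> fmeas g -> (forall w, g w \in V) -> measurable B ->
  measurable_fun [set: T] f ->
  (\int[P]_(w in B) (f w)%:E = \sum_(v <- V) \int[P]_(w in B `&` g @^-1` [set v]) (f w)%:E)%E.
Proof.
move=> uV [_ fg] gV mB mf.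
have BE : \big[setU/set0]_(v <- V) (B `&` g @^-1` [set v]) = B.
  rewrite -bigcup_seq; apply/seteqP; split=> [w [v _ []]//|w Bw].
  by exists (g w) => //; exact: gV.
rewrite -{1}BE integral_bigsetU_EFin//.
- by move=> v; apply: measurableI => //; exact: fg.
- by apply/trivIsetP => i j _ _ /eqP ij; apply/seteqP; split=> // w [[_ /= h1] [_ /= h2]]; case: ij; rewrite -h1.
- by apply: measurable_funTS; exact/measurable_EFinP.
Qed.

Lemma pr_split (k : level) B : level_ok k -> measurable B ->
  \sum_(v <- k.2) pr (B `&` k.1.2 @^-1` [set v]) = pr B.
Proof.
move=> ok mB; have [uV [fr fS] SV] := ok; apply: EFin_inj; rewrite -prE//.
have := @integral_split _ k.1.2 k.2 B (cst 1) uV (conj fr fS) SV mB (measurable_cst _).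
rewrite /cst integral_cst// mul1e => ->; rewrite -sumEFin; apply: eq_bigr => v _.
have mBv : measurable (B `&` k.1.2 @^-1` [set v]) by apply: measurableI => //; exact: fS.
by rewrite integral_cst// mul1e; exact/esym/prE.
Qed.

(** The joint law of the two transforms on [B] is the law of a tree. The weight [pr B] is kept in
    front so that null events are covered. *)
Lemma event_tree Ss B : levels_ok Ss -> measurable B ->
  exists E, tree m (level_dirs Ss) E /\ forall Phi, (forall a b, 0 <= Phi a b) ->
  (\int[P]_(w in B) (Phi (transform (fun=> 1) Ss B w) (transform m Ss B w))%:E =
   (pr B * E Phi)%:E)%E.
Proof.
elim: Ss B => [|k Ss IH] B /=.
  move=> _ mB; exists (fun Phi => Phi 0 0); split; first exact: tree_leaf.
  by move=> Phi _; rewrite integral_cst// mulrC EFinM; congr (_ * _)%E; exact: prE.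
move=> [okk ok] mB; have [uV [fr fS] SV] := okk.
have okS : levels_ok (k :: Ss) by [].
have mBv v : measurable (B `&` k.1.2 @^-1` [set v]) by apply: measurableI => //; exact: fS.
(* On a null event both sides vanish for any tree with the prescribed directions. *)
have [B0|Bn0] := eqVneq (pr B) 0.
  have [E tE] := tree_idle X m (level_dirs (k :: Ss)); exists E; split=> // Phi Phi0.
  rewrite B0 mul0r; apply: null_set_integral => //; last first.
    by apply: etrans (prE mB) _; rewrite B0.
  apply: measurable_funTS; apply/measurable_EFinP.
  apply: (@fmeas_measurable _ _ _ _ _ _ id); apply: fmeas_comp2 => //.
    exact: (@fmeas_transform (fun=> 1) (k :: Ss) B).
  exact: (@fmeas_transform m (k :: Ss) B).
have [E hE] := choice (fun v => IH (B `&` k.1.2 @^-1` [set v]) ok (mBv v)).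
have Q0 : 0 < \sum_(v <- k.2) pr (B `&` k.1.2 @^-1` [set v]) by rewrite pr_split// lt0r Bn0 pr_ge0.
have [E' tE' EE'] := tree_multi k.1.1 id (fun v => pr_ge0 _) (fun v => (hE v).1) Q0.
exists E'; split=> // Phi Phi0.
rewrite (integral_split uV (conj fr fS) SV)//.
- rewrite -(pr_split okk mB) EE' -sumEFin; apply: eq_bigr => v _.
  rewrite -(hE v).2; last by move=> a b; exact: Phi0.
  apply: eq_integral => w; rewrite inE => -[_ /= Sv].
  by rewrite Sv scale1r (pr_split okk mB).
- apply: (@fmeas_measurable _ _ _ _ _ _ id); apply: fmeas_comp2 => //.
    exact: (@fmeas_transform (fun=> 1) (k :: Ss) B).
  exact: (@fmeas_transform m (k :: Ss) B).
Qed.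

End event_tree.

Section conditional_expectation.
Context (d0 : measure_display) (T : measurableType d0) (R : realType) (X : normedModType R[i])
  (P : probability T R) (p : R) (d : nat).
Hypothesis p1 : 1 < p.
Local Notation fmeas := (fmeas (@measurable d0 T)).
Local Notation smeas := (strongly_meas (@measurable d0 T)).
Local Notation Psi x := (normX x `^ p).
Let sm := sigma_measurable T.
Let p0 : 0 < p. Proof. exact: lt_trans ltr01 p1. Qed.

(* Young's inequality is the tangent line inequality for [t ^ p] at [a]. *)
Lemma powR_tangent (a t : R) : 0 <= a -> 0 <= t ->
  p * a `^ (p - 1) * t <= t `^ p + (p - 1) * a `^ p.
Proof.
move=> a0 t0; have q0 : 0 < p / (p - 1) by rewrite divr_gt0// subr_gt0.
have pm1 : p - 1 != 0 by rewrite gt_eqF// subr_gt0.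
have pn0 : p != 0 by rewrite gt_eqF.
have := @conjugate_powR R t (a `^ (p - 1)) p (p / (p - 1)) t0 (powR_ge0 _ _) p0 q0.
have -> : (a `^ (p - 1)) `^ (p / (p - 1)) = a `^ p by rewrite -powRrM mulrCA divff// mulr1.
have E : p^-1 + (p / (p - 1))^-1 = 1 by rewrite invf_div; field.
move=> /(_ E) h.
have := ler_wpM2l (ltW p0) h; rewrite mulrDr [p * (t `^ p / p)]mulrC divfK//.
rewrite (_ : p * (a `^ p / (p / (p - 1))) = (p - 1) * a `^ p); last first.
  by rewrite invf_div; field.
by rewrite -mulrA [t * _]mulrC.
Qed.

Lemma le1Dpow (t : R) : 0 <= t -> t <= 1 + t `^ p.
Proof.
move=> t0; have [t1|t1] := leP t 1; first by rewrite (le_trans t1)// lerDl powR_ge0.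
apply: (@le_trans _ _ (t `^ p)); last by rewrite lerDr.
by rewrite -[leLHS]powRr1//; apply: ler_powR; exact: ltW.
Qed.

Lemma bounded_integrable (C : set T) (f : T -> R) (M : R) : measurable C ->
  measurable_fun [set: T] f -> (forall w, `|f w| <= M) -> P.-integrable C (EFin \o f).
Proof.
move=> mC mf fM; apply: (@le_integrable _ _ _ P C mC _ (fun=> M%:E)).
- by apply: measurable_funTS; exact/measurable_EFinP.
- by move=> s _; rewrite lee_fin (le_trans (fM s))// ler_norm.
- exact: finite_measure_integrable_cst.
Qed.

(** The mean of [f] over [C] vanishes against functionals, so the average of [S] is morally that of
    [S - f]. With a functional norming the average, of norm $a$, and the tangent to $t^p$ at $a$,
    integration over [C] gives $(p a^p - (p-1) a^p)\,P(C)$ on the left. *)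
Lemma avg_le (k : 'rV[R]_d * (T -> X) * seq X) (C : set T) (f : T -> X) :
  level_ok k -> measurable C -> smeas f -> (\int[P]_w (Psi (f w))%:E < +oo)%E ->
  (forall phi : X -> (R[i])^o, clinfun phi -> cint P C (fun w => phi (f w)) = 0) ->
  ((pr P C * Psi (avg P k.1.2 k.2 C))%:E <= \int[P]_(w in C) (Psi (k.1.2 w - f w))%:E)%E.
Proof.
move=> okk mC sf fi f0; have [uV [fr fS] SV] := okk.
set S := k.1.2; set v0 := avg _ _ _ _; set a := normX v0.
have ss : smeas S by exact: fmeas_smeas.
have sSf : smeas (fun w => S w - f w) by exact: smeasB.
have I0 : (0 <= \int[P]_(w in C) (Psi (S w - f w))%:E)%E.
  by apply: integral_ge0 => w _; rewrite lee_fin powR_ge0.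
have [C0|Cn0] := eqVneq (pr P C) 0; first by rewrite C0 mul0r.
have [phi [lphi phile phia]] := norming_functional v0.
have a0 : 0 <= a by exact: normX_ge0.
have [phiL phiC] := lphi.
have phiB y z : phi y - phi z = phi (y - z).
  by have := phiL (-1) z y; rewrite scaleN1r mulN1r addrC [in RHS]addrC => ->; rewrite addrC.
pose h y : R := complex.Re (phi y).
have hlip y z : h y - h z <= normX (y - z).
  by rewrite /h -ReN -ReD phiB; exact: phile.
have mhS : measurable_fun [set: T] ((fun w => h (S w)) : T -> R) by exact: smeas_lip.
have mhf : measurable_fun [set: T] ((fun w => h (f w)) : T -> R) by exact: smeas_lip.
have h00 : h 0 = 0.
  by have := phiB 0 0; rewrite subrr subrr /h => <-.
have hN y : `|h y| <= normX y.
  rewrite ler_norml lerNl; have := hlip 0 y; have := hlip y 0.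
  by rewrite h00 subr0 sub0r subr0 normXC subr0; lra.
have ihf : P.-integrable C (EFin \o (fun w => h (f w))).
  apply: (@le_integrable _ _ _ P C mC _ (fun w => (1 + Psi (f w))%:E)).
  - by apply: measurable_funTS; exact/measurable_EFinP.
  - move=> w _; rewrite lee_fin; apply: le_trans (hN _) _.
    by rewrite (le_trans (le1Dpow (normX_ge0 _)))// ler_norm.
  - rewrite (_ : (fun _ => _) = (cst 1%E \+ (fun w => (Psi (f w))%:E))%E)//.
    apply: integrableD => //; first exact: finite_measure_integrable_cst.
    apply: (integrableS measurableT) => //; apply/integrableP; split; first exact: smeas_pow.
    by under eq_integral do rewrite gee0_abs ?lee_fin ?powR_ge0//.
have intf : (\int[P]_(w in C) (h (f w))%:E = 0)%E.
  have /(congr1 (@complex.Re R)) /= := f0 phi lphi.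
  have hfin : (\int[P]_(w in C) (h (f w))%:E)%E \is a fin_num by exact: integrable_fin_num.
  by rewrite -/(h _) => E; rewrite -(fineK hfin); congr EFin.
pose M := \sum_(v <- k.2) normX v.
have SM w : normX (S w) <= M.
  have := SV w; rewrite /M -/S => Vw; rewrite (big_rem _ Vw)/= lerDl.
  by apply: sumr_ge0 => v _; exact: normX_ge0.
have ihS : P.-integrable C (EFin \o (fun w => h (S w))).
  by apply: (@bounded_integrable _ _ M) => // w; exact: le_trans (hN _) (SM w).
have intS : (\int[P]_(w in C) (h (S w))%:E = (pr P C * a)%:E)%E.
  rewrite (integral_split P uV (conj fr fS) SV mC mhS).
  have -> : pr P C * a = \sum_(v <- k.2) pr P (C `&` S @^-1` [set v]) * h v.
    have hS (s : seq X) (c : X -> R) : h (\sum_(v <- s) (c v)%:C%C *: v) = \sum_(v <- s) c v * h v.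
      elim: s => [|v s IH]; first by rewrite !big_nil.
      by rewrite !big_cons -IH /h phiL ReD ReM /= mul0r subr0.
    rewrite -hS /a -phia -/(h v0); have := hS [:: v0] (fun=> pr P C); rewrite !big_seq1 => <-.
    by rewrite /v0 /avg scalerA -rmorphM/= divff// scale1r.
  rewrite -sumEFin; apply: eq_bigr => v _.
  have mCv : measurable (C `&` S @^-1` [set v]) by apply: measurableI => //; exact: fS.
  rewrite (@eq_integral _ _ _ P _ (cst (h v)%:E)); last by move=> w; rewrite inE => -[_ /= <-].
  by rewrite integral_cst// mulrC EFinM; congr (_ * _)%E; exact: (prE P mCv).
have [->|Ifin] := eqVneq (\int[P]_(w in C) (Psi (S w - f w))%:E)%E +oo%E; first exact: leey.
have iPsi : P.-integrable C (EFin \o (fun w => Psi (S w - f w))).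
  apply/integrableP; split; first by apply: measurable_funTS; exact: smeas_pow.
  under eq_integral do rewrite /= ger0_norm ?powR_ge0//.
  by rewrite ltey.
set K := p * a `^ (p - 1).
have Ka : K * a = p * a `^ p.
  rewrite /K -mulrA; congr (_ * _); have [->|an0] := eqVneq a 0.
    by rewrite mulr0 powR0// gt_eqF.
  by rewrite -{2}[a]powRr1// -powRD ?subrK// an0 implybT.
have icst r : P.-integrable C (EFin \o (fun=> r)) by exact: finite_measure_integrable_cst.
have iZ (r : R) (g : T -> R) : P.-integrable C (EFin \o g) -> P.-integrable C (EFin \o (fun w => r * g w)).
  by move=> ig; rewrite (_ : _ \o _ = (fun s => r%:E * (EFin \o g) s)%E); [exact: integrableZl|
    apply/funext => s; rewrite /= EFinM].
have K0 : 0 <= K by rewrite mulr_ge0 ?powR_ge0// ltW.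
have : (\int[P]_(w in C) (K * h (S w))%:E <=
    \int[P]_(w in C) ((Psi (S w - f w))%:E + ((p - 1) * a `^ p)%:E + (K * h (f w))%:E))%E.
  apply: le_integral => //; first exact: iZ.
    apply: integrableD => //; last exact: iZ.
    by apply: integrableD => //; exact: icst.
  move=> w _; rewrite -!EFinD lee_fin.
  have := powR_tangent a0 (normX_ge0 (S w - f w)).
  have := ler_wpM2l K0 (hlip (S w) (f w)); rewrite -/K; lra.
rewrite integralD//; last 2 first.
- by apply: integrableD => //; exact: icst.
- exact: iZ.
rewrite integralD//; last exact: icst.
have IZ (g : T -> R) : P.-integrable C (EFin \o g) ->
    (\int[P]_(w in C) (K * g w)%:E = K%:E * \int[P]_(w in C) (g w)%:E)%E.
  by move=> ig; rewrite -integralZl//; apply: eq_integral => w _; rewrite EFinM.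
rewrite !IZ// intS intf mule0 adde0 integral_cst//.
move=> H; have {}H : (((K * (pr P C * a)) - (p - 1) * a `^ p * pr P C)%:E <= \int[P]_(w in C) (Psi (S w - f w))%:E)%E.
  rewrite EFinB leeBlDr//; apply: le_trans H _; apply: leeD2l.
  by rewrite [in leRHS]EFinM; apply: lee_wpmul2l; [rewrite lee_fin mulr_ge0 ?powR_ge0// subr_ge0 ltW|rewrite -(prE P mC)].
apply: le_trans H; rewrite lee_fin mulrCA Ka; lra.
Qed.

End conditional_expectation.

Section discretization.
Context (d0 : measure_display) (T : measurableType d0) (R : realType) (X : normedModType R[i])
  (P : probability T R) (p : R) (d : nat).
Hypothesis p1 : 1 < p.
Local Notation smeas := (strongly_meas (@measurable d0 T)).
Local Notation Psi x := (normX x `^ p).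
Let sm := sigma_measurable T.
Let p0 : 0 < p. Proof. exact: lt_trans ltr01 p1. Qed.

Lemma integral_lincomb (a b : R) (f g : T -> R) : 0 <= a -> 0 <= b ->
  measurable_fun [set: T] f -> measurable_fun [set: T] g ->
  (forall w, 0 <= f w) -> (forall w, 0 <= g w) ->
  (\int[P]_w (a * f w + b * g w)%:E =
   a%:E * \int[P]_w (f w)%:E + b%:E * \int[P]_w (g w)%:E)%E.
Proof.
move=> a0 b0 mf mg f0 g0.
rewrite -!ge0_integralZl//; try exact/measurable_EFinP; try by move=> w _; rewrite lee_fin.
rewrite -ge0_integralD//.
- by move=> w _; rewrite mule_ge0 ?lee_fin.
- by apply: emeasurable_funM; [exact: measurable_cst|exact/measurable_EFinP].
- by move=> w _; rewrite mule_ge0 ?lee_fin.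
- by apply: emeasurable_funM; [exact: measurable_cst|exact/measurable_EFinP].
Qed.

Lemma smeas_Psi (f : T -> X) : smeas f -> measurable_fun [set: T] ((fun w => Psi (f w)) : T -> R).
Proof. by move=> sf; apply/measurable_EFinP; exact: smeas_pow. Qed.

Lemma PsiZ (z : R[i]) (x : X) : Psi (z *: x) = normc z `^ p * Psi x.
Proof. by rewrite normXZ powRM ?normc_ge0 ?normX_ge0. Qed.

Lemma PsiN (x : X) : Psi (- x) = Psi x.
Proof. by rewrite normXN. Qed.

Lemma int_PsiD (a b : R) (f g : T -> X) : smeas f -> smeas g ->
  (\int[P]_w (Psi (f w))%:E <= a%:E -> \int[P]_w (Psi (g w))%:E <= b%:E ->
   \int[P]_w (Psi (f w + g w))%:E <= (2 `^ p * (a + b))%:E)%E.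
Proof.
move=> sf sg fa gb.
apply: (@le_trans _ _ (\int[P]_w (2 `^ p * Psi (f w) + 2 `^ p * Psi (g w))%:E)%E).
  apply: ge0_le_integral_nomeas => w; first by rewrite lee_fin powR_ge0.
  by rewrite lee_fin -mulrDr PsiD_le.
rewrite integral_lincomb ?powR_ge0//; try exact: smeas_Psi; try by move=> w; exact: powR_ge0.
by rewrite mulrDr EFinD !EFinM; apply: leeD; apply: lee_wpmul2l; rewrite ?lee_fin ?powR_ge0.
Qed.

Lemma int_PsiZ (K a : R) (z : R[i]) (f : T -> X) : smeas f -> normc z <= K ->
  (\int[P]_w (Psi (f w))%:E <= a%:E -> \int[P]_w (Psi (z *: f w))%:E <= (K `^ p * a)%:E)%E.
Proof.
move=> sf zK fa; apply: (@le_trans _ _ (\int[P]_w ((K `^ p)%:E * (Psi (f w))%:E))%E).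
  apply: ge0_le_integral_nomeas => w; first by rewrite lee_fin powR_ge0.
  rewrite -EFinM lee_fin PsiZ; apply: ler_wpM2r; first exact: powR_ge0.
  by apply: le_pow => //; exact: normc_ge0.
rewrite ge0_integralZl// ?lee_fin ?powR_ge0//; last 2 first.
- exact: smeas_pow.
- by move=> w _; rewrite lee_fin powR_ge0.
by rewrite EFinM; apply: lee_wpmul2l; rewrite ?lee_fin ?powR_ge0.
Qed.

Lemma Lp_sum (I : eqType) (r : seq I) (z : I -> R[i]) (F : I -> T -> X) :
  {in r, forall i, smeas (F i)} -> {in r, forall i, (\int[P]_w (Psi (F i w))%:E < +oo)%E} ->
  (\int[P]_w (Psi (\sum_(i <- r) z i *: F i w))%:E < +oo)%E.
Proof.
move=> sF Ffin.
suff [a ha] : exists a, (\int[P]_w (Psi (\sum_(i <- r) z i *: F i w))%:E <= a%:E)%E.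
  exact: le_lt_trans ha (ltry _).
elim: r sF Ffin => [|i r IH] sF Ffin.
  exists 0; rewrite integral0_eq// => w _; rewrite big_nil normX0 powR0// gt_eqF//.
have ir : i \in i :: r by rewrite mem_head.
have rr j : j \in r -> j \in i :: r by move=> jr; rewrite in_cons jr orbT.
have [a {}IH] := IH (fun j jr => sF j (rr j jr)) (fun j jr => Ffin j (rr j jr)).
have [b hb] : exists b, (\int[P]_w (Psi (F i w))%:E <= b%:E)%E.
  exists (fine (\int[P]_w (Psi (F i w))%:E)); rewrite fineK// ge0_fin_numE; first exact: Ffin.
  by apply: integral_ge0 => w _; rewrite lee_fin powR_ge0.
exists (2 `^ p * (normc (z i) `^ p * b + a)).
under eq_integral do rewrite big_cons.
apply: int_PsiD => //.
- by apply: smeasZ => //; exact: sF.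
- by apply: smeas_sum => // j jr; apply: smeasZ => //; exact/sF/rr.
- exact: (int_PsiZ (sF i ir) (lexx _) hb).
Qed.

Variables (G : nat -> set (set T)) (ds : nat -> T -> X) (N : nat).
Hypothesis ds_mds : mds P p G ds N.
Variables (xi : nat -> 'rV[R]_d) (S : nat -> T -> X) (V : nat -> seq X) (del : R).
Hypothesis S_meas : forall n, (1 <= n <= N)%N -> fmeas (G n) (S n).
Hypothesis SV : forall n, (1 <= n <= N)%N -> uniq (V n) /\ forall w, S n w \in V n.
Hypothesis S_ds : forall n, (1 <= n <= N)%N -> (\int[P]_w (Psi (S n w - ds n w))%:E <= del%:E)%E.

Let sG n : sigma_algebra setT (G n). Proof. by case: ds_mds => /(_ n)[]. Qed.
Let Gm n : G n `<=` measurable. Proof. by case: ds_mds => /(_ n)[_ []]. Qed.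
Let GS n : G n `<=` G n.+1. Proof. by case: ds_mds => /(_ n)[_ []]. Qed.

Lemma fmeas_sub (Y : Type) (G1 G2 : set (set T)) (g : T -> Y) : G1 `<=` G2 -> fmeas G1 g -> fmeas G2 g.
Proof. by move=> GG [h1 h2]; split=> // y; exact: GG. Qed.

Definition level_at n : 'rV[R]_d * (T -> X) * seq X := (xi n, S n, V n).

Lemma level_at_ok n : (1 <= n <= N)%N -> level_ok (level_at n).
Proof. by move=> nN; have [h1 h2] := SV nN; split=> //; apply: fmeas_sub (S_meas nN); exact: Gm. Qed.

Lemma levels_at_ok n k : (1 <= k)%N -> (k + n <= N.+1)%N -> levels_ok [seq level_at j | j <- iota k n].
Proof.
elim: n k => [//|n IH] k k1 kn /=; split; first by apply: level_at_ok; rewrite k1/= -ltnS (leq_trans _ kn)// -addn1 leq_add2l.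
by apply: IH => //; rewrite addSnnS.
Qed.

Lemma smeas_ds n : (1 <= n <= N)%N -> smeas (ds n).
Proof. by move=> nN; case: ds_mds => _ /(_ n nN)[h _ _]; exact: smeas_sub h. Qed.

(* [B w] is the atom containing [w] of a finite sub-algebra of [G k]. *)
Definition atoms k (B : T -> set T) :=
  [/\ fmeas (G k) B, forall w, G k (B w), forall w, B w w &
    forall w w', B w w' -> B w' = B w].

Lemma atoms_step k B : (1 <= k.+1 <= N)%N -> atoms k B ->
  atoms k.+1 (fun w => B w `&` S k.+1 @^-1` [set S k.+1 w]).
Proof.
move=> kN [fB GB Bw Beq]; have fS := S_meas kN; split.
- apply: (@fmeas_comp2 _ _ (sG k.+1) _ _ _ B (S k.+1) (fun C v => C `&` S k.+1 @^-1` [set v])) => //.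
  by apply: fmeas_sub fB; exact: GS.
- by move=> w; apply: sigmaI => //; [exact: GS|case: fS].
- by move=> w; split.
- by move=> w w' [/Beq -> /= ->].
Qed.

(** On each atom, an event of [G k], the difference [ds k.+1] has mean zero; [avg_le] is applied
    atom by atom and summed. *)
Lemma avg_error k B : (2 <= k.+1 <= N)%N -> atoms k B ->
  (\int[P]_w (Psi (avg P (S k.+1) (V k.+1) (B w)))%:E <= del%:E)%E.
Proof.
move=> /andP[k2 kN] [fB GB Bw Beq]; have kN' : (1 <= k.+1 <= N)%N by [].
have [_ /(_ _ kN')[_ dfin dmean]] := ds_mds.
apply: le_trans (S_ds kN').
have fBm : fmeas measurable B by apply: fmeas_sub fB; exact: Gm.
have [VB uVB BV] := fmeas_values fBm.
have sS : smeas (S k.+1) by apply: fmeas_smeas; have [_ ? _] := level_at_ok kN'.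
have sd := smeas_ds kN'.
rewrite (integral_split P uVB fBm BV measurableT); last first.
  exact: (@fmeas_measurable _ _ _ _ _ B (fun C => Psi (avg P (S k.+1) (V k.+1) C))).
rewrite (integral_split P uVB fBm BV measurableT); last first.
  by apply: smeas_Psi; exact: smeasB.
apply: lee_sum => C _; rewrite setTI.
have [[w0 BC]|nB] := pselect (exists w0, B w0 = C); last first.
  rewrite (_ : B @^-1` _ = set0) ?integral_set0//.
  by apply/seteqP; split=> // w /= wC; apply: nB; exists w.
have GC : G k C by rewrite -BC.
have -> : B @^-1` [set C] = C.
  apply/seteqP; split=> [w /= <-//|w Cw /=].
  by rewrite -BC; apply: Beq; rewrite BC.
have mC : measurable C by exact: Gm GC.
have := avg_le p1 (level_at_ok kN') mC sd dfin (dmean k2 _ GC).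
rewrite /level_at/=; apply: le_trans.
rewrite (@eq_integral _ _ _ P C (cst (Psi (avg P (S k.+1) (V k.+1) C))%:E)).
  by rewrite integral_cst// mulrC EFinM le_eqVlt; apply/orP; left; apply/eqP; congr (_ * _)%E; exact: (prE P mC).
by move=> w; rewrite inE => Cw; congr (Psi (avg _ _ _ _))%:E; rewrite -BC; apply: Beq; rewrite BC.
Qed.

(** Each level contributes [del] for the approximation and [del] for the subtracted average. The
    powers of 2 come from $\|x+y\|^p \le 2^p(\|x\|^p + \|y\|^p)$. What matters later is linearity in
    [del]. *)
Fixpoint error_cst (K : R) n : R :=
  match n with
  | 0 => 0
  | n'.+1 => 2 `^ p * (K `^ p * (2 `^ p * (del + del)) + error_cst K n')
  end.

Lemma transform_error (e : 'rV[R]_d -> R[i]) (K : R) n k B :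
  (forall j, (1 <= j <= N)%N -> normc (e (xi j)) <= K) ->
  (1 <= k)%N -> (k.+1 + n <= N.+1)%N -> atoms k B ->
  (\int[P]_w (Psi (transform P e [seq level_at j | j <- iota k.+1 n] (B w) w -
      \sum_(j <- iota k.+1 n) e (xi j) *: ds j w))%:E <= (error_cst K n)%:E)%E.
Proof.
move=> eK; elim: n k B => [|n IH] k B k1 kn aB.
  rewrite integral0_eq// => w _; rewrite big_nil/= subr0 normX0 powR0// gt_eqF//.
have kN : (1 <= k.+1 <= N)%N by rewrite /= -ltnS (leq_trans _ kn)// addnS ltnS leq_addr.
have kN2 : (2 <= k.+1 <= N)%N by rewrite ltnS k1; case/andP: kN.
have aB' := atoms_step kN aB.
have IHn := IH k.+1 _ isT _ aB'; rewrite addSnnS in IHn; have {}IHn := IHn kn.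
set B' := (fun w => _) in aB' IHn.
have [fB GB Bw Beq] := aB; have [fB' _ _ _] := aB'.
have fBm : fmeas measurable B by apply: fmeas_sub fB; exact: Gm.
have fBm' : fmeas measurable B' by apply: fmeas_sub fB'; exact: Gm.
have sS : smeas (S k.+1) by apply: fmeas_smeas; have [_ ? _] := level_at_ok kN.
have sd := smeas_ds kN.
pose f1 w := S k.+1 w - ds k.+1 w; pose f2 w := - avg P (S k.+1) (V k.+1) (B w).
have s1 : smeas f1 by exact: smeasB.
have s2 : smeas f2.
  by apply: fmeas_smeas; exact: (@fmeas_comp _ _ sm _ _ B (fun C => - avg P (S k.+1) (V k.+1) C)).
pose f3 w := transform P e [seq level_at j | j <- iota k.+2 n] (B' w) w - \sum_(j <- iota k.+2 n) e (xi j) *: ds j w.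
have s3 : smeas f3.
  apply: smeasB => //.
    apply: fmeas_smeas; apply: (@fmeas_glue _ _ sm _ _ B' (fun C w => transform P e [seq level_at j | j <- iota k.+2 n] C w)) => // C.
    by apply: fmeas_transform; apply: levels_at_ok => //; rewrite addSnnS.
  apply: smeas_sum => // j; rewrite mem_iota => /andP[j1 j2]; apply: smeasZ => //; apply: smeas_ds.
  by rewrite (leq_trans _ j1)//= -ltnS (leq_trans j2)// addSnnS.
have E w : transform P e [seq level_at j | j <- iota k.+1 n.+1] (B w) w -
      \sum_(j <- iota k.+1 n.+1) e (xi j) *: ds j w = e (xi k.+1) *: (f1 w + f2 w) + f3 w.
  rewrite big_cons/= opprD addrACA; congr (_ + _).
  by rewrite -scalerBr /f1 /f2 addrAC.
under eq_integral do rewrite E.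
apply: int_PsiD => //; first by apply: smeasZ => //; exact: smeasD.
apply: int_PsiZ; [exact: smeasD|exact: eK|].
apply: int_PsiD => //; first exact: S_ds.
under eq_integral do rewrite PsiN.
exact: avg_error.
Qed.

Variables (m : 'rV[R]_d -> (R[i])^o) (c : R).
Hypothesis m_even : forall xi : 'rV[R]_d, m (- xi) = m xi.
Hypothesis m_homog : forall (c : R) (xi : 'rV[R]_d), 0 < c -> m (c *: xi) = m xi.
Hypothesis m_cont : {within [set xi : 'rV[R]_d | xi != 0], continuous m}.
Hypothesis c0 : 0 <= c.
Hypothesis Tm_le : forall s : seq (('rV[R]_d -> R[i]) * X),
  (forall k, k \in s -> schwartz k.1) ->
  (LpRd p (Tm m s) <= c%:E * LpRd p (tensor s))%E.
Hypothesis xi_neq0 : forall n, (1 <= n <= N)%N -> xi n != 0.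
Hypothesis N_gt0 : (0 < N)%N.

Definition start w := S 1 @^-1` [set S 1 w].

(** The first difference is unrestricted and is not centred: [S 1] serves as the initial vector of
    the trees. *)
Definition simple_transform (e : 'rV[R]_d -> R[i]) w : X :=
  e (xi 1) *: S 1 w + transform P e [seq level_at j | j <- iota 2 N.-1] (start w) w.

Let N1 : (1 <= 1 <= N)%N. Proof. by []. Qed.
Let N2 : (2 + N.-1 <= N.+1)%N. Proof. by rewrite addSn add1n prednK. Qed.

Lemma atoms_start : atoms 1 start.
Proof.
have fS := S_meas N1; split.
- exact: (@fmeas_comp _ _ (sG 1) _ _ (S 1) (fun v => S 1 @^-1` [set v])).
- by move=> w; case: fS => _; exact.
- by [].
- by move=> w w'; rewrite /start/= => ->.
Qed.

Lemma fmeas_simple_transform e : fmeas measurable (simple_transform e).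
Proof.
have [_ fS _] := level_at_ok N1.
apply: (@fmeas_glue _ _ sm _ _ (S 1) (fun v w => e (xi 1) *: v +
  transform P e [seq level_at j | j <- iota 2 N.-1] (S 1 @^-1` [set v]) w)) => // v.
apply: (@fmeas_comp _ _ sm _ _ _ (fun x => e (xi 1) *: v + x)).
by apply: fmeas_transform; exact: levels_at_ok.
Qed.

Lemma simple_transform_error (e : 'rV[R]_d -> R[i]) (K : R) :
  (forall j, (1 <= j <= N)%N -> normc (e (xi j)) <= K) ->
  (\int[P]_w (Psi (simple_transform e w - \sum_(1 <= j < N.+1) e (xi j) *: ds j w))%:E <=
   (2 `^ p * (K `^ p * del + error_cst K N.-1))%:E)%E.
Proof.
move=> eK; have sS : smeas (S 1) by apply: fmeas_smeas; have [_ ? _] := level_at_ok N1.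
have sd := smeas_ds N1.
have E w : simple_transform e w - \sum_(1 <= j < N.+1) e (xi j) *: ds j w =
    e (xi 1) *: (S 1 w - ds 1 w) + (transform P e [seq level_at j | j <- iota 2 N.-1] (start w) w -
      \sum_(j <- iota 2 N.-1) e (xi j) *: ds j w).
  rewrite big_ltn ?ltnS// /index_iota subSS subn1 opprD addrACA; congr (_ + _).
  by rewrite scalerBr.
under eq_integral do rewrite E.
apply: int_PsiD.
- by apply: smeasZ => //; exact: smeasB.
- apply: smeasB => //.
    have [fB _ _ _] := atoms_start.
    have fBm : fmeas measurable start by apply: fmeas_sub fB; exact: Gm.
    apply: fmeas_smeas; apply: (@fmeas_glue _ _ sm _ _ start (fun C w => transform P e [seq level_at j | j <- iota 2 N.-1] C w)) => // C.
    by apply: fmeas_transform; exact: levels_at_ok.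
  apply: smeas_sum => // j; rewrite mem_iota => /andP[j1 j2]; apply: smeasZ => //; apply: smeas_ds.
  by rewrite (leq_trans _ j1)//= -ltnS (leq_trans j2).
- by apply: int_PsiZ; [exact: smeasB|exact: eK|exact: S_ds].
- exact: transform_error atoms_start.
Qed.

(** On each event where [S 1] has a given value the transform is a tree started at this value, so
    [tree_transform_le] applies and the events are summed. *)
Lemma simple_transform_le :
  (\int[P]_w (Psi (simple_transform m w))%:E <=
   (c `^ p)%:E * \int[P]_w (Psi (simple_transform (fun=> 1%R) w))%:E)%E.
Proof.
have [uV fS SV1] := level_at_ok N1.
have ok := levels_at_ok (isT : (1 <= 2)%N) N2.
rewrite (integral_split P uV fS SV1 measurableT); last first.
  by apply: (@fmeas_measurable _ _ _ _ _ _ (fun x => Psi x)); exact: fmeas_simple_transform.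
rewrite (integral_split P uV fS SV1 measurableT); last first.
  by apply: (@fmeas_measurable _ _ _ _ _ _ (fun x => Psi x)); exact: fmeas_simple_transform.
rewrite ge0_sume_distrr; last first.
  by move=> v _; apply: integral_ge0 => w _; rewrite lee_fin powR_ge0.
apply: lee_sum => v _; rewrite setTI /=.
have mB : measurable (S 1 @^-1` [set v]) by case: fS => _ /(_ v).
have [E [tE hE]] := event_tree P m ok mB.
have l1 : (\int[P]_(w in S 1 @^-1` [set v]) (Psi (simple_transform m w))%:E =
    (pr P (S 1 @^-1` [set v]) * E (fun _ b => Psi ((m (xi 1) : R[i]) *: v + b)))%:E)%E.
  rewrite -hE; last by move=> a b; exact: powR_ge0.
  by apply: eq_integral => w; rewrite inE /simple_transform /start /= => ->.
have l2 : (\int[P]_(w in S 1 @^-1` [set v]) (Psi (simple_transform (fun=> 1) w))%:E =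
    (pr P (S 1 @^-1` [set v]) * E (fun a _ => Psi (v + a)))%:E)%E.
  rewrite -hE; last by move=> a b; exact: powR_ge0.
  by apply: eq_integral => w; rewrite inE /simple_transform /start /= => ->; rewrite scale1r.
rewrite l1 l2 -EFinM lee_fin mulrCA; apply: ler_wpM2l; first exact: pr_ge0.
apply: (tree_transform_le p1 m_even m_homog m_cont c0 Tm_le) tE _ _; first exact: xi_neq0.
rewrite /level_dirs -map_comp => x /flattenP[s /mapP[j + ->]].
rewrite mem_iota => /andP[j1 j2]; rewrite mem_nseq => /andP[_ /eqP ->]; apply: xi_neq0.
by rewrite (leq_trans _ j1)//= -ltnS (leq_trans j2).
Qed.

End discretization.

(** * Martingale transforms *)

Section mds_transform.
Context (d0 : measure_display) (T : measurableType d0) (R : realType) (X : normedModType R[i])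
  (P : probability T R) (p : R) (d : nat).
Hypothesis p1 : 1 < p.
Local Notation smeas := (strongly_meas (@measurable d0 T)).
Local Notation Psi x := (normX x `^ p).
Local Notation I f := (\int[P]_w (Psi (f w))%:E)%E.
Let sm := sigma_measurable T.
Let p0 : 0 < p. Proof. exact: lt_trans ltr01 p1. Qed.

Lemma int_Psi_convex (t : R) (f g : T -> X) : 0 <= t <= 1 -> smeas f -> smeas g ->
  (I (fun w => t%:C%C *: f w + (1 - t)%:C%C *: g w) <= t%:E * I f + (1 - t)%:E * I g)%E.
Proof.
move=> t01 sf sg; have /andP[t0 t1] := t01.
rewrite -integral_lincomb ?subr_ge0//; try exact: smeas_Psi; try by move=> w; exact: powR_ge0.
apply: ge0_le_integral_nomeas => w; first by rewrite lee_fin powR_ge0.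
by rewrite lee_fin normX_pow_convex.
Qed.

(* A perturbation costs an arbitrarily small factor on the main term. *)
Lemma int_Psi_perturb (r a b : R) (f g : T -> X) : 0 < r < 1 -> smeas f -> smeas g ->
  (I g <= a%:E -> I (fun w => g w - f w) <= b%:E ->
   (r `^ p)%:E * I f <= (a + (r / (1 - r)) `^ p * b)%:E)%E.
Proof.
move=> /andP[r0 r1] sf sg ga hb; have r1' : 0 < 1 - r by rewrite subr_gt0.
(* With this factor $r g + (1-r)(-\mathrm{kap})(g - f) = r f$, to which convexity is applied. *)
set kap := r / (1 - r); have k0 : 0 <= kap by rewrite divr_ge0// ltW.
have r01 : 0 <= r <= 1 by rewrite !ltW.
have sh : smeas (fun w => (- kap)%:C%C *: (g w - f w)) by apply: smeasZ => //; exact: smeasB.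
have := int_Psi_convex r01 sg sh.
have E w : r%:C%C *: g w + (1 - r)%:C%C *: ((- kap)%:C%C *: (g w - f w)) = r%:C%C *: f w.
  rewrite scalerA -rmorphM/= /kap mulrN mulrCA divff ?gt_eqF// mulr1 rmorphN scaleNr.
  by rewrite scalerBr opprB addrC subrK.
under eq_integral do rewrite E PsiZ normc_real gtr0_norm// EFinM.
rewrite ge0_integralZl ?lee_fin ?powR_ge0//; last 2 first.
- exact: smeas_pow.
- by move=> w _; rewrite lee_fin powR_ge0.
move=> /le_trans; apply.
have hk : (I (fun w => (- kap)%:C%C *: (g w - f w)) <= (kap `^ p * b)%:E)%E.
  by apply: int_PsiZ => //; [exact: smeasB|rewrite normc_real normrN ger0_norm].
rewrite [leRHS]EFinD; apply: leeD.
  apply: le_trans ga; rewrite -[leRHS]mul1e; apply: lee_wpmul2r; last by rewrite lee_fin ltW.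
  by apply: integral_ge0 => w _; rewrite lee_fin powR_ge0.
apply: le_trans hk; rewrite -[leRHS]mul1e; apply: lee_wpmul2r; last by rewrite lee_fin gerBl ltW.
by apply: integral_ge0 => w _; rewrite lee_fin powR_ge0.
Qed.

Lemma error_cst_linear (K : R) n : exists2 L, 0 <= L & forall del, error_cst p del K n = L * del.
Proof.
elim: n => [|n [L L0 LE]]; first by exists 0 => // del; rewrite mul0r.
exists (2 `^ p * (K `^ p * (2 `^ p * 2) + L)).
  by rewrite mulr_ge0 ?addr_ge0 ?mulr_ge0 ?powR_ge0.
by move=> del; rewrite /= LE; ring.
Qed.

Variables (G : nat -> set (set T)) (ds : nat -> T -> X) (N : nat).
Hypothesis ds_mds : mds P p G ds N.

Lemma smeas_mds_sum (z : nat -> R[i]) : smeas (fun w => \sum_(1 <= n < N.+1) z n *: ds n w).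
Proof.
apply: smeas_sum => // n; rewrite mem_index_iota => nN; apply: smeasZ => //.
exact: smeas_ds ds_mds _ nN.
Qed.

Lemma mds_sum_fin (z : nat -> R[i]) : exists2 a, 0 <= a &
  I (fun w => \sum_(1 <= n < N.+1) z n *: ds n w) = a%:E.
Proof.
have I0 : (0 <= I (fun w => \sum_(1 <= n < N.+1) z n *: ds n w))%E.
  by apply: integral_ge0 => w _; rewrite lee_fin powR_ge0.
exists (fine (I (fun w => \sum_(1 <= n < N.+1) z n *: ds n w))); first exact: fine_ge0.
rewrite fineK// ge0_fin_numE//; apply: Lp_sum => // n; rewrite mem_index_iota => nN.
  exact: smeas_ds ds_mds _ nN.
by have [_ /(_ n nN)[]] := ds_mds.
Qed.

Variables (m : 'rV[R]_d -> (R[i])^o) (c : R) (xi : nat -> 'rV[R]_d).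
Hypothesis m_even : forall xi : 'rV[R]_d, m (- xi) = m xi.
Hypothesis m_homog : forall (c : R) (xi : 'rV[R]_d), 0 < c -> m (c *: xi) = m xi.
Hypothesis m_cont : {within [set xi : 'rV[R]_d | xi != 0], continuous m}.
Hypothesis c0 : 0 <= c.
Hypothesis Tm_le : forall s : seq (('rV[R]_d -> R[i]) * X),
  (forall k, k \in s -> schwartz k.1) ->
  (LpRd p (Tm m s) <= c%:E * LpRd p (tensor s))%E.
Hypothesis xi_neq0 : forall n, (1 <= n <= N)%N -> xi n != 0.

(** Both sides are replaced by their discretizations. For fixed [r] the error vanishes with [del];
    the factors $r^p$, one for each side, are removed at the end. *)
Lemma mds_transform_le :
  (I (fun w => \sum_(1 <= n < N.+1) (m (xi n) : R[i]) *: ds n w) <=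
   (c `^ p)%:E * I (fun w => \sum_(1 <= n < N.+1) ds n w))%E.
Proof.
have [N0|N0] := posnP N.
  rewrite integral0_eq; first by rewrite mule_ge0 ?lee_fin ?powR_ge0// integral_ge0// => w _; rewrite lee_fin powR_ge0.
  by move=> w _; rewrite N0 big_geq// normX0 powR0// gt_eqF.
pose one : 'rV[R]_d -> R[i] := fun=> 1.
have -> : I (fun w => \sum_(1 <= n < N.+1) ds n w) = I (fun w => \sum_(1 <= n < N.+1) one (xi n) *: ds n w).
  by apply: eq_integral => w _; under [in RHS]eq_bigr do rewrite scale1r.
have [a a0 Ea] := mds_sum_fin (fun n => m (xi n)).
have [b b0 Eb] := mds_sum_fin (fun n => one (xi n)).
have sY := smeas_mds_sum (fun n => m (xi n)).
have sX := smeas_mds_sum (fun n => one (xi n)).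
rewrite Ea Eb -EFinM lee_fin.
(* One constant bounding the coefficients of both transforms, by [m] and by 1. *)
pose K := 1 + \sum_(1 <= j < N.+1) normc (m (xi j)).
have sumge0 (r : seq nat) : 0 <= \sum_(j <- r) normc (m (xi j)) by apply: sumr_ge0 => j _; exact: normc_ge0.
have Km j : (1 <= j <= N)%N -> normc (m (xi j)) <= K.
  move=> jN; rewrite /K (big_rem j)/=; last by rewrite mem_index_iota.
  by rewrite addrCA lerDl addr_ge0.
have K1 j : (1 <= j <= N)%N -> normc (one (xi j)) <= K.
  by move=> _; rewrite /one normc_real ?normr1// lerDl.
have [L0 L00 L0E] := error_cst_linear K N.-1.
pose L := 2 `^ p * (K `^ p + L0).
have L_ge0 : 0 <= L by rewrite mulr_ge0 ?addr_ge0 ?powR_ge0.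
have main r : 0 < r < 1 -> r `^ p * (r `^ p * a) <= c `^ p * b.
  move=> r01; have [r0 r1] := andP r01.
  set kap := (r / (1 - r)) `^ p.
  have k0 : 0 <= kap by exact: powR_ge0.
  apply/ler_addgt0Pr => e e0.
  (* The accumulated error is $((c^p + 1)\,\mathrm{kap}\,L)\,del$, which this choice makes at most
     [e]. *)
  pose M := (c `^ p + 1) * kap * L + 1.
  have M0 : 0 < M by rewrite ltr_wpDl// !mulr_ge0// addr_ge0// powR_ge0.
  pose del := e / M; have del0 : 0 < del by rewrite divr_gt0.
  have [_ dsP] := ds_mds; have [sGm _] := ds_mds.
  have /choice[S hS] : forall n, exists S : T -> X, (1 <= n <= N)%N ->
      fmeas (G n) S /\ (I (fun w => S w - ds n w) <= del%:E)%E.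
    move=> n; have [nN|nN] := boolP (1 <= n <= N)%N; last by exists (fun=> 0).
    have [h1 h2 _] := dsP n nN; have [sG [Gm _]] := sGm n.
    by have [S fS IS] := Lp_simple_approx p1 sG Gm h1 h2 del0; exists S.
  have /choice[V hV] : forall n, exists V : seq X, (1 <= n <= N)%N -> uniq V /\ forall w, S n w \in V.
    move=> n; have [nN|nN] := boolP (1 <= n <= N)%N; last by exists [::].
    by have [V uV VS] := fmeas_values (hS n nN).1; exists V.
  have fS n nN := (hS n nN).1; have IS n nN := (hS n nN).2.
  have eY := simple_transform_error p1 ds_mds fS hV IS N0 Km.
  have eX := simple_transform_error p1 ds_mds fS hV IS N0 K1.
  have le1 := simple_transform_le p1 ds_mds fS hV m_even m_homog m_cont c0 Tm_le xi_neq0 N0.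
  rewrite L0E in eY eX.
  have LE : 2 `^ p * (K `^ p * del + L0 * del) = L * del by rewrite /L; ring.
  rewrite LE in eY eX.
  have sX' : smeas (simple_transform P N xi S V one).
    by apply: fmeas_smeas; exact: fmeas_simple_transform ds_mds _ _ _ fS hV N0 one.
  have sY' : smeas (simple_transform P N xi S V m).
    by apply: fmeas_smeas; exact: fmeas_simple_transform ds_mds _ _ _ fS hV N0 m.
  have [x' x'0 Ex'] : exists2 x', 0 <= x' & I (simple_transform P N xi S V one) = x'%:E.
    have I0 : (0 <= I (simple_transform P N xi S V one))%E.
      by apply: integral_ge0 => w _; rewrite lee_fin powR_ge0.
    exists (fine (I (simple_transform P N xi S V one))); first exact: fine_ge0.
    rewrite fineK// ge0_fin_numE//.
    have sXX : smeas (fun w => simple_transform P N xi S V one w - \sum_(1 <= n < N.+1) one (xi n) *: ds n w).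
      exact: smeasB.
    have Eb' : (I (fun w => \sum_(1 <= n < N.+1) one (xi n) *: ds n w) <= b%:E)%E by rewrite Eb.
    have := int_PsiD p1 sXX sX eX Eb'.
    by under eq_integral do rewrite subrK; move=> /le_lt_trans; apply; exact: ltry.
  rewrite Ex' -EFinM in le1.
  have pY := int_Psi_perturb r01 sY sY' le1 eY.
  have Xb : (I (fun w => \sum_(1 <= n < N.+1) one (xi n) *: ds n w) <= b%:E)%E by rewrite Eb.
  have eX' : (I (fun w => \sum_(1 <= n < N.+1) one (xi n) *: ds n w - simple_transform P N xi S V one w) <= (L * del)%:E)%E.
    by under eq_integral do rewrite normXC.
  have pX := int_Psi_perturb r01 sX' sX Xb eX'.
  rewrite Ea -EFinM lee_fin -/kap in pY.
  rewrite Ex' -EFinM lee_fin -/kap in pX.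
  have rp0 : 0 <= r `^ p by exact: powR_ge0.
  have rp1 : r `^ p <= 1 by have := le_pow p1 (ltW r0) (ltW r1); rewrite powR1.
  have cp0 : 0 <= c `^ p by exact: powR_ge0.
  have kL : 0 <= kap * (L * del) by apply: mulr_ge0 => //; apply: mulr_ge0 => //; exact: ltW.
  apply: (@le_trans _ _ (r `^ p * (c `^ p * x' + kap * (L * del)))); first exact: ler_wpM2l.
  apply: (@le_trans _ _ (c `^ p * (r `^ p * x') + kap * (L * del))).
    by rewrite mulrDr mulrCA lerD2l ler_piMl.
  apply: (@le_trans _ _ (c `^ p * (b + kap * (L * del)) + kap * (L * del))).
    by rewrite lerD2r ler_wpM2l.
  rewrite mulrDr -addrA lerD2l.
  rewrite (_ : _ + _ = ((c `^ p + 1) * kap * L) * del); last by ring.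
  rewrite /del mulrCA; apply: ler_piMr; first exact: ltW.
  by rewrite ler_pdivrMr// mul1r lerDl.
(* A natural exponent above $2p$ suffices because $r < 1$, and brings [le_of_expr_lt1] into play. *)
have [D hD] : exists D : nat, 2 * p <= D%:R.
  by exists (Num.bound (2 * p)); apply/ltW/archi_boundP; rewrite mulr_ge0// ltW.
apply: (@le_of_expr_lt1 R a _ D) => // r /[dup] r01 /andP[r0 r1].
have rn0 : r != 0 by rewrite gt_eqF.
apply: le_trans (main r r01); rewrite mulrA -powRD; last by rewrite rn0 implybT.
apply: ler_wpM2r => //; rewrite -powR_mulrn; last exact: ltW.
apply: ger_powR; first by rewrite r0/=; exact: ltW.
by lra.
Qed.

End mds_transform.

(** * From two values of the multiplier to unimodular numbers *)

Section multiplier_extension.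
Context (d0 : measure_display) (T : measurableType d0) (R : realType) (X : normedModType R[i])
  (P : probability T R) (p : R).
Hypothesis p1 : 1 < p.
Local Notation smeas := (strongly_meas (@measurable d0 T)).
Local Notation Psi x := (normX x `^ p).
Local Notation I f := (\int[P]_w (Psi (f w))%:E)%E.
Let p0 : 0 < p. Proof. exact: lt_trans ltr01 p1. Qed.

Variables (G : nat -> set (set T)) (ds : nat -> T -> X) (N : nat).
Hypothesis ds_mds : mds P p G ds N.
Local Notation J z := (I (fun w => \sum_(1 <= n < N.+1) (z n : R[i]) *: ds n w)).

(** Subtracting [b] from a sequence with values [a] and [b] and dividing by [a - b] gives a sequence
    of zeros and ones. *)
Lemma zero_one_multipliers (a b : R[i]) (C B : R) : a != b ->
  (J (fun=> 1) <= B%:E)%E ->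
  (forall del : nat -> bool, (J (fun n => if del n then a else b) <= (C * B)%:E)%E) ->
  forall del : nat -> bool,
  (J (fun n => (del n)%:R) <= (normc (a - b)^-1 `^ p * (2 `^ p * (C + normc b `^ p)) * B)%:E)%E.
Proof.
move=> ab hB hab del; have ab0 : a - b != 0 by rewrite subr_eq0.
have s1 := smeas_mds_sum ds_mds (fun n => if del n then a else b).
have s2 := smeas_mds_sum ds_mds (fun=> 1).
have sZ : smeas (fun w => (- b) *: \sum_(1 <= n < N.+1) (1 : R[i]) *: ds n w).
  by apply: smeasZ => //; exact: sigma_measurable.
have E w : \sum_(1 <= n < N.+1) ((del n)%:R : R[i]) *: ds n w = (a - b)^-1 *:
    (\sum_(1 <= n < N.+1) (if del n then a else b) *: ds n w +
     (- b) *: \sum_(1 <= n < N.+1) (1 : R[i]) *: ds n w).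
  rewrite scaler_sumr -big_split scaler_sumr; apply: eq_bigr => n _ /=.
  rewrite scalerA mulr1 -scalerDl scalerA; congr (_ *: _).
  by case: (del n); rewrite ?mulVf// subrr mulr0.
under eq_integral do rewrite E.
have hZ : (I (fun w => (- b) *: \sum_(1 <= n < N.+1) (1 : R[i]) *: ds n w) <= (normc b `^ p * B)%:E)%E.
  by apply: int_PsiZ => //; rewrite normcN.
have h := int_PsiD p1 s1 sZ (hab del) hZ.
have h' := int_PsiZ p1 (smeasD (sigma_measurable T) s1 sZ) (lexx (normc (a - b)^-1)) h.
by apply: le_trans h' _; rewrite lee_fin le_eqVlt; apply/orP; left; apply/eqP; ring.
Qed.

(** Convexity in one coefficient at a time: [k] bounds the indices whose coefficients may differ
    from 0 and 1, and the coefficient at the last of them is a mean of these two values. *)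
Lemma unit_interval_multipliers (C : R) :
  (forall del : nat -> bool, (J (fun n => (del n)%:R) <= C%:E)%E) ->
  forall l : nat -> R, (forall n, 0 <= l n <= 1) -> (J (fun n => (l n)%:C%C) <= C%:E)%E.
Proof.
move=> H01.
have H k : forall l : nat -> R, (forall n, 0 <= l n <= 1) ->
    (forall n, (k <= n)%N -> l n = 0 \/ l n = 1) -> (J (fun n => (l n)%:C%C) <= C%:E)%E.
  elim: k => [|k IH] l l01 lk.
    apply: le_trans (H01 (fun n => l n == 1)).
    rewrite le_eqVlt; apply/orP; left; apply/eqP; apply: eq_integral => w _.
    congr ((Psi _)%:E); apply: eq_bigr => n _; congr (_ *: _).
    by have [->|->] := lk n isT; rewrite ?eqxx// eq_sym oner_eq0.
  pose upd (r : R) n := if n == k then r else l n.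
  have upd01 r : 0 <= r <= 1 -> forall n, 0 <= upd r n <= 1.
    by move=> r01 n; rewrite /upd; case: ifP.
  have updk r : r = 0 \/ r = 1 -> forall n, (k <= n)%N -> upd r n = 0 \/ upd r n = 1.
    move=> r01 n; rewrite leq_eqVlt => /predU1P[<-|kn]; first by rewrite /upd eqxx.
    by rewrite /upd gtn_eqF//; exact: lk.
  have h1 := IH (upd 1) (upd01 1 ltac:(by rewrite ler01 lexx)) (updk 1 (or_intror erefl)).
  have h0 := IH (upd 0) (upd01 0 ltac:(by rewrite ler01 lexx)) (updk 0 (or_introl erefl)).
  have E w : \sum_(1 <= n < N.+1) (l n)%:C%C *: ds n w =
      (l k)%:C%C *: (\sum_(1 <= n < N.+1) (upd 1 n)%:C%C *: ds n w) +
      (1 - l k)%:C%C *: (\sum_(1 <= n < N.+1) (upd 0 n)%:C%C *: ds n w).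
    rewrite !scaler_sumr -big_split; apply: eq_bigr => n _ /=.
    rewrite !scalerA -scalerDl -!rmorphM -rmorphD; congr (_%:C%C *: _).
    by rewrite /upd; case: eqP => [->|_]; ring.
  under eq_integral do rewrite E.
  have s1 := smeas_mds_sum ds_mds (fun n => (upd 1 n)%:C%C).
  have s2 := smeas_mds_sum ds_mds (fun n => (upd 0 n)%:C%C).
  apply: le_trans (int_Psi_convex P p1 (l01 k) s1 s2) _.
  have /andP[a0 a1] := l01 k.
  apply: (@le_trans _ _ ((l k)%:E * C%:E + (1 - l k)%:E * C%:E)%E).
    by apply: leeD; [apply: lee_wpmul2l h1|apply: lee_wpmul2l h0]; rewrite lee_fin ?subr_ge0.
  by rewrite -!EFinM -EFinD -mulrDl subrKC mul1r.
(* Set to 0 beyond [N], so that only finitely many coefficients have to be treated. *)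
move=> l l01; pose l' n := if (n <= N)%N then l n else 0.
have := H N.+1 l'; rewrite (_ : J (fun n => (l' n)%:C%C) = J (fun n => (l n)%:C%C)); last first.
  apply: eq_integral => w _; congr ((Psi _)%:E); apply: eq_big_nat => n /andP[_ nN].
  by rewrite /l' -ltnS nN.
apply=> n; first by rewrite /l'; case: ifP => // _; rewrite lexx ler01.
by move=> nN; left; rewrite /l' leqNgt nN.
Qed.

(** A number of modulus at most 1 is a combination, with coefficients of modulus 1, of the positive
    and negative parts of its real and imaginary parts, all in [0,1]. The three applications of
    [int_PsiD] produce the constant. *)
Lemma circle_multipliers (C : R) :
  (forall l : nat -> R, (forall n, 0 <= l n <= 1) -> (J (fun n => (l n)%:C%C) <= C%:E)%E) ->
  forall e : nat -> R[i], (forall n, (1 <= n <= N)%N -> normc (e n) <= 1) ->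
  (J e <= (2 `^ p * (2 `^ p * (C + C) + 2 `^ p * (C + C)))%:E)%E.
Proof.
move=> Hl e0 e01; pose e n := if (1 <= n <= N)%N then e0 n else 0.
rewrite (_ : J e0 = J e); last first.
  apply: eq_integral => w _; congr ((Psi _)%:E); apply: eq_big_nat => n nN.
  by rewrite /e ltnS in nN *; rewrite nN.
have e1 n : normc (e n) <= 1.
  by rewrite /e; case: ifP => [/e01//|_]; rewrite (normc_real 0) normr0 ler01.
pose pos (r : R) := Num.max r 0.
have pos01 r : `|r| <= 1 -> 0 <= pos r <= 1.
  by rewrite ler_norml /pos => /andP[h1 h2]; rewrite le_max lexx orbT ge_max h2 ler01.
have posE r : r = pos r - pos (- r) by rewrite /pos !maxEle; case: ifP; case: ifP; lra.
have hRe n : `|complex.Re (e n)| <= 1 by exact: le_trans (normc_Re _) (e1 n).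
have hIm n : `|complex.Im (e n)| <= 1 by exact: le_trans (normc_Im _) (e1 n).
have Z1 (z : R[i]) (a : R) (f : T -> X) : smeas f -> normc z <= 1 ->
    (I f <= a%:E -> I (fun w => z *: f w) <= a%:E)%E.
  by move=> sf z1 fa; have := int_PsiZ p1 sf z1 fa; rewrite powR1 mul1r.
pose F (l : nat -> R) w := \sum_(1 <= n < N.+1) (l n)%:C%C *: ds n w.
have sF l : smeas (F l) by exact: smeas_mds_sum ds_mds (fun n => (l n)%:C%C).
have sm := sigma_measurable T.
have FB (f : nat -> R) : (forall n, `|f n| <= 1) ->
    smeas (fun w => F (fun n => pos (f n)) w + (-1) *: F (fun n => pos (- f n)) w) /\
    (I (fun w => F (fun n => pos (f n)) w + (-1) *: F (fun n => pos (- f n)) w) <= (2 `^ p * (C + C))%:E)%E.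
  move=> f1; have sN : smeas (fun w => (-1) *: F (fun n => pos (- f n)) w) by exact: smeasZ.
  split; first exact: smeasD.
  apply: int_PsiD => //; first by apply: Hl => n; exact: pos01.
  apply: Z1 => //; first by rewrite normcN normc1.
  by apply: Hl => n; apply: pos01; rewrite normrN.
have [sA hA] := FB _ hRe; have [sB hB] := FB _ hIm.
have E w : \sum_(1 <= n < N.+1) e n *: ds n w =
    (F (fun n => pos (complex.Re (e n))) w + (-1) *: F (fun n => pos (- complex.Re (e n))) w) +
    'i%C *: (F (fun n => pos (complex.Im (e n))) w + (-1) *: F (fun n => pos (- complex.Im (e n))) w).
  rewrite /F !scaler_sumr -!big_split scaler_sumr -big_split; apply: eq_bigr => n _ /=.
  rewrite !scalerA -!scalerDl scalerA -scalerDl; congr (_ *: _).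
  rewrite !mulN1r -!rmorphB -!posE.
  by apply: complexP; rewrite ?ReD ?ImD ?ReM ?ImM /=; ring.
under eq_integral do rewrite E.
have i1 : normc 'i%C <= 1 :> R by rewrite /= expr0n/= add0r expr1n sqrtr1.
exact: (int_PsiD p1 sA (smeasZ sm 'i%C sB) hA (Z1 _ _ _ sB i1 hB)).
Qed.

Lemma LpP_le (C : R) (f g : T -> X) : 0 <= C ->
  (I f <= (C `^ p)%:E * I g)%E -> (LpP P p f <= C%:E * LpP P p g)%E.
Proof.
move=> C0; rewrite /LpP; set A := (\int[P]_w _)%E; set B := (\int[P]_w _)%E => H.
have A0 : (0 <= A)%E by apply: integral_ge0 => w _; rewrite lee_fin powR_ge0.
have B0 : (0 <= B)%E by apply: integral_ge0 => w _; rewrite lee_fin powR_ge0.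
have -> : C%:E = poweR (C `^ p)%:E p^-1.
  by rewrite poweR_EFin -powRrM divff ?gt_eqF// powRr1.
rewrite -poweRM ?lee_fin ?powR_ge0//; apply: gt0_ler_poweR => //.
- by rewrite invr_ge0 ltW.
- by rewrite in_itv/= A0 leey.
- by rewrite in_itv/= leey andbT mule_ge0 ?lee_fin ?powR_ge0.
Qed.

End multiplier_extension.

Theorem theorem4p1 (R : realType) (X : completeNormedModType R[i]) (p : R)
  (d : nat) (m : 'rV[R]_d -> (R[i])^o) :
  1 < p ->
  (forall xi : 'rV[R]_d, m (- xi) = m xi) ->
  (forall (c : R) (xi : 'rV[R]_d), 0 < c -> m (c *: xi) = m xi) ->
  {within [set xi : 'rV[R]_d | xi != 0], continuous m} ->
  (UMDconst X p (m @` [set xi : 'rV[R]_d | xi != 0%R]) <= multnorm X p m)%E /\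
  ((UMDconst X p [set z : R[i] | (`|z| = 1)%R] = +oo)%E ->
   (exists xi eta : 'rV[R]_d, [/\ xi != 0, eta != 0 & m xi != m eta]) ->
   multnorm X p m = +oo%E).
Proof.
move=> p1 m_even m_homog m_cont; have p0 : 0 < p := lt_trans ltr01 p1.
split.
  apply: le_ereal_inf_tmp => _ [c [c0 Tm_le] <-]; apply: ereal_inf_lbound; exists c => //; split=> //.
  move=> d0 T P G ds N eps hmds epsA.
  have /choice[xi hxi] : forall n, exists xi : 'rV[R]_d, (1 <= n <= N)%N -> xi != 0 /\ m xi = eps n.
    move=> n; have [nN|nN] := boolP (1 <= n <= N)%N; last by exists 0.
    by have [xi x0 xe] := epsA n nN; exists xi.
  apply: LpP_le => //.
  have := mds_transform_le p1 hmds m_even m_homog m_cont c0 Tm_le (fun n nN => (hxi n nN).1).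
  apply: le_trans; rewrite le_eqVlt; apply/orP; left; apply/eqP; apply: eq_integral => w _.
  by congr ((normX _ `^ p)%:E); apply: eq_big_nat => n nN; rewrite (hxi n nN).2.
move=> UMDoo [xi [eta [xi0 eta0 xieta]]]; apply: contrapT => multfin.
(* Were there no finite constant, [multnorm] would be the infimum of the empty set, which is
   infinite. *)
have [c c0 Tm_le] : exists2 c, 0 <= c & forall s : seq (('rV[R]_d -> R[i]) * X),
    (forall k, k \in s -> schwartz k.1) -> (LpRd p (Tm m s) <= c%:E * LpRd p (tensor s))%E.
  apply: contrapT => H; apply: multfin; rewrite /multnorm (_ : [set _ | _ in _] = set0) ?ereal_inf0//.
  by apply/seteqP; split=> // z [c [c0 Tm_le] _]; apply: H; exists c.
(* [K] and [K2] are the constants of [zero_one_multipliers] and [circle_multipliers], freed from the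
   common factor [b], the p-th moment of the sum of the differences. *)
pose K := normc ((m xi : R[i]) - m eta)^-1 `^ p * (2 `^ p * (c `^ p + normc (m eta) `^ p)).
have K0 : 0 <= K by rewrite !mulr_ge0 ?addr_ge0 ?powR_ge0.
pose K2 := 2 `^ p * (2 `^ p * (K + K) + 2 `^ p * (K + K)).
have K20 : 0 <= K2 by rewrite mulr_ge0 ?addr_ge0 ?mulr_ge0 ?addr_ge0 ?powR_ge0.
suff : (UMDconst X p [set z : R[i] | (`|z| = 1)%R] <= (K2 `^ p^-1)%:E)%E by rewrite UMDoo.
apply: ereal_inf_lbound; exists (K2 `^ p^-1) => //; split; first exact: powR_ge0.
move=> d0 T P G ds N eps hmds eps1; apply: LpP_le => //; first exact: powR_ge0.
rewrite -powRrM mulVf ?gt_eqF// powRr1//.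
have [b b0 Eb] := mds_sum_fin p1 hmds (fun=> 1).
have -> : (\int[P]_w (normX (\sum_(1 <= n < N.+1) ds n w) `^ p)%:E = b%:E)%E.
  by rewrite -Eb; apply: eq_integral => w _; under [in RHS]eq_bigr do rewrite scale1r.
have hab (del : nat -> bool) : (\int[P]_w (normX (\sum_(1 <= n < N.+1)
    (if del n then (m xi : R[i]) else m eta) *: ds n w) `^ p)%:E <= (c `^ p * b)%:E)%E.
  have xi'0 n : (1 <= n <= N)%N -> (if del n then xi else eta) != 0 by case: ifP.
  have := mds_transform_le p1 hmds m_even m_homog m_cont c0 Tm_le xi'0.
  rewrite (_ : \int[P]_w (normX (\sum_(1 <= n < N.+1) ds n w) `^ p)%:E = b%:E)%E.
    rewrite -EFinM; apply: le_trans; rewrite le_eqVlt; apply/orP; left; apply/eqP.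
    apply: eq_integral => w _; congr ((normX _ `^ p)%:E).
    by apply: eq_bigr => n _; case: (del n).
  by rewrite -Eb; apply: eq_integral => w _; under [in RHS]eq_bigr do rewrite scale1r.
have hb : (\int[P]_w (normX (\sum_(1 <= n < N.+1) (1 : R[i]) *: ds n w) `^ p)%:E <= b%:E)%E by rewrite Eb.
have h01 := zero_one_multipliers p1 hmds xieta hb hab.
have hu := unit_interval_multipliers p1 hmds h01.
have eps1' n : (1 <= n <= N)%N -> normc (eps n) <= 1.
  by move=> /eps1 /= h; rewrite -lecR -normCE h.
have := circle_multipliers p1 hmds hu eps1'.
move=> /le_trans; apply; rewrite -EFinM lee_fin le_eqVlt; apply/orP; left; apply/eqP.
by rewrite /K2 -/K; ring.
Qed.
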